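(* Let $g\ge 2$ be an integer and $B$ a connected closed oriented surface with base point $b_0$. If $\Gamma$ and $\Gamma'$ are $\mathcal{C}_0$-charts in $B$ such that $\Gamma'$ is obtained from $\Gamma$ by a chart move of type W, then $w(\Gamma)=w(\Gamma')$ in $\mathbb{Z}_2$.
   Context: **Charts.** Let $\mathcal{X}$ be a set, $\mathcal{R},\mathcal{S}$ sets of words in $\mathcal{X}\cup\mathcal{X}^{-1}$, $\mathcal{C}=(\mathcal{X},\mathcal{R},\mathcal{S})$. Let $\Gamma$ be a finite graph in $B$ (possibly empty or with hoops, i.e. closed edges without vertices) with each edge oriented and labeled by an element of $\mathcal{X}$. For a path $\gamma$ meeting the edges transversely and missing the vertices, the intersection word $w_\Gamma(\gamma)$ is obtained by reading along $\gamma$ the labels of the edges crossed, with exponent $+1$ or $-1$ according to the direction of crossing (a fixed convention, e.g. $+1$ if the edge crosses $\gamma$ from right to left). For a vertex $v$, $m_v$ is a small counterclockwise loop around $v$. $\Gamma$ is a $\mathcal{C}$-chart if its vertices are divided into white and black vertices such that $w_\Gamma(m_v)$ is a cyclic permutation of an element of $\mathcal{R}\cup\mathcal{R}^{-1}$ if $v$ is white, and of an element of $\mathcal{S}$ if $v$ is black. A white vertex $v$ is of type $r$ (resp. $r^{-1}$), $r\in\mathcal{R}$, if $w_\Gamma(m_v)^{-1}$ is a cyclic permutation of $r$ (resp. $r^{-1}$). Charts are disjoint from the base point $b_0$. **$\mathcal{C}_0$-charts.** $\mathcal{C}_0=(\mathcal{X}_0,\mathcal{R}_0,\mathcal{S}_0)$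 with $\mathcal{X}_0=\{\xi_1,\ldots,\xi_{2g+1}\}$; $\mathcal{R}_0$ consists of $r_1(i,j)=\xi_i\xi_j\xi_i^{-1}\xi_j^{-1}$ ($1\le i<j-1\le 2g$), $r_2(i)=\xi_i\xi_{i+1}\xi_i\xi_{i+1}^{-1}\xi_i^{-1}\xi_{i+1}^{-1}$ ($1\le i\le 2g$), $r_3=\xi_1\xi_2\cdots\xi_{2g+1}\xi_{2g+1}\cdots\xi_2\xi_1$, $r_4=(\xi_1\xi_2\cdots\xi_{2g+1})^{2g+2}$; $\mathcal{S}_0$ consists of $\xi_i^{\pm1}$ ($1\le i\le 2g+1$) and $\ell_h^{\pm1}$, $\ell_h=(\xi_1\xi_2\cdots\xi_{2h})^{4h+2}$ ($1\le h\le[g/2]$). (The group $\langle\mathcal{X}_0\mid\mathcal{R}_0\rangle$ is the mapping class group $\mathcal{M}_{0,2g+2}$ of $S^2$ with $2g+2$ marked points.) **The number $w$.** For a $\mathcal{C}_0$-chart $\Gamma$, $w(\Gamma)\in\mathbb{Z}_2$ is the number modulo 2 of white vertices of types $r_4^{\pm1}$ in $\Gamma$. **Chart move of type W.** $\Gamma'$ is obtained from $\Gamma$ by a chart move of type W if there is a disk $D$ embedded in $B-\{b_0\}$ whose boundary meets $\Gamma$ and $\Gamma'$ transversely such that $\Gamma\cap(B-\mathrm{Int}\,D)=\Gamma'\cap(B-\mathrm{Int}\,D)$ and both $\Gamma\cap D$ and $\Gamma'\cap D$ contain no black vertices. *)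

(* Defs.v *)
From HB Require Import structures.
From mathcomp Require Import all_boot all_order all_algebra.
From mathcomp Require Import all_classical all_reals all_analysis.
From Stdlib Require List.

Set Implicit Arguments.
Unset Strict Implicit.
Unset Printing Implicit Defensive.
Import Order.TTheory GRing.Theory Num.Theory.
Import numFieldNormedType.Exports.
Local Open Scope classical_set_scope.
Local Open Scope ring_scope.

(* ---- Words in X and its formal inverses ---- *)

(* (x, true) is the letter x and (x, false) is its formal inverse. *)
Definition word (X : Type) := seq (X * bool).

Definition winv (X : Type) (w : word X) : word X :=
  rev [seq (l.1, ~~ l.2) | l <- w].

Definition wpow (X : Type) (w : word X) (n : nat) : word X :=
  flatten (nseq n w).

Definition cyclic_perm (X : Type) (w w' : word X) : Prop :=
  exists k : nat, w' = rot k w.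

(* The triple (X, R, S), the alphabet X being a parameter. *)
Record system (X : Type) := System {
  relators : set (word X);
  singular_words : set (word X) }.

(* ---- Oriented surfaces ---- *)

Definition circle {R : realType} (t : R) : R * R :=
  (cos (2 * pi * t), sin (2 * pi * t)).

Definition dilate {R : realType} (s : R) (z : R * R) : R * R :=
  (s * z.1, s * z.2).

Definition closed_disk {R : realType} : set (R * R) :=
  [set z | z.1 ^+ 2 + z.2 ^+ 2 <= 1].

Definition open_disk {R : realType} : set (R * R) :=
  [set z | z.1 ^+ 2 + z.2 ^+ 2 < 1].

(* Coordinate charts: homeomorphisms from an open subset of B onto an open
   subset of the plane. The values of [to_plane] outside [cdom], and of
   [from_plane] outside [cimg], are irrelevant. *)
Record coord_chart (R : realType) (B : topologicalType) := CoordChart {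
  cdom : set B;
  cimg : set (R * R);
  to_plane : B -> R * R;
  from_plane : R * R -> B;
  cdom_open : open cdom;
  cimg_open : open cimg;
  to_plane_img : forall p, cdom p -> cimg (to_plane p);
  from_plane_dom : forall z, cimg z -> cdom (from_plane z);
  to_planeK : forall p, cdom p -> from_plane (to_plane p) = p;
  from_planeK : forall z, cimg z -> to_plane (from_plane z) = z;
  to_plane_continuous : {in cdom, continuous to_plane};
  from_plane_continuous : {in cimg, continuous from_plane} }.

(* f has local degree +1 at z: the f-image of each small counterclockwise
   circle around z has winding number +1 around f z, as witnessed by a
   continuous choice [theta] of the angle, measured in full turns. *)
Definition orientation_preserving_at {R : realType}
    (f : R * R -> R * R) (z : R * R) : Prop :=
  \forall r \near (0 : R)^'+, exists theta : R -> R,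
    [/\ {within `[0, 1], continuous theta},
        theta 1 = theta 0 + 1 &
        forall t, 0 <= t <= 1 -> exists2 m : R, 0 < m &
          f (z + dilate r (circle t)) = f z + dilate m (circle (theta t))].

Definition compatible (R : realType) (B : topologicalType)
    (c c' : coord_chart R B) : Prop :=
  forall p, cdom c p -> cdom c' p ->
    orientation_preserving_at (to_plane c' \o from_plane c) (to_plane c p).

(* A topological surface structure with an orientation, given by its maximal
   atlas of positively oriented charts. *)
Record oriented_surface (R : realType) (B : topologicalType) :=
  OrientedSurface {
    atlas : set (coord_chart R B);
    atlas_cover : forall p, exists2 c, atlas c & cdom c p;
    atlas_compatible : forall c c', atlas c -> atlas c' -> compatible c c';
    atlas_maximal : forall c,
      (forall c', atlas c' -> compatible c c' /\ compatible c' c) ->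
      atlas c }.

(* ---- Labelled oriented graphs in a surface ---- *)

(* Raw data. An edge that is not a hoop is parametrized by [0, 1], its interior
   by ]0, 1[; a hoop is parametrized by the whole line, with period 1. The
   orientation of an edge is the direction of increasing parameter. *)
Record graph_data (R : realType) (B : topologicalType) (X : Type) := GraphData {
  vertex : finType;
  edge : finType;
  position : vertex -> B;
  is_hoop : pred edge;
  epath : edge -> R -> B;
  label : edge -> X;
  black : pred vertex }.

Definition edom (R : realType) (B : topologicalType) (X : Type)
    (G : graph_data R B X) (e : edge G) : set R :=
  if is_hoop e then setT else `]0, 1[%classic.

Definition support (R : realType) (B : topologicalType) (X : Type)
    (G : graph_data R B X) : set B :=
  [set p | (exists v : vertex G, p = position v) \/
           (exists (e : edge G) (s : R), edom e s /\ p = epath e s)].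

(* c carries a neighbourhood of the point [epath e s], which it sends to the
   origin, to a neighbourhood of the origin in which the graph is the
   horizontal axis, directed to the right. *)
Definition flat_chart (R : realType) (B : topologicalType)
    (S : oriented_surface R B) (X : Type) (G : graph_data R B X)
    (e : edge G) (s : R) (c : coord_chart R B) : Prop :=
  [/\ atlas S c,
      cdom c (epath e s),
      to_plane c (epath e s) = 0,
      (\forall z \near (0 : R * R), support G (from_plane c z) <-> z.2 = 0) &
      \forall u \near s & u' \near s, u < u' ->
        (to_plane c (epath e u)).1 < (to_plane c (epath e u')).1].

Record is_graph (R : realType) (B : topologicalType)
    (S : oriented_surface R B) (X : Type) (G : graph_data R B X) : Prop :=
  IsGraph {
    position_inj : injective (@position R B X G);
    epath_continuous : forall e : edge G,
      {within `[0, 1], continuous (epath e)};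
    hoop_periodic : forall e : edge G, is_hoop e ->
      forall s, epath e (s + 1) = epath e s;
    edge_ends : forall e : edge G, ~~ is_hoop e ->
      (exists v : vertex G, epath e 0 = position v) /\
      (exists v : vertex G, epath e 1 = position v);
    edge_not_vertex : forall (e : edge G) s (v : vertex G),
      edom e s -> epath e s <> position v;
    edge_inj : forall (e e' : edge G) s s', edom e s -> edom e' s' ->
      epath e s = epath e' s' ->
      e = e' /\ (s = s' \/ is_hoop e /\ s - s' \is a Num.int);
    (* Tameness: automatic by the Schoenflies theorem, and implicit in the
       notion of transversality. *)
    edge_flat : forall (e : edge G) s, edom e s ->
      exists c, flat_chart S e s c }.

(* ---- Transverse paths and intersection words ---- *)

(* At time t the path gamma crosses an edge transversely: in a suitable
   positively oriented chart the edge is the horizontal axis directed to the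
   right, and gamma runs along the vertical axis. The exponent is +1 when gamma
   runs downwards, i.e. when the edge crosses gamma from right to left. *)
Definition crossing (R : realType) (B : topologicalType)
    (S : oriented_surface R B) (X : Type) (G : graph_data R B X)
    (gamma : R -> B) (t : R) (l : X * bool) : Prop :=
  exists (e : edge G) (s : R) (c : coord_chart R B),
    [/\ edom e s, gamma t = epath e s, label e = l.1, flat_chart S e s c &
        (\forall u \near t,
           cdom c (gamma u) /\ (to_plane c (gamma u)).1 = 0) /\
        (\forall u \near t & u' \near t, u < u' ->
           if l.2 then (to_plane c (gamma u')).2 < (to_plane c (gamma u)).2
           else (to_plane c (gamma u)).2 < (to_plane c (gamma u')).2)].

(* w is the intersection word of the path gamma, defined on [0, 1]. *)
Definition intersection_word (R : realType) (B : topologicalType)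
    (S : oriented_surface R B) (X : Type) (G : graph_data R B X)
    (gamma : R -> B) (w : word X) : Prop :=
  {within `[0, 1], continuous gamma} /\
  exists ts : seq R,
    [/\ sorted (fun x y => x < y) ts,
        {in ts, forall t, 0 < t < 1},
        (forall t, 0 <= t <= 1 -> (support G (gamma t) <-> t \in ts)) &
        List.Forall2 (crossing S G gamma) ts w].

(* m is a small counterclockwise loop around v: in a positively oriented chart
   centred at v, it is a circle inside a ball which contains no other vertex
   and in which the graph is a union of straight rays from the origin. *)
Definition meridian (R : realType) (B : topologicalType)
    (S : oriented_surface R B) (X : Type) (G : graph_data R B X)
    (v : vertex G) (m : R -> B) : Prop :=
  exists (c : coord_chart R B) (rho r t0 : R),
    [/\ atlas S c, cdom c (position v), to_plane c (position v) = 0,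
        0 < r < rho & ball (0 : R * R) rho `<=` cimg c] /\
    [/\ (forall z (v' : vertex G), ball (0 : R * R) rho z ->
           from_plane c z = position v' -> v' = v),
        (forall z s, ball (0 : R * R) rho z -> 0 < s <= 1 ->
           (support G (from_plane c z) <->
            support G (from_plane c (dilate s z)))) &
        m = fun t => from_plane c (dilate r (circle (t + t0)))].

Definition vertex_word (R : realType) (B : topologicalType)
    (S : oriented_surface R B) (X : Type) (G : graph_data R B X)
    (v : vertex G) (w : word X) : Prop :=
  exists2 m, meridian S v m & intersection_word S G m w.

(* ---- Charts ---- *)

Definition is_chart (R : realType) (B : topologicalType)
    (S : oriented_surface R B) (b0 : B) (X : Type) (C : system X)
    (G : graph_data R B X) : Prop :=
  [/\ is_graph S G,
      ~ support G b0,
      (forall v : vertex G, ~~ black v ->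
         exists w, vertex_word S v w /\
           exists2 r, relators C r &
             cyclic_perm r w \/ cyclic_perm (winv r) w) &
      (forall v : vertex G, black v ->
         exists w, vertex_word S v w /\
           exists2 s, singular_words C s & cyclic_perm s w)].

(* The vertex v, if white, is of type r. *)
Definition vertex_type (R : realType) (B : topologicalType)
    (S : oriented_surface R B) (X : Type) (G : graph_data R B X)
    (v : vertex G) (r : word X) : Prop :=
  exists2 w, vertex_word S v w & cyclic_perm r (winv w).

(* G and G' have the same intersection with K, as graphs with labelled and
   oriented edges and with vertices of two colours. *)
Definition agree_on (R : realType) (B : topologicalType) (X : Type)
    (K : set B) (G G' : graph_data R B X) : Prop :=
  [/\ support G `&` K = support G' `&` K,
      (forall p b, K p ->
         (exists2 v : vertex G, position v = p & black v = b) <->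
         (exists2 v : vertex G', position v = p & black v = b)) &
      forall (e : edge G) s (e' : edge G') s',
        edom e s -> edom e' s' -> epath e s = epath e' s' -> K (epath e s) ->
        label e = label e' /\
        \forall u \near s & u' \near s',
          K (epath e u) -> epath e u = epath e' u' -> (u < s) = (u' < s')].

(* The embedded disk D is given as the closed unit disk of a positively oriented
   chart; every (tame) embedded disk is of this form. *)
Definition move_W (R : realType) (B : topologicalType)
    (S : oriented_surface R B) (b0 : B) (X : Type)
    (G G' : graph_data R B X) : Prop :=
  exists c : coord_chart R B,
    let D := from_plane c @` closed_disk in
    let intD := from_plane c @` open_disk in
    let bdD := fun t => from_plane c (circle t) in
    [/\ atlas S c, closed_disk `<=` cimg c & ~ D b0] /\
    [/\ (forall t, support G (bdD t) -> exists l, crossing S G bdD t l),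
        (forall t, support G' (bdD t) -> exists l, crossing S G' bdD t l),
        agree_on (~` intD) G G',
        (forall v : vertex G, D (position v) -> ~~ black v) &
        (forall v : vertex G', D (position v) -> ~~ black v)].

(* ---- The system C_0 of genus g, and the number w ---- *)

Definition X0 (g : nat) := 'I_(2 * g).+1.

(* The letter xi_i, where 1 <= i <= 2g+1; it is the ordinal i - 1. *)
Definition xi (g i : nat) : X0 g * bool := (inord i.-1, true).
Definition xi_inv (g i : nat) : X0 g * bool := (inord i.-1, false).

(* xi_1 xi_2 ... xi_n *)
Definition xi_seq (g n : nat) : word (X0 g) := [seq xi g i | i <- iota 1 n].

Definition r1 (g i j : nat) : word (X0 g) :=
  [:: xi g i; xi g j; xi_inv g i; xi_inv g j].

Definition r2 (g i : nat) : word (X0 g) :=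
  [:: xi g i; xi g i.+1; xi g i; xi_inv g i.+1; xi_inv g i; xi_inv g i.+1].

Definition r3 (g : nat) : word (X0 g) :=
  xi_seq g (2 * g).+1 ++ rev (xi_seq g (2 * g).+1).

Definition r4 (g : nat) : word (X0 g) :=
  wpow (xi_seq g (2 * g).+1) (2 * g).+2.

Definition ell (g h : nat) : word (X0 g) :=
  wpow (xi_seq g (2 * h)) (4 * h).+2.

Inductive R0 (g : nat) : word (X0 g) -> Prop :=
| R0_r1 i j : (1 <= i)%N -> (i < j - 1)%N -> (j - 1 <= 2 * g)%N -> R0 (r1 g i j)
| R0_r2 i : (1 <= i <= 2 * g)%N -> R0 (r2 g i)
| R0_r3 : R0 (r3 g)
| R0_r4 : R0 (r4 g).

Inductive S0 (g : nat) : word (X0 g) -> Prop :=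
| S0_xi i : (1 <= i <= (2 * g).+1)%N -> S0 [:: xi g i]
| S0_xi_inv i : (1 <= i <= (2 * g).+1)%N -> S0 [:: xi_inv g i]
| S0_ell h : (1 <= h <= g./2)%N -> S0 (ell g h)
| S0_ell_inv h : (1 <= h <= g./2)%N -> S0 (winv (ell g h)).

Definition C0 (g : nat) : system (X0 g) := System (@R0 g) (@S0 g).

Definition w_invariant (R : realType) (B : topologicalType)
    (S : oriented_surface R B) (g : nat) (G : graph_data R B (X0 g)) : 'Z_2 :=
  #|[pred v : vertex G | ~~ black v &&
      `[< vertex_type S v (r4 g) \/ vertex_type S v (winv (r4 g)) >]]|%:R.

(* Main.v *)
(* Let H be a group with a map from the letters such that r1, r2, r3 have value
   1 and r4 has value z, central of order two. Call a function F on the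
   surface, with values in H, a potential if it is locally constant off the
   graph and is multiplied on the right by the value of the label when an edge
   is crossed. Potentials exist locally away from the vertices, where they are
   unique up to left multiplication; a white vertex has a potential on a
   punctured neighbourhood iff its word has value 1, so the vertices of type r4
   or its inverse are those without such a potential, and around them F is
   multiplied by z. Cut the disk along vertical rays going upwards from these
   vertices and let F jump by z across each of them: the resulting local models
   glue to a function on a neighbourhood of the disk D, because it is simply
   connected. The same is done for the second graph, giving F'. On a circle
   slightly larger than D both graphs agree, hence F F'^-1 is locally constant
   except for a factor z at each cut, and going around the circle gives z ^ k =
   1, where k is the total number of vertices of type r4 or its inverse that
   the two graphs have in D. *)
Require Import Defs.
From mathcomp Require Import all_boot all_order all_algebra all_fingroup.
From mathcomp Require Import all_classical all_reals all_analysis.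
From mathcomp Require Import ring lra zify.

Set Implicit Arguments.
Unset Strict Implicit.
Unset Printing Implicit Defensive.
Import Order.TTheory GRing.Theory Num.Theory Defs.
Import numFieldNormedType.Exports.
Local Open Scope classical_set_scope.
Local Open Scope ring_scope.

(** * Germs of functions with values in a group *)

(** The group presented by r1, r2 and r3 is the braid group of the sphere on 2g+2 strands, and r4 is
    its full twist, central of order two; [H] is a finite group in which this twist survives. An
    abelian group would not do: with m = 2g+1, all letters would have one value x, r3 would give
    x^(2m) = 1, and r4 has m(m+1) = 2m(g+1) letters. Hence the permutations with weights. The word
    at a vertex depends on a choice of meridian, and the type of a vertex asks only for some
    meridian. The existence of a potential on a punctured neighbourhood is intrinsic; it identifies
    the vertices of type r4 or its inverse, and matches those outside the disk without comparing
    meridians. All cuts are vertical and go upwards, so that a circle around the disk meets them in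
    its upper half only, ordered by their abscissae. The circle is larger than the boundary of the
    disk because potentials are compared through germs, which requires agreement on an open set. *)

Lemma cousin (R : realType) (a b : R) (P : R -> R -> Prop) :
  a <= b ->
  (forall x y z, a <= x -> x <= y -> y <= z -> z <= b ->
    P x y -> P y z -> P x z) ->
  (forall t, a <= t <= b -> exists2 e, 0 < e &
    forall s u, a <= s -> s <= u -> u <= b -> t - e < s -> u < t + e -> P s u) ->
  P a b.
Proof.
move=> ab trP locP.
(* The local hypothesis at the supremum of [A] puts the smaller of [b] and [sup A + e / 2] into [A],
   so this number is [b]. *)
pose A := [set t | a <= t <= b /\ P a t].
have Aa : A a.
  split; first by rewrite lexx.
  by have [|e e0 he] := locP a; [rewrite lexx | apply: he => //; lra].
have Aub : ubound A b by move=> t [/andP[_ ->]].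
have supA : has_sup A by split; [exists a | exists b].
have sA : a <= sup A by apply: ub_le_sup => //; exists b.
have sb : sup A <= b by apply: ge_sup => //; exists a.
have [|e e0 he] := locP (sup A); first by rewrite sA.
have [t [/andP[at_ tb] Pat] st] := sup_adherent e0 supA.
have ts : t <= sup A.
  by apply: ub_le_sup; [exists b | split => //; rewrite at_].
have tm : t <= Num.min b (sup A + e / 2) by rewrite le_min tb /=; lra.
have mb : Num.min b (sup A + e / 2) <= b by rewrite ge_min lexx.
have Pm : P a (Num.min b (sup A + e / 2)).
  apply: (trP _ t) => //; apply: he => //; last first.
  - by rewrite gt_min; apply/orP; right; lra.
have ms : Num.min b (sup A + e / 2) <= sup A.
  apply: ub_le_sup; first by exists b.
  by split => //; rewrite mb (le_trans at_ tm).
move: ms Pm; rewrite minEle; case: ifP => // _; lra.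
Qed.

(** The set [off] need not be connected: near a point of the path, [F] takes one value on all of
    [off]. The constants of adjacent subintervals agree because [off] meets every neighbourhood of
    the common endpoint. *)
Lemma path_const (R : realType) (T : topologicalType) (X : Type)
    (off : set T) (F : T -> X) (gam : R -> T) (a b : R) :
  a <= b ->
  (forall t, a <= t <= b -> {for t, continuous gam}) ->
  (forall t U, a <= t <= b -> nbhs (gam t) U -> exists2 q, U q & off q) ->
  (forall t, a <= t <= b ->
    exists x, \forall q \near gam t, off q -> F q = x) ->
  exists x, forall t, a <= t <= b ->
    \forall q \near gam t, off q -> F q = x.
Proof.
move=> ab gamc dns loc.
apply: (@cousin _ a b (fun s u => exists x, forall t, s <= t <= u ->
    \forall q \near gam t, off q -> F q = x)) => //.
  move=> x y z ax xy yz zb [h1 H1] [h2 H2]; exists h1 => t /andP[xt tz].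
  have [ty|yt] := leP t y; first by apply: H1; rewrite xt.
  have yab : a <= y <= b by rewrite (le_trans ax xy) (le_trans yz zb).
  suff -> : h1 = h2 by apply: H2; rewrite (ltW yt).
  have Hy1 : \forall q \near gam y, off q -> F q = h1.
    by apply: H1; rewrite xy lexx.
  have Hy2 : \forall q \near gam y, off q -> F q = h2.
    by apply: H2; rewrite yz lexx.
  have [q [/= q1 q2] oq] := dns _ _ yab (filterI Hy1 Hy2).
  by rewrite -q1 // q2.
move=> t tab; have [x Hx] := loc t tab.
have /nbhs_interior Hx' := Hx.
have := gamc t tab _ Hx'; rewrite /= => /nbhs_ballP[e /= e0 he].
exists e => // s u as_ su ub ts tu; exists x => v /andP[sv vu].
apply: (he v); rewrite /ball /=; rewrite ltr_distl; apply/andP; split; lra.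
Qed.

Section Germs.
Context (T : topologicalType) (H : groupType) (off : set T).

(** Labels act on the right, so the ambiguity of a potential is a factor on the left. Only the
    values on [off] count, which in use is the complement of the graph. *)
Definition same_germ (F F' : T -> H) (z : T) : Prop :=
  exists h, \forall q \near z, off q -> F q = (h * F' q)%g.

Lemma same_germ_refl F z : same_germ F F z.
Proof. by exists 1%g; near=> q; rewrite mul1g. Unshelve. all: by end_near. Qed.

Lemma same_germ_sym F F' z : same_germ F F' z -> same_germ F' F z.
Proof.
move=> [h Hh]; exists (h^-1)%g; near=> q => oq.
have -> : F q = (h * F' q)%g by move: oq; near: q.
by rewrite mulKg.
Unshelve. all: by end_near. Qed.

Lemma same_germ_trans F F' F'' z :
  same_germ F F' z -> same_germ F' F'' z -> same_germ F F'' z.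
Proof.
move=> [h Hh] [k Hk]; exists (h * k)%g; near=> q => oq.
have -> : F q = (h * F' q)%g by move: oq; near: q.
have -> : F' q = (k * F'' q)%g by move: oq; near: q.
by rewrite mulgA.
Unshelve. all: by end_near. Qed.

Lemma same_germ_near F F' z :
  same_germ F F' z -> \forall z' \near z, same_germ F F' z'.
Proof.
by move=> [h /nbhs_interior Hh]; near=> z'; exists h; near: z'.
Unshelve. all: by end_near. Qed.

Lemma same_germ_congr F F1 F' z :
  (\forall q \near z, off q -> F q = F1 q) ->
  same_germ F F' z -> same_germ F1 F' z.
Proof.
move=> H1 [h Hh]; exists h; near=> q => oq.
have <- : F q = F1 q by move: oq; near: q.
by move: oq; near: q.
Unshelve. all: by end_near. Qed.

Lemma same_germ_mull F F' z k :
  same_germ F F' z -> same_germ (fun q => k * F q)%g F' z.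
Proof.
move=> [h Hh]; exists (k * h)%g; near=> q => oq.
have -> : F q = (h * F' q)%g by move: oq; near: q.
by rewrite mulgA.
Unshelve. all: by end_near. Qed.

Lemma same_germ_quotient F F' z : same_germ F F' z ->
  exists x, \forall q \near z, off q -> (F q * (F' q)^-1)%g = x.
Proof.
move=> [h Hh]; exists h; near=> q => oq.
have -> : F q = (h * F' q)%g by move: oq; near: q.
by rewrite mulgK.
Unshelve. all: by end_near. Qed.

End Germs.

Definition seg {R : realType} (o q : R * R) (t : R) : R * R :=
  (o.1 + t * (q.1 - o.1), o.2 + t * (q.2 - o.2)).

Lemma seg0 (R : realType) (o q : R * R) : seg o q 0 = o.
Proof. by case: o => x y; rewrite /seg !mul0r !addr0. Qed.

Lemma seg1 (R : realType) (o q : R * R) : seg o q 1 = q.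
Proof. by case: o q => x y [x' y']; rewrite /seg /= !mul1r !subrKC. Qed.

Lemma near_prodR (R : realType) (z : R * R) (P : R * R -> Prop) :
  (\forall q \near z, P q) <->
  exists2 e : R, 0 < e & forall q, `|q.1 - z.1| < e -> `|q.2 - z.2| < e -> P q.
Proof.
split=> [/nbhs_ballP[e /= e0 he]|[e e0 he]].
  exists e => // q h1 h2; apply: he; split; rewrite /ball /= distrC; assumption.
apply/nbhs_ballP; exists e => // q [].
by rewrite /ball /= distrC => h1; rewrite distrC => h2; apply: he.
Qed.

Lemma seg_continuous2 (R : realType) (o q : R * R) t :
  {for (t, q), continuous (fun x : R * (R * R) => seg o x.2 x.1)}.
Proof.
rewrite /seg; apply: (@cvg_pair _ _ _ _ (nbhs _) (nbhs _)) => /=.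
- apply: cvgD; first exact: cvg_cst.
  apply: cvgM; first exact: cvg_fst.
  apply: cvgB; last exact: cvg_cst.
  apply: (@cvg_comp _ _ _ snd fst); first exact: cvg_snd.
  exact: cvg_fst.
- apply: cvgD; first exact: cvg_cst.
  apply: cvgM; first exact: cvg_fst.
  apply: cvgB; last exact: cvg_cst.
  apply: (@cvg_comp _ _ _ snd snd); first exact: cvg_snd.
  exact: cvg_snd.
Qed.

Lemma seg_continuous (R : realType) (o q : R * R) : continuous (seg o q).
Proof.
move=> t; apply: (@continuous_comp _ _ _ (fun t => (t, q)) (fun x => seg o x.2 x.1)).
  by apply: (@cvg_pair _ _ _ _ (nbhs _) (nbhs _)) => /=; [exact: cvg_id | exact: cvg_cst].
exact: seg_continuous2.
Qed.

Lemma seg_tube (R : realType) (o q : R * R) (U : set (R * R)) : open U ->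
  (forall t, 0 <= t <= 1 -> U (seg o q t)) ->
  \forall q' \near q, forall t, 0 <= t <= 1 -> U (seg o q' t).
Proof.
move=> Uo sU.
have /compact_near_coveringP cov := @segment_compact R 0 1.
have HA : \forall q' \near q, `[0, 1] `<=` (fun t => U (seg o q' t)).
  apply: (cov _ (nbhs q) (fun q' t => U (seg o q' t))) => t /=.
  rewrite in_itv /= => t01.
  have UU : nbhs (seg o q t) U by apply: open_nbhs_nbhs; split => //; exact: sU.
  exact: (@seg_continuous2 _ o q t _ UU).
near=> q' => t t01.
have : `[0, 1] `<=` (fun t => U (seg o q' t)) by near: q'.
by apply; rewrite /= in_itv.
Unshelve. all: by end_near. Qed.

Lemma star_const (R : realType) (X : Type) (off A : set (R * R)) (o : R * R)
    (F : R * R -> X) :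
  A o -> (forall q (t : R), A q -> 0 <= t <= 1 -> A (seg o q t)) ->
  (forall z U, A z -> nbhs z U -> exists2 q, U q & off q) ->
  (forall z, A z -> exists x, \forall q \near z, off q -> F q = x) ->
  exists x, forall z, A z -> \forall q \near z, off q -> F q = x.
Proof.
move=> Ao sA dns loc; have [x Hx] := loc o Ao.
exists x => z Az.
have [y Hy] := @path_const R _ X off F (seg o z) 0 1 ler01
  (fun t _ => @seg_continuous R o z t) (fun t U t01 => dns _ U (sA _ _ Az t01))
  (fun t t01 => loc _ (sA _ _ Az t01)).
have H1 := Hy 1; rewrite seg1 ler01 lexx in H1.
have H0 := Hy 0; rewrite seg0 ler01 lexx in H0.
have [q [q1 q2] oq] := dns _ _ Ao (filterI Hx (H0 isT)).
by rewrite -q1 // q2 //; exact: H1.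
Qed.

(** * Gluing germs over a star-shaped region *)

Section Glue.
Context (R : realType) (H : groupType) (off : set (R * R)).
Context (M : R * R -> R * R -> H) (O : set (R * R)) (o : R * R).
Hypothesis Oopen : open O.
Hypothesis Oo : O o.
Hypothesis Ostar : forall q (t : R), O q -> 0 <= t <= 1 -> O (seg o q t).
Hypothesis dns : forall z U, O z -> nbhs z U -> exists2 q, U q & off q.
Hypothesis cons : forall z, O z -> \forall z' \near z, same_germ off (M z) (M z') z'.

Let good F z := same_germ off F (M z) z.

Lemma good_open F z : O z -> good F z -> \forall z' \near z, good F z'.
Proof.
move=> Oz Fz; near=> z'; apply: (@same_germ_trans _ _ _ _ (M z)).
  by near: z'; exact: (same_germ_near Fz).
by near: z'; exact: cons.
Unshelve. all: by end_near. Qed.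

Lemma good_same F F' z : good F z -> good F' z -> same_germ off F F' z.
Proof. by move=> h1 /same_germ_sym h2; exact: same_germ_trans h1 h2. Qed.

(** Good functions on two adjacent pieces of the segment differ by a left factor at the common
    point. Absorbing this factor into the second function makes them match, and [cousin] does the
    rest. *)
Lemma good_along_seg q : O q ->
  exists F, forall t, 0 <= t <= 1 -> good F (seg o q t).
Proof.
move=> Oq; pose g := seg o q.
have Og t : 0 <= t <= 1 -> O (g t) by exact: Ostar.
have [<-|noq] := eqVneq o q.
  exists (M o) => t _; suff -> : seg o o t = o by exact: same_germ_refl.
  by rewrite /seg !subrr !mulr0 !addr0; case: (o).
(* [l] is the scalar product with the direction of the segment, so that [g t] has level [t * n]. Two
   pieces are joined along the line orthogonal to the segment at level [b * n]. *)
pose l (p : R * R) := (p.1 - o.1) * (q.1 - o.1) + (p.2 - o.2) * (q.2 - o.2).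
pose n := (q.1 - o.1) ^+ 2 + (q.2 - o.2) ^+ 2.
have n0 : 0 < n.
  have [e1|ne1] := eqVneq q.1 o.1; last first.
    by rewrite ltr_wpDr ?sqr_ge0 // exprn_even_gt0 //= subr_eq0.
  rewrite ltr_wpDl ?sqr_ge0 // exprn_even_gt0 //= subr_eq0; apply: contra noq.
  by move=> /eqP e2; apply/eqP; case: (o) (q) e1 e2 => ? ? [? ?] /= -> ->.
have lg t : l (g t) = t * n by rewrite /l /g /seg /n /=; ring.
have lc : continuous l.
  move=> p; rewrite /l; apply: cvgD; apply: cvgM; try exact: cvg_cst;
  apply: cvgB; try exact: cvg_cst; [exact: cvg_fst | exact: cvg_snd].
apply: (@cousin _ 0 1 (fun s u => exists F, forall t, s <= t <= u -> good F (g t))) => //.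
  move=> a b c a0 ab bc c1 [F1 H1] [F2 H2].
  have b01 : 0 <= b <= 1 by rewrite (le_trans a0 ab) (le_trans bc c1).
  have [h hb] : same_germ off F1 F2 (g b).
    by apply: good_same; [apply: H1; rewrite ab lexx | apply: H2; rewrite lexx bc].
  exists (fun p => if l p < b * n then F1 p else (h * F2 p)%g) => t /andP[at_ tc].
  have [tb|bt|tb] := ltgtP t b.
  - have lt_ : \forall p \near g t, l p < b * n.
      by apply: (lc (g t) (fun x => x < b * n)); apply: lt_nbhsl; rewrite lg ltr_pM2r.
    apply: (same_germ_congr (F := F1)); last by apply: H1; rewrite at_ ltW.
    by near=> p => _; rewrite (near lt_ p).
  - have lt_ : \forall p \near g t, b * n < l p.
      by apply: (lc (g t) (fun x => b * n < x)); apply: lt_nbhsr; rewrite lg ltr_pM2r.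
    apply: (same_germ_congr (F := fun p => h * F2 p)%g); last first.
      by apply: same_germ_mull; apply: H2; rewrite tc ltW.
    by near=> p => _; rewrite ifN // -leNgt ltW // (near lt_ p).
  - apply: (same_germ_congr (F := F1)); last by apply: H1; rewrite at_ tb lexx.
    rewrite tb; near=> p => op; case: ifP => // _.
    by move: op; near: p.
move=> t t01.
have /nbhs_ballP[e /= e0 he] : \forall u \near t, good (M (g t)) (g u).
  apply: (@seg_continuous _ o q t).
  by apply: good_open; [exact: Og | exact: same_germ_refl].
exists e => // s u s0 su u1 ts tu; exists (M (g t)) => v /andP[sv vu].
apply: he; rewrite /ball /= ltr_distl; apply/andP; split; lra.
Unshelve. all: by end_near. Qed.

(* The value at q is that of a function obtained along the segment from o to q
   and normalized at o; nearby points q give the same function by the tube lemma. *)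
Lemma glue_star : exists F, forall z, O z -> same_germ off F (M z) z.
Proof.
have Ex q : exists F, O q -> (forall t, 0 <= t <= 1 -> good F (seg o q t)) /\
    (\forall p \near o, off p -> F p = M o p).
  have [Oq|] := pselect (O q); last by exists (M o).
  have [F HF] := good_along_seg Oq.
  have [h Hh] : good F o by have := HF 0; rewrite seg0 lexx ler01; apply.
  exists (fun p => h^-1 * F p)%g => _; split.
    by move=> t t01; apply: same_germ_mull; exact: HF.
  near=> p => op; have -> : F p = (h * M o p)%g by move: op; near: p.
  by rewrite mulKg.
have [Fs HFs] := choice Ex.
exists (fun q => Fs q q) => z Oz.
have [Hz Nz] := HFs z Oz.
have : good (Fs z) z by have := Hz 1; rewrite seg1 lexx ler01; apply.
apply: same_germ_congr.
have tube : \forall q \near z, forall t, 0 <= t <= 1 ->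
    (O `&` (good (Fs z))°) (seg o q t).
  apply: seg_tube; first by apply: openI => //; exact: open_interior.
  move=> t t01; split; first exact: Ostar.
  by apply: good_open; [exact: Ostar | exact: Hz].
near=> q => oq.
have tq : forall t, 0 <= t <= 1 -> (O `&` (good (Fs z))°) (seg o q t) by near: q.
have Oq : O q by have [] := tq 1; rewrite ?lexx ?ler01 // seg1.
have [Hq Nq] := HFs q Oq.
(* [Fs z] and [Fs q] are both good along the segment to [q] and coincide near [o]; hence their
   ratio, which is constant along the segment, is 1. *)
have [x Hx] := @path_const R _ H off (fun p => Fs z p * (Fs q p)^-1)%g (seg o q) 0 1 ler01
  (fun t _ => @seg_continuous R o q t)
  (fun t U t01 => dns (Ostar Oq t01))
  (fun t t01 => same_germ_quotient
     (good_same (nbhs_singleton (tq t t01).2) (Hq t t01))).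
have H1 := Hx 1; rewrite seg1 ler01 lexx in H1.
have H0 := Hx 0; rewrite seg0 ler01 lexx in H0.
have [p [[p1 p2] p3] op] := dns Oo (filterI (filterI Nz Nq) (H0 isT)).
have x1 : x = 1%g by rewrite -p3 // p1 // p2 // mulgV.
have := nbhs_singleton (H1 isT) oq; rewrite x1 => /(congr1 (fun y => y * Fs q q)%g).
by rewrite mulgVK mul1g.
Unshelve. all: by end_near. Qed.

End Glue.

(** * Plane geometry *)

Definition sqnorm {R : realType} (z : R * R) : R := z.1 ^+ 2 + z.2 ^+ 2.

Definition cross {R : realType} (d z : R * R) : R := d.1 * z.2 - d.2 * z.1.

Lemma sqnorm_circle (R : realType) (t : R) : sqnorm (circle t) = 1.
Proof. exact: cos2Dsin2. Qed.

Lemma sqnorm_dilate (R : realType) (l : R) (z : R * R) :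
  sqnorm (dilate l z) = l ^+ 2 * sqnorm z.
Proof. by rewrite /sqnorm /dilate /=; ring. Qed.

Lemma sqnorm_continuous (R : realType) : continuous (@sqnorm R).
Proof.
move=> z; rewrite /sqnorm; under eq_fun do rewrite !expr2.
by apply: cvgD; apply: cvgM; try exact: cvg_fst; exact: cvg_snd.
Qed.

Lemma cross_continuous (R : realType) (d : R * R) : continuous (cross d).
Proof.
move=> z; rewrite /cross; apply: cvgB; apply: cvgM; try exact: cvg_cst.
  exact: cvg_snd.
exact: cvg_fst.
Qed.

Lemma cross_seg (R : realType) (d p q : R * R) t :
  cross d (seg p q t) = (1 - t) * cross d p + t * cross d q.
Proof. by rewrite /cross /seg /=; ring. Qed.

Lemma cross_circle (R : realType) (u0 l u : R) :
  cross (circle u0) (dilate l (circle u)) = l * sin (2 * pi * (u - u0)).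
Proof. by rewrite /cross /dilate /circle /= mulrBr sinB; ring. Qed.

Lemma dilate_continuous (R : realType) (l : R) : continuous (dilate l).
Proof.
move=> z; apply: (@cvg_pair _ _ _ _ (nbhs _) (nbhs _)) => /=; apply: cvgM;
  try exact: cvg_cst; [exact: cvg_fst | exact: cvg_snd].
Qed.

Lemma circle_continuous (R : realType) : continuous (@circle R).
Proof.
move=> t; apply: (@cvg_pair _ _ _ _ (nbhs _) (nbhs _)) => /=.
  apply: (@continuous_comp _ _ _ (fun t => 2 * pi * t) cos); last exact: continuous_cos.
  by apply: cvgM; [exact: cvg_cst | exact: cvg_id].
apply: (@continuous_comp _ _ _ (fun t => 2 * pi * t) sin); last exact: continuous_sin.
by apply: cvgM; [exact: cvg_cst | exact: cvg_id].
Qed.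

Lemma circleD1 (R : realType) (t : R) : circle (t + 1) = circle t.
Proof.
rewrite /circle; have -> : 2 * pi * (t + 1) = 2 * pi * t + pi *+ 2 :> R by ring.
by rewrite cosD2pi sinD2pi.
Qed.

Lemma sin_turn_gt0 (R : realType) (x : R) : 0 < x < 1 / 2 -> 0 < sin (2 * pi * x).
Proof.
move=> /andP[x0 x1]; have p0 := pi_gt0 R; apply: sin_gt0_pi.
rewrite mulr_gt0 ?mulr_gt0 //=.
have -> : 2 * pi * x = pi * (2 * x) by ring.
by rewrite gtr_pMr //; lra.
Qed.

Lemma sin_turn_lt0 (R : realType) (x : R) : - (1 / 2) < x < 0 -> sin (2 * pi * x) < 0.
Proof.
move=> h; rewrite -oppr_gt0 -sinN -mulrN; apply: sin_turn_gt0; lra.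
Qed.

(** [a] and [b] are the coordinates of [z] in the frame rotated by the angle [u0]; for positive [a]
    the arctangent of [b / a] is the remaining angle, converted to full turns. *)
Lemma polar_alg (R : realType) (u0 : R) (z : R * R)
    (a := z.1 * (circle u0).1 + z.2 * (circle u0).2) (b := cross (circle u0) z) :
  0 < a ->
  z = dilate (Num.sqrt (a ^+ 2 + b ^+ 2)) (circle (u0 + atan (b / a) / (2 * pi))).
Proof.
move=> a0; have p0 := pi_gt0 R.
have n0 : 0 < a ^+ 2 + b ^+ 2 by rewrite ltr_wpDr ?sqr_ge0 // exprn_gt0.
set r := Num.sqrt _; have r0 : 0 < r by rewrite sqrtr_gt0.
have ca : cos (atan (b / a)) = a / r.
  rewrite cos_atan; have -> : 1 + (b / a) ^+ 2 = (a ^+ 2 + b ^+ 2) / a ^+ 2.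
    by field; rewrite gt_eqF.
  rewrite sqrtrM ?ltW // sqrtrV ?sqr_ge0 // sqrtr_sqr gtr0_norm //.
  by rewrite invfM invrK mulrC.
have sa : sin (atan (b / a)) = b / r.
  have ca0 : cos (atan (b / a)) != 0 by rewrite ca gt_eqF // divr_gt0.
  have := atanK (b / a); rewrite /tan => /(congr1 (fun x => x * cos (atan (b / a)))).
  by rewrite divfK // ca => ->; field; rewrite !gt_eqF.
have e : 2 * pi * (u0 + atan (b / a) / (2 * pi)) = 2 * pi * u0 + atan (b / a).
  rewrite mulrDr; congr (_ + _); rewrite mulrC divfK // mulf_neq0 // gt_eqF //.
have cs := cos2Dsin2 (2 * pi * u0).
rewrite /dilate /circle e cosD sinD /= ca sa.
move: cs; rewrite /a /b /cross /circle /=; set C := cos _; set S := sin _ => cs.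
clearbody C S; move: r0; clearbody r => r0; clear ca sa e n0.
move: z @a @b a0 => [x y] a b _; rewrite {}/a {}/b /=.
congr pair.
  transitivity (x * (C ^+ 2 + S ^+ 2)); first by rewrite cs mulr1.
  by field; rewrite gt_eqF.
transitivity (y * (C ^+ 2 + S ^+ 2)); first by rewrite cs mulr1.
by field; rewrite gt_eqF.
Qed.

Lemma polar_near (R : realType) (l0 u0 e : R) : 0 < l0 -> 0 < e ->
  \forall z \near dilate l0 (circle u0), exists l u,
    [/\ 0 < l, `|l - l0| < e, `|u - u0| < e & z = dilate l (circle u)].
Proof.
move=> l00 e0; set z0 := dilate l0 _; have p0 := pi_gt0 R.
pose a (z : R * R) := z.1 * (circle u0).1 + z.2 * (circle u0).2.
pose b (z : R * R) := cross (circle u0) z.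
have ac : continuous a.
  move=> z; rewrite /a; apply: cvgD; apply: cvgM; try exact: cvg_cst;
  [exact: cvg_fst | exact: cvg_snd].
have bc : continuous b by exact: cross_continuous.
have az0 : a z0 = l0.
  have := sqnorm_circle u0; rewrite /a /z0 /dilate /sqnorm.
  case: (circle u0) => x y /= cs.
  by transitivity (l0 * (x ^+ 2 + y ^+ 2)); [ring | rewrite cs mulr1].
have bz0 : b z0 = 0 by rewrite /b cross_circle subrr mulr0 sin0 mulr0.
have lc : Num.sqrt (a z ^+ 2 + b z ^+ 2) @[z --> z0] --> l0.
  rewrite -[l0]ger0_norm ?ltW // -sqrtr_sqr.
  have -> : l0 ^+ 2 = a z0 ^+ 2 + b z0 ^+ 2 by rewrite az0 bz0 expr0n addr0.
  apply: (@continuous_comp _ _ _ (fun z => a z ^+ 2 + b z ^+ 2) Num.sqrt).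
    by apply: cvgD; apply: cvgM; first [exact: ac | exact: bc].
  exact: sqrt_continuous.
have uc : u0 + atan (b z / a z) / (2 * pi) @[z --> z0] --> u0.
  rewrite -[X in _ --> X]addr0; apply: cvgD; first exact: cvg_cst.
  have -> : (0 : R) = atan (b z0 / a z0) / (2 * pi) by rewrite bz0 !mul0r atan0 mul0r.
  apply: cvgM; last exact: cvg_cst.
  apply: (@continuous_comp _ _ _ (fun z => b z / a z) atan); last exact: continuous_atan.
  apply: cvgM; first exact: bc.
  by apply: cvgV; [rewrite az0 gt_eqF | exact: ac].
near=> z.
have az : 0 < a z by near: z; apply: (cvgr_gt (a z0)); [exact: ac | rewrite az0].
exists (Num.sqrt (a z ^+ 2 + b z ^+ 2)), (u0 + atan (b z / a z) / (2 * pi)).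
split; last exact: polar_alg.
- by rewrite sqrtr_gt0 ltr_wpDr ?sqr_ge0 // exprn_gt0.
- by rewrite distrC; near: z; apply: (@cvgr_dist_lt _ _ _ _ _ _ _ lc).
- by rewrite distrC; near: z; apply: (@cvgr_dist_lt _ _ _ _ _ _ _ uc).
Unshelve. all: by end_near. Qed.

(* Rules out that an orientation-preserving coordinate change mapping the
   horizontal axis to itself, with its direction, exchanges its two sides. *)
Lemma turn_side (R : realType) (theta : R -> R) :
  {within `[0, 1], continuous theta} -> theta 1 = theta 0 + 1 ->
  0 < cos (2 * pi * theta 0) -> sin (2 * pi * theta 0) = 0 ->
  (forall t, 0 < t < 1 / 2 -> sin (2 * pi * theta t) < 0) ->
  (forall t, 1 / 2 < t < 1 -> 0 < sin (2 * pi * theta t)) -> False.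
Proof.
move=> tc t1 cos0 sin0' lo hi.
have sgn x : sin (2 * pi * (theta 0 + x)) = cos (2 * pi * theta 0) * sin (2 * pi * x).
  by rewrite mulrDr sinD sin0' mul0r add0r.
(* If the angle has grown at half time, it has passed a value slightly above [theta 0], where the
   sine is positive, during the first half. Otherwise it must rise to [theta 0 + 1] during the
   second half and passes [theta 0 + 3 / 4], where the sine is negative. *)
have [h|h] := ltP (theta 0) (theta (1 / 2)).
  pose x := Num.min (1 / 4) ((theta (1 / 2) - theta 0) / 2).
  have x0 : 0 < x by rewrite lt_min; apply/andP; split; lra.
  have x4 : x <= 1 / 4 by rewrite ge_min lexx.
  have xh : x <= (theta (1 / 2) - theta 0) / 2 by rewrite ge_min lexx orbT.
  have [|||t] := @IVT _ theta 0 (1 / 2) (theta 0 + x).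
  - lra.
  - apply: continuous_subspaceW tc => y /=; rewrite !in_itv /= => /andP[-> ?]; lra.
  - rewrite minEle maxEle !ifT; lra.
  rewrite in_itv /= => /andP[t0 t2] ht.
  have : 0 < t < 1 / 2.
    rewrite !lt_neqAle t0 t2 !andbT; apply/andP; split.
      by apply/eqP => e; move: ht; rewrite -e; lra.
    by apply/eqP => e; move: ht; rewrite e; lra.
  move=> /lo; rewrite ht sgn pmulr_rlt0 //.
  have : 0 < sin (2 * pi * x) by apply: sin_turn_gt0; rewrite x0 /=; lra.
  lra.
have [|||t] := @IVT _ theta (1 / 2) 1 (theta 0 + 3 / 4).
- lra.
- apply: continuous_subspaceW tc => y /=; rewrite !in_itv /= => /andP[? ->]; lra.
- rewrite t1 minEle maxEle ifT; last lra.
  by rewrite ifT; [apply/andP; split|]; lra.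
rewrite in_itv /= => /andP[t0 t2] ht.
have : 1 / 2 < t < 1.
  rewrite !lt_neqAle t0 t2 !andbT; apply/andP; split.
    by apply/eqP => e; move: ht; rewrite -e; lra.
  by apply/eqP => e; move: ht; rewrite e t1; lra.
move=> /hi; rewrite ht sgn pmulr_rgt0 //.
have -> : 2 * pi * (3 / 4) = 2 * pi * (- (1 / 4)) + pi *+ 2 :> R by field.
rewrite sinD2pi; have : sin (2 * pi * (- (1 / 4))) < 0 :> R by apply: sin_turn_lt0; lra.
lra.
Qed.

(** Each of the two halves of [A] cut off by the line [l = 0] is convex and contains no zero of [f],
    so [f] has constant sign on it by the intermediate value theorem. Since [f] takes both signs,
    the two halves have opposite ones. *)
Lemma convex_sides (R : realType) (A : set (R * R)) (l f : R * R -> R) :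
  (forall p q (t : R), A p -> A q -> 0 <= t <= 1 -> A (seg p q t)) ->
  (forall p q (t : R), l (seg p q t) = (1 - t) * l p + t * l q) ->
  (forall z, A z -> {for z, continuous f}) ->
  (forall z, A z -> (f z = 0 <-> l z = 0)) ->
  (exists2 p, A p & 0 < f p) -> (exists2 p, A p & f p < 0) ->
  (forall z, A z -> (0 < l z -> 0 < f z) /\ (l z < 0 -> f z < 0)) \/
  (forall z, A z -> (0 < l z -> f z < 0) /\ (l z < 0 -> 0 < f z)).
Proof.
move=> cA ls fc fl [p Ap fp] [n An fn].
have same x y : A x -> A y -> 0 < l x * l y -> 0 < f x -> 0 < f y.
  move=> Ax Ay lxy fx; rewrite ltNge; apply/negP => fy.
  have gc : {within `[0, 1], continuous (f \o seg x y)}.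
    apply: continuous_in_subspaceT => t; rewrite inE /= in_itv /= => t01.
    apply: continuous_comp; first exact: seg_continuous.
    by apply: fc; exact: cA.
  have [|t] := @IVT _ (f \o seg x y) 0 1 0 ler01 gc.
    by rewrite /= seg0 seg1 minEle maxEle; case: ifP; lra.
  rewrite in_itv /= => t01 /(fl _ (cA _ _ _ Ax Ay t01)).
  rewrite ls => h; have [t0 t1] := andP t01.
  have [lx0|lx0] := ltP 0 (l x).
    have ly0 : 0 < l y by rewrite -(pmulr_rgt0 _ lx0).
    by have [?|?] := leP t (1 / 2); nra.
  have lx1 : l x < 0 by rewrite lt_neqAle lx0 andbT; apply/eqP => e; move: lxy; rewrite e mul0r ltxx.
  have ly0 : l y < 0 by rewrite -(nmulr_rgt0 _ lx1).
  by have [?|?] := leP t (1 / 2); nra.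
have f0 z : A z -> l z != 0 -> f z != 0.
  by move=> Az lz; apply: contra lz => /eqP/(fl _ Az) ->.
have lp : l p != 0 by apply: contraTneq fp => /(fl _ Ap) ->; rewrite ltxx.
have ln : l n != 0 by apply: contraTneq fn => /(fl _ An) ->; rewrite ltxx.
have neg z : A z -> l z != 0 -> ~ 0 < f z -> f z < 0.
  by move=> Az lz; have := f0 z Az lz; case: ltgtP.
have [lp0|lp0] := ltP 0 (l p).
  have ln0 : l n < 0.
    rewrite lt_neqAle ln leNgt; apply/negP => ln0.
    have : 0 < f n by apply: (same p n) => //; exact: mulr_gt0.
    lra.
  left => z Az; split => lz; first by apply: (same p z) => //; exact: mulr_gt0.
  apply: neg => //; first by rewrite lt_eqF.
  move=> fz; have : 0 < f n by apply: (same z n) => //; rewrite nmulr_rgt0.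
  lra.
have lpn : l p < 0 by rewrite lt_neqAle lp.
have ln0 : 0 < l n.
  rewrite lt_neqAle eq_sym ln leNgt; apply/negP => ln0.
  have : 0 < f n by apply: (same p n) => //; rewrite nmulr_rgt0.
  lra.
right => z Az; split => lz; last by apply: (same p z) => //; rewrite nmulr_rgt0.
apply: neg => //; first by rewrite gt_eqF.
move=> fz; have : 0 < f n by apply: (same z n) => //; exact: mulr_gt0.
lra.
Qed.

(** * Coordinate charts and graphs *)

Section CoordCharts.
Context (R : realType) (B : topologicalType).
Implicit Types (c : coord_chart R B) (z a : R * R) (p q : B).

Lemma from_continuous c z : cimg c z -> {for z, continuous (from_plane c)}.
Proof. by move=> h; exact: from_plane_continuous (mem_set h). Qed.

Lemma to_continuous c p : cdom c p -> {for p, continuous (to_plane c)}.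
Proof. by move=> h; exact: to_plane_continuous (mem_set h). Qed.

Lemma near_cimg c z : cimg c z -> \forall z' \near z, cimg c z'.
Proof. by move=> h; apply: open_nbhs_nbhs; split => //; exact: cimg_open. Qed.

Lemma near_cdom c p : cdom c p -> \forall q \near p, cdom c q.
Proof. by move=> h; apply: open_nbhs_nbhs; split => //; exact: cdom_open. Qed.

Lemma near_from c z (P : B -> Prop) : cimg c z ->
  (\forall q \near from_plane c z, P q) <-> (\forall z' \near z, P (from_plane c z')).
Proof.
move=> cz; split=> [h|h]; first exact: (from_continuous cz h).
have dz := from_plane_dom cz.
have h' : \forall q \near from_plane c z, P (from_plane c (to_plane c q)).
  have h2 : nbhs (to_plane c (from_plane c z)) (fun x => P (from_plane c x)).
    by rewrite from_planeK.
  exact: (to_continuous dz h2).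
near=> q; rewrite -[q](@to_planeK _ _ c); first by near: q.
by near: q; exact: near_cdom.
Unshelve. all: by end_near. Qed.

Lemma near_to c p (P : B -> Prop) : cdom c p ->
  (\forall q \near p, P q) <-> (\forall z \near to_plane c p, P (from_plane c z)).
Proof.
by move=> dp; rewrite -near_from ?to_planeK //; exact: to_plane_img.
Qed.

Definition shift a z : R * R := (z.1 + a.1, z.2 + a.2).

Lemma shift_continuous a : continuous (shift a).
Proof.
move=> z; apply: (@cvg_pair _ _ _ _ (nbhs _) (nbhs _)) => /=; apply: cvgD;
  try exact: cvg_cst; [exact: cvg_fst | exact: cvg_snd].
Qed.

Lemma shiftNK a z : shift (- a) (shift a z) = z.
Proof. by case: a z => ? ? [? ?]; rewrite /shift /= !addrK. Qed.

Lemma shiftKN a z : shift a (shift (- a) z) = z.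
Proof. by case: a z => ? ? [? ?]; rewrite /shift /= !subrK. Qed.

Lemma shift_add a z z' : shift a (z + z') = shift a z + z'.
Proof. by case: a z z' => ? ? [? ?] [? ?]; rewrite /shift /=; congr pair => /=; rewrite addrAC. Qed.

Program Definition translate c a : coord_chart R B :=
  @CoordChart R B (cdom c) (shift a @^-1` cimg c)
    (fun p => shift (- a) (to_plane c p)) (fun z => from_plane c (shift a z))
    (@cdom_open _ _ c) _ _ _ _ _ _ _.
Next Obligation.
move=> c a; apply: open_comp; last exact: cimg_open.
by move=> z _; exact: shift_continuous.
Qed.
Next Obligation. by move=> c a p dp; rewrite /= shiftKN; exact: to_plane_img. Qed.
Next Obligation. by move=> c a z /= cz; exact: from_plane_dom. Qed.
Next Obligation. by move=> c a p dp /=; rewrite shiftKN to_planeK. Qed.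
Next Obligation. by move=> c a z /= cz; rewrite from_planeK // shiftNK. Qed.
Next Obligation.
move=> c a p /set_mem dp; apply: (@continuous_comp _ _ _ (to_plane c) (shift (- a))).
  exact: to_continuous.
exact: shift_continuous.
Qed.
Next Obligation.
move=> c a z /set_mem cz; apply: (@continuous_comp _ _ _ (shift a) (from_plane c)).
  exact: shift_continuous.
exact: from_continuous.
Qed.

(** By maximality of the atlas: translating source or target does not change the winding numbers
    that express compatibility. *)
Lemma translate_atlas (S : oriented_surface R B) c a :
  atlas S c -> atlas S (translate c a).
Proof.
move=> Sc; apply: atlas_maximal => c' Sc'; split => p /= dp dp'.
  have := atlas_compatible Sc Sc' dp dp'; rewrite /orientation_preserving_at /= !shiftKN.
  apply: filterS => r [theta [? ? h]]; exists theta; split => // t t01.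
  by have [m m0 e] := h t t01; exists m => //; rewrite shift_add shiftKN.
have := atlas_compatible Sc' Sc dp dp'; rewrite /orientation_preserving_at /=.
apply: filterS => r [theta [? ? h]]; exists theta; split => // t t01.
by have [m m0 e] := h t t01; exists m => //; rewrite e shift_add.
Qed.

End CoordCharts.

Section Graphs.
Context (R : realType) (B : topologicalType) (S : oriented_surface R B).
Context (X : Type).
Hypothesis hausB : hausdorff_space B.

Section OneGraph.
Context (G : graph_data R B X).
Hypothesis grG : is_graph S G.
Implicit Types (e : edge G) (s : R) (v : vertex G).

Lemma edge_support e s : edom e s -> support G (epath e s).
Proof. by move=> h; right; exists e, s. Qed.

Lemma epath_near01 e s U : 0 <= s <= 1 -> nbhs (epath e s) U ->
  exists2 d, 0 < d & forall t, 0 <= t <= 1 -> `|t - s| < d -> U (epath e t).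
Proof.
move=> s01 hU; have := epath_continuous grG (e := e).
move=> /subspace_continuousP /(_ s).
rewrite /= in_itv /= => /(_ s01 _ hU).
rewrite /nbhs /= /within /= => /nbhs_ballP[d /= d0 hd]; exists d => // t t01 ts.
by apply: hd => //; rewrite /ball /= distrC.
Qed.

Lemma hoop_periodicz e (n : int) t : is_hoop e -> epath e (t + n%:~R) = epath e t.
Proof.
move=> he; have pn (m : nat) t' : epath e (t' + m%:R) = epath e t'.
  elim: m => [|m IH]; first by rewrite addr0.
  by rewrite -addn1 natrD addrA (hoop_periodic grG).
case: n => n; first exact: pn.
by rewrite NegzE mulrNz -[in RHS](subrK n.+1%:R t) pn.
Qed.

Lemma floor_decomp (s : R) : exists (n : int) t, [/\ s = t + n%:~R, 0 <= t & t < 1].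
Proof.
exists (Num.floor s), (s - (Num.floor s)%:~R); rewrite subrK; split => //.
  by rewrite subr_ge0 floor_le.
by rewrite ltrBlDr addrC -[1]/(1%:~R) -intrD floorD1_gt.
Qed.

(** For a hoop, continuity is given on one period only. At the integers, the behaviour to the right
    of 0 and to the left of 1 is combined by periodicity. *)
Lemma epath_continuous_at e s : edom e s -> {for s, continuous (epath e)}.
Proof.
have int_case t : 0 < t < 1 -> {for t, continuous (epath e)}.
  move=> /andP[t0 t1] U hU.
  have [|d d0 hd] := @epath_near01 e t U _ hU; first by rewrite !ltW.
  change (\forall u \near t, U (epath e u)).
  near=> u; apply: hd; last first.
    by near: u; apply/nbhs_ballP; exists d => // u; rewrite /ball /= distrC.
  apply/andP; split; apply: ltW; near: u; [exact: lt_nbhsr | exact: lt_nbhsl].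
rewrite /edom; case: ifPn => [he _|_ /=]; last by rewrite in_itv /= => /int_case.
have shiftc (n : int) t : {for t, continuous (epath e)} ->
    {for t + n%:~R, continuous (epath e)}.
  move=> h U; rewrite /= hoop_periodicz // => /h hU.
  change (\forall x \near t + n%:~R, U (epath e x)).
  near=> x; rewrite -[x](subrK n%:~R) hoop_periodicz //.
  near: x; have c : (fun x : R => x - n%:~R) x @[x --> t + n%:~R] --> t.
    by rewrite -[X in _ --> X](addrK n%:~R t); apply: cvgB; [exact: cvg_id | exact: cvg_cst].
  exact: (c _ hU).
have [n [t [-> t0 t1]]] := floor_decomp s.
apply: shiftc; have [t0'|t0'] := ltP 0 t; first by apply: int_case; rewrite t0'.
have -> : t = 0 by apply/eqP; rewrite eq_le t0' t0.
move=> U /= U0.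
have U1 : nbhs (epath e 1) U by rewrite -[1]add0r (hoop_periodic grG).
have [|d1 d10 h1] := @epath_near01 e 1 U _ U1; first by rewrite ler01 lexx.
have [|d2 d20 h2] := @epath_near01 e 0 U _ U0; first by rewrite ler01 lexx.
apply/nbhs_ballP; exists (Num.min (Num.min d1 d2) 1) => /=.
  by rewrite !lt_min d10 d20 ltr01.
move=> x; rewrite /ball /= sub0r normrN !lt_min => /andP[/andP[x1 x2] x3].
move: x3; rewrite ltr_norml => /andP[x3 x4].
have [x0|x0] := ltP x 0.
  rewrite -(hoop_periodic grG) //; apply: h1; first by apply/andP; split; lra.
  by have -> : x + 1 - 1 = x by ring.
by apply: h2; [apply/andP; split; lra | rewrite subr0].
Unshelve. all: by end_near. Qed.

(** The graph is a finite union of points and of images of the closed unit interval: the ends of an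
    edge that is not a hoop are vertices, and one period covers a hoop. *)
Lemma support_closed : compact [set: B] -> closed (support G).
Proof.
move=> cB; apply: compact_closed => //.
have -> : support G =
    \bigcup_(v in [set` enum (vertex G)]) [set @position _ _ _ G v] `|`
    \bigcup_(e in [set` enum (edge G)]) (@epath _ _ _ G e @` `[0, 1]).
  apply/seteqP; split => [p [[v ->]|[e [s [es ->]]]]|p [[v _ ->]|[e _ [s /=]]]].
  - by left; exists v => //=; rewrite mem_enum.
  - right; exists e; first by rewrite /= mem_enum.
    move: es; rewrite /edom; case: ifPn => [he _|_ /= es].
      have [n [t [-> t0 t1]]] := floor_decomp s.
      by rewrite hoop_periodicz //; exists t => //; rewrite /= in_itv /= t0 ltW.
    by exists s => //; apply: subset_itv_oo_cc.
  - by left; exists v.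
  - rewrite in_itv /= => /andP[s0 s1] <-.
    case he: (is_hoop e); first by right; exists e, s; rewrite /edom he.
    have [[v0 e0] [v1 e1]] := edge_ends grG (negbT he).
    have [->|ns0] := eqVneq s 0; first by left; exists v0.
    have [->|ns1] := eqVneq s 1; first by left; exists v1.
    right; exists e, s; rewrite /edom he /= in_itv /= !lt_neqAle s0 s1 ns1 !andbT.
    by rewrite eq_sym ns0.
apply: compactU; rewrite bigcup_seq; apply: bigsetU_compact => i _.
  exact: compact_set1.
apply: continuous_compact; last exact: segment_compact.
exact: (epath_continuous grG (e := i)).
Qed.

End OneGraph.
End Graphs.

Lemma nbhsI (T : topologicalType) (x : T) (P Q : T -> Prop) :
  (\forall y \near x, P y) -> (\forall y \near x, Q y) ->
  \forall y \near x, P y /\ Q y.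
Proof. exact: filterI. Qed.

Definition box {R : realType} (p : R * R) (e : R) : set (R * R) :=
  [set z | `|z.1 - p.1| < e /\ `|z.2 - p.2| < e].

Lemma conv_lt (R : realType) (a b x t : R) :
  a < x -> b < x -> 0 <= t <= 1 -> a + t * (b - a) < x.
Proof.
move=> ax bx /andP[]; rewrite le_eqVlt => /predU1P[<- _|t0 t1]; first by rewrite mul0r addr0.
have h1 : 0 <= (1 - t) * (x - a) by apply: mulr_ge0; lra.
have h2 : 0 < t * (x - b) by apply: mulr_gt0; lra.
nra.
Qed.

Lemma conv_gt (R : realType) (a b x t : R) :
  x < a -> x < b -> 0 <= t <= 1 -> x < a + t * (b - a).
Proof.
move=> ax bx t01; have := @conv_lt _ (- a) (- b) (- x) t.
rewrite !ltrN2 => /(_ ax bx t01); lra.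
Qed.

Lemma box_seg (R : realType) (p q q' : R * R) (e t : R) :
  box p e q -> box p e q' -> 0 <= t <= 1 -> box p e (seg q q' t).
Proof.
rewrite /box /= !ltr_distl => -[/andP[? ?] /andP[? ?]] [/andP[? ?] /andP[? ?]] t01.
by split; rewrite conv_lt // conv_gt.
Qed.

Lemma box_nbhs (R : realType) (p : R * R) (e : R) : 0 < e -> nbhs p (box p e).
Proof. by move=> e0; apply/near_prodR; exists e. Qed.

Lemma box_open (R : realType) (p : R * R) (e : R) : open (box p e).
Proof.
rewrite openE => z [z1 z2]; apply/near_prodR.
exists (Num.min (e - `|z.1 - p.1|) (e - `|z.2 - p.2|)).
  by rewrite lt_min !subr_gt0 z1.
move=> q; rewrite !lt_min => /andP[q1 _] /andP[_ q2]; split.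
  by rewrite -(subrK z.1 q.1) -addrA (le_lt_trans (ler_normD _ _)) // -ltrBrDr.
by rewrite -(subrK z.2 q.2) -addrA (le_lt_trans (ler_normD _ _)) // -ltrBrDr.
Qed.

(** * Flat charts along an edge *)

Section FlatCharts.
Context (R : realType) (B : topologicalType) (S : oriented_surface R B).
Context (X : Type).
Hypothesis hausB : hausdorff_space B.

Section OneGraph.
Context (G : graph_data R B X).
Hypothesis grG : is_graph S G.
Implicit Types (e : edge G) (s : R) (v : vertex G) (c : coord_chart R B).

Lemma vertex_discrete p : \forall q \near p, forall v, position v <> p -> q <> position v.
Proof.
apply: filter_forall => v; have [->|h] := pselect (position v = p).
  by near=> q => /(_ erefl).
near=> q => _; near: q.
apply: (@open_nbhs_nbhs _ p (~` [set position v])); split.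
  by apply: closed_openC; apply: accessible_closed_set1; exact: hausdorff_accessible.
by move=> /= e; apply: h.
Unshelve. all: by end_near. Qed.

Lemma edom_near e s : edom e s -> \forall u \near s, edom e u.
Proof.
rewrite /edom; case: ifP => [_ _|_ es]; first by near=> u.
by apply: open_nbhs_nbhs; split => //; exact: interval_open.
Unshelve. all: by end_near. Qed.

Section OneChart.
Context (e : edge G) (s : R) (c : coord_chart R B).
Hypothesis fl : flat_chart S e s c.

Lemma flat_cimg0 : cimg c 0.
Proof. by case: fl => _ dc <- _ _; exact: to_plane_img. Qed.

Lemma flat_from0 : from_plane c 0 = epath e s.
Proof. by case: fl => _ dc <- _ _; rewrite to_planeK. Qed.

Lemma near_flat (P : B -> Prop) :
  (\forall q \near epath e s, P q) <-> (\forall z \near (0 : R * R), P (from_plane c z)).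
Proof. by case: fl => _ dc <- _ _; exact: near_to. Qed.

Lemma flat_support : \forall q \near epath e s,
  cdom c q /\ (support G q <-> (to_plane c q).2 = 0).
Proof.
apply/near_flat; case: fl => _ _ _ sup _; near=> z.
have cz : cimg c z by near: z; exact: near_cimg flat_cimg0.
by split; [exact: from_plane_dom | rewrite from_planeK //; near: z].
Unshelve. all: by end_near. Qed.

Lemma flat_edge : edom e s -> exists2 d : R, 0 < d & forall u, `|u - s| < d ->
  [/\ edom e u, cdom c (epath e u), (to_plane c (epath e u)).2 = 0 &
   forall u', `|u' - s| < d -> u < u' ->
     (to_plane c (epath e u)).1 < (to_plane c (epath e u')).1].
Proof.
move=> es; case: (fl) => _ _ _ _ mono.
have [[A1 A2] /= [hA1 hA2] hA] := mono.
have hs : \forall u \near s, [/\ edom e u, cdom c (epath e u),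
    (to_plane c (epath e u)).2 = 0 & A1 u /\ A2 u].
  near=> u; have eu : edom e u by near: u; exact: edom_near.
  have [du su] : cdom c (epath e u) /\
      (support G (epath e u) <-> (to_plane c (epath e u)).2 = 0).
    by near: u; exact: (epath_continuous_at grG es flat_support).
  split => //; first by apply/su; exact: edge_support.
  by split; near: u.
have /nbhs_ballP[d /= d0 hd] := hs; exists d => // u us.
have [eu du u0 [a1 a2]] : [/\ edom e u, cdom c (epath e u),
    (to_plane c (epath e u)).2 = 0 & A1 u /\ A2 u].
  by apply: hd; rewrite /ball /= distrC.
split => // u' us' uu'.
have [_ _ _ [_ a2']] : [/\ edom e u', cdom c (epath e u'),
    (to_plane c (epath e u')).2 = 0 & A1 u' /\ A2 u'].
  by apply: hd; rewrite /ball /= distrC.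
exact: (hA (u, u')).
Unshelve. all: by end_near. Qed.

(** The first coordinate increases along the edge, so by the intermediate value theorem the edge
    near [s] already covers the axis near the origin. Hence no other part of the graph comes close
    to the point. *)
Lemma flat_axis d : edom e s -> 0 < d ->
  \forall z \near (0 : R * R), z.2 = 0 ->
  exists u, [/\ `|u - s| < d, edom e u, from_plane c z = epath e u &
    (to_plane c (epath e u)) = z].
Proof.
move=> es d0; have [d1 d10 h1] := flat_edge es.
case: (fl) => _ _ p0 _ _.
pose r := Num.min d d1 / 2.
have r0 : 0 < r by rewrite divr_gt0 // lt_min d0.
have m1 : Num.min d d1 <= d by rewrite ge_min lexx.
have m2 : Num.min d d1 <= d1 by rewrite ge_min lexx orbT.
have rd : r < d by rewrite /r ltr_pdivrMr //; lra.
have rd1 : r < d1 by rewrite /r ltr_pdivrMr //; lra.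
pose f u := (to_plane c (epath e u)).1.
have near_s u : s - r <= u <= s + r -> `|u - s| < d1.
  by move=> /andP[? ?]; rewrite ltr_norml; apply/andP; split; lra.
have fc : {within `[s - r, s + r], continuous f}.
  apply: continuous_in_subspaceT => u; rewrite inE /= in_itv /= => /near_s/h1[eu du _ _].
  apply: (@continuous_comp _ _ _ (epath e) (fun p => (to_plane c p).1)).
    exact: (epath_continuous_at grG eu).
  apply: (@continuous_comp _ _ _ (to_plane c) fst); first exact: to_continuous.
  exact: cvg_fst.
have fs : f s = 0 by rewrite /f p0.
have inc u u' : s - r <= u <= s + r -> s - r <= u' <= s + r -> u < u' -> f u < f u'.
  by move=> /near_s/h1[_ _ _ h] /near_s; exact: h.
have lo : f (s - r) < 0 by rewrite -fs; apply: inc; lra.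
have hi : 0 < f (s + r) by rewrite -fs; apply: inc; lra.
near=> z => z2.
have zlo : f (s - r) < z.1.
  by near: z; apply: (cvgr_gt (0 : R * R).1); [exact: cvg_fst | exact: lo].
have zhi : z.1 < f (s + r).
  by near: z; apply: (cvgr_lt (0 : R * R).1); [exact: cvg_fst | exact: hi].
have [||u] := @IVT _ f (s - r) (s + r) z.1 _ fc.
- lra.
- by rewrite minEle maxEle !ifT; lra.
rewrite in_itv /= => us fu; have [eu du u2 _] := h1 u (near_s u us).
have tz : to_plane c (epath e u) = z by rewrite [LHS]surjective_pairing [RHS]surjective_pairing u2 z2 -fu.
exists u; split => //; last by rewrite -tz to_planeK.
by move: us => /andP[? ?]; rewrite ltr_norml; apply/andP; split; lra.
Unshelve. all: by end_near. Qed.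

Lemma flat_param d : edom e s -> 0 < d ->
  \forall q \near epath e s, support G q ->
  exists u, [/\ `|u - s| < d, edom e u & q = epath e u].
Proof.
move=> es d0; apply/near_flat; have := flat_axis es d0; have := near_cimg flat_cimg0.
have /near_flat := flat_support; apply: filterS3 => z [_ sz] cz H /sz.
by rewrite from_planeK // => /H[u [? ? ? _]]; exists u.
Qed.

(** Nearby points of the edge lie on the axis of the chart, so the recentring is a horizontal
    translation, which keeps the axis and both sides of it. *)
Lemma flat_translate : edom e s ->
  \forall u \near s, flat_chart S e u (translate c (to_plane c (epath e u))).
Proof.
move=> es; have [d d0 hd] := flat_edge es; case: (fl) => Sc dp p0 sup _.
have opn : \forall u \near s, \forall z \near to_plane c (epath e u),
    support G (from_plane c z) <-> z.2 = 0.
  have /nbhs_interior := sup; rewrite -[X in nbhs X _]p0 => /(to_continuous dp).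
  by move=> /(epath_continuous_at grG es).
near=> u.
have us : `|u - s| < d.
  by near: u; apply/nbhs_ballP; exists d => // u; rewrite /ball /= distrC.
have [eu du u2 _] := hd u us.
have sh0 : shift (to_plane c (epath e u)) 0 = to_plane c (epath e u).
  by rewrite /shift /= !add0r; case: (to_plane _ _).
split => //.
- exact: translate_atlas.
- by rewrite /shift /=; congr pair; exact: subrr.
- have o : \forall z \near shift (to_plane c (epath e u)) 0,
      support G (from_plane c z) <-> z.2 = 0 by rewrite sh0; near: u.
  have o' : \forall z \near (0 : R * R),
      support G (from_plane c (shift (to_plane c (epath e u)) z)) <->
      (shift (to_plane c (epath e u)) z).2 = 0 := shift_continuous o.
  by apply: filterS o' => z /=; rewrite /shift /= u2 addr0.
- have nd : \forall x \near u, `|x - s| < d.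
    apply/nbhs_ballP; exists (d - `|u - s|); first by rewrite /= subr_gt0.
    move=> x; rewrite /ball /= distrC ltrBrDr => h; apply: le_lt_trans h.
    by rewrite -{1}(subrK u x) -addrA ler_normD.
  exists ([set x | `|x - s| < d], [set x | `|x - s| < d]) => //=.
  move=> [x y] /= [xs ys] xy; rewrite /shift /= ltrD2r.
  by have [_ _ _ h] := hd x xs; exact: h.
Unshelve. all: by end_near. Qed.

End OneChart.
End OneGraph.

Section Sides.
Context (G G' : graph_data R B X) (grG : is_graph S G) (grG' : is_graph S G').
Context (e : edge G) (s : R) (c : coord_chart R B).
Context (e' : edge G') (s' : R) (c' : coord_chart R B).
Hypotheses (es : edom e s) (es' : edom e' s').
Hypotheses (fl : flat_chart S e s c) (fl' : flat_chart S e' s' c').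
Hypothesis epp : epath e s = epath e' s'.
Hypothesis dir : \forall u \near s & u' \near s',
  epath e u = epath e' u' -> (u < s) = (u' < s').
Hypothesis sup : \forall q \near epath e s, support G q <-> support G' q.

(** The second coordinate of [c'], read in [c], vanishes exactly on the axis; by [convex_sides] it
    preserves or exchanges the two sides. An exchange is excluded by [turn_side] on a small circle,
    as both charts are positively oriented and direct the edge to the right. *)
Lemma flat_same_side : \forall q \near epath e s,
  (0 < (to_plane c q).2 -> 0 < (to_plane c' q).2) /\
  ((to_plane c q).2 < 0 -> (to_plane c' q).2 < 0).
Proof.
pose p := epath e s.
have dp : cdom c p by case: fl.
have dp' : cdom c' p by case: fl' => _; rewrite /p epp.
have p0 : to_plane c p = 0 by case: fl.
have p0' : to_plane c' p = 0 by rewrite /p epp; case: fl'.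
pose f z := (to_plane c' (from_plane c z)).2.
have N1 : \forall z \near (0 : R * R),
    [/\ cimg c z, cdom c' (from_plane c z) & (f z = 0 <-> z.2 = 0)].
  have := flat_support fl; have := flat_support fl'.
  rewrite -epp => S' S0.
  have := proj1 (near_flat fl _) (nbhsI (nbhsI S' S0) sup).
  have := near_cimg (flat_cimg0 fl); apply: filterS2 => z cz [[[dz s1] [_ s2]] s3].
  split => //; rewrite /f; move: s2; rewrite from_planeK // => s2.
  by rewrite -s1 -s2 s3.
have /near_prodR[eps eps0 hN] := N1.
pose A := box (0 : R * R) eps.
have hA z : A z -> [/\ cimg c z, cdom c' (from_plane c z) & (f z = 0 <-> z.2 = 0)].
  by move=> [z1 z2]; apply: hN.
have nA : nbhs (0 : R * R) A by exact: box_nbhs.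
have cA q q' (t : R) : A q -> A q' -> 0 <= t <= 1 -> A (seg q q' t) by exact: box_seg.
(* The points of the vertical axis of [c'], with [x] equal to 1 and to -1, show that [f] takes both
   signs. *)
have sgn (x : R) : 0 < x \/ x < 0 -> \forall r \near (0 : R)^'+,
    let z := to_plane c (from_plane c' (0, x * r)) in A z /\ f z = x * r.
  move=> _; apply: cvg_within.
  have xc : (fun r : R => (0, x * r) : R * R) r @[r --> 0] --> (0 : R * R).
    rewrite -[X in _ --> X](_ : (0, x * 0) = 0); last by rewrite mulr0.
    apply: (@cvg_pair _ _ _ _ (nbhs _) (nbhs _)) => /=; first exact: cvg_cst.
    by apply: cvgM; [exact: cvg_cst | exact: cvg_id].
  have Ac : \forall z \near (0 : R * R), A (to_plane c (from_plane c' z)) /\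
      cimg c' z /\ cdom c (from_plane c' z).
    have h1 : \forall q \near p, A (to_plane c q) /\ cdom c q.
      apply: filterI; last exact: near_cdom.
      by apply: (to_continuous dp); rewrite /= p0.
    move: h1; rewrite /p epp => /(proj1 (near_flat fl' _)).
    have := near_cimg (flat_cimg0 fl'); apply: filterS2 => z ? [? ?]; split => //.
  have xA : \forall r \near (0 : R), A (to_plane c (from_plane c' (0, x * r))) /\
    cimg c' (0, x * r) /\ cdom c (from_plane c' (0, x * r)) := xc _ Ac.
  apply: filterS xA => r /= [A1 [c1 d1]]; split => //.
  by rewrite /f to_planeK // from_planeK.
have [[z1 Az1 fz1] [z2 Az2 fz2]] : (exists2 z, A z & 0 < f z) /\ (exists2 z, A z & f z < 0).
  have r0 : \forall r \near (0 : R)^'+, 0 < r by exact: nbhs_right_gt.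
  have [r [[A1 f1] rp]] := @filter_ex _ _ _ _ (filterI (sgn 1 (or_introl ltr01)) r0).
  have [r' [[A2 f2] rp']] := @filter_ex _ _ _ _ (filterI (sgn (-1) (or_intror (ltrN10 R))) r0).
  split; first by exists (to_plane c (from_plane c' (0, 1 * r))) => //; rewrite f1 mul1r.
  by exists (to_plane c (from_plane c' (0, -1 * r'))) => //; rewrite f2 mulN1r oppr_lt0.
have [|||H|H] := @convex_sides _ A (fun z => z.2) f cA _ _ _ (ex_intro2 _ _ z1 Az1 fz1) (ex_intro2 _ _ z2 Az2 fz2).
- by move=> q q' t; rewrite /seg /=; ring.
- move=> z /hA[cz dz _].
  apply: (@continuous_comp _ _ _ (fun z => to_plane c' (from_plane c z)) snd); last exact: cvg_snd.
  apply: (@continuous_comp _ _ _ (from_plane c) (to_plane c')).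
    exact: from_continuous.
  exact: to_continuous.
- by move=> z /hA[].
- apply/(proj2 (near_flat fl _)); near=> z.
  have Az : A z by near: z.
  by have [cz _ _] := hA z Az; rewrite from_planeK //; exact: H.
exfalso.
have Sc : atlas S c by case: fl. have Sc' : atlas S c' by case: fl'.
have := atlas_compatible Sc Sc' dp dp'; rewrite /orientation_preserving_at p0 => op.
(* A point to the right of the origin has a parameter greater than [s] on [e]; by [dir] its
   parameter on [e'] is greater than [s'], so it is also to the right in [c']. *)
have Dax : \forall r \near (0 : R)^'+, A (r, 0) /\ 0 < (to_plane c' (from_plane c (r, 0))).1.
  have [[U1 U2] /= [hU1 hU2] hU] := dir.
  have [d1 d10 hd1] := flat_edge grG fl es.
  have [d2 d20 hd2] := flat_edge grG' fl' es'.
  have /nbhs_ballP[d3 /= d30 hd3] := hU1.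
  have /nbhs_ballP[d4 /= d40 hd4] := hU2.
  have m0 : 0 < Num.min d1 d3 by rewrite lt_min d10.
  have m0' : 0 < Num.min d2 d4 by rewrite lt_min d20.
  have ax := flat_param grG fl es m0.
  have ax' := flat_param grG' fl' es' m0'; rewrite -epp in ax'.
  have /(proj1 (near_flat fl _)) Q := nbhsI (nbhsI ax ax') sup.
  have rc : (fun r : R => (r, 0) : R * R) r @[r --> 0] --> (0 : R * R).
    by apply: (@cvg_pair _ _ _ _ (nbhs _) (nbhs _)) => /=; [exact: cvg_id | exact: cvg_cst].
  pose W q := (exists u, [/\ `|u - s| < Num.min d1 d3, edom e u & q = epath e u]) /\
    (exists u, [/\ `|u - s'| < Num.min d2 d4, edom e' u & q = epath e' u]).
  have Q' : \forall r \near (0 : R), A (r, 0) /\ W (from_plane c (r, 0)).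
    have QA : \forall z \near (0 : R * R), z.2 = 0 -> A z /\ W (from_plane c z).
      have := nbhsI N1 (nbhsI (proj1 (near_flat fl _) (flat_support fl)) Q).
      move=> /(nbhsI nA); apply: filterS => z [Az [[cz _ _] [[_ sz] [[a1 a2] a3]]]] z20.
      have sG : support G (from_plane c z) by apply/sz; rewrite from_planeK.
      by split => //; split; [exact: a1 | apply: a2; apply/a3].
    have QA' : \forall r \near (0 : R), (r, (0 : R)).2 = 0 -> A (r, 0) /\ W (from_plane c (r, 0)) :=
      rc (fun z => z.2 = 0 -> A z /\ W (from_plane c z)) QA.
    by apply: filterS QA' => r; apply.
  have Q2 : \forall r \near (0 : R)^'+, A (r, 0) /\ W (from_plane c (r, 0)) := cvg_within _ Q'.
  near=> r; have r0 : 0 < r by near: r; exact: nbhs_right_gt.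
  have [Ar] : A (r, 0) /\ W (from_plane c (r, 0)) by near: r; exact: Q2.
  set q := from_plane c (r, 0) => -[[u [us eu qu]] [u' [us' eu' qu']]]; split => //.
  have [cz _ _] := hA _ Ar.
  have qr : to_plane c q = (r, 0) by rewrite from_planeK.
  move: us us'; rewrite !lt_min => /andP[u1 u3] /andP[u2 u4].
  have ss' : `|s' - s'| < d2 by rewrite subrr normr0.
  have [_ _ _ mo] := hd1 u u1; have [_ _ _ mo'] := hd2 s' ss'.
  have ss : `|s - s| < d1 by rewrite subrr normr0.
  have us : (u < s) = (u' < s').
    apply: (hU (u, u')) => /=; last by rewrite -qu -qu'.
    by split; [apply: hd3 | apply: hd4]; rewrite /ball /= distrC.
  have u's' : s' < u'.
    rewrite lt_neqAle leNgt -us; apply/andP; split.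
      apply/eqP => e0; have : to_plane c q = 0 by rewrite qu' -e0 -epp.
      by rewrite qr => -[] e1; rewrite e1 ltxx in r0.
    apply/negP => /(mo s ss); rewrite -qu qr -/p p0 /=; lra.
  have := mo' u' u2 u's'.
  by rewrite -qu' -epp -/p p0'.
have small : \forall r \near (0 : R)^'+, forall t, A (dilate r (circle t)).
  near=> r => t; have r0 : 0 < r by near: r; exact: nbhs_right_gt.
  have re : r < eps by near: r; exact: nbhs_right_lt.
  rewrite /A /box /= !subr0 !normrM (gtr0_norm r0).
  have b (x : R) : `|x| <= 1 -> r * `|x| < eps.
    by move=> x1; apply: le_lt_trans re; rewrite ler_piMr // ltW.
  by split; apply: b; rewrite ?cos_max // sin_max.
near (0 : R)^'+ => r.
have r0 : 0 < r by near: r; exact: nbhs_right_gt.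
have [Ar Dr] : A (r, 0) /\ 0 < (to_plane c' (from_plane c (r, 0))).1 by near: r; exact: Dax.
have sm : forall t, A (dilate r (circle t)) by near: r; exact: small.
have [theta [thc th1 th']] : exists theta : R -> R,
    [/\ {within `[0, 1], continuous theta}, theta 1 = theta 0 + 1 &
      forall t, 0 <= t <= 1 -> exists2 m, 0 < m &
        to_plane c' (from_plane c (dilate r (circle t))) = dilate m (circle (theta t))].
  near: r; apply: filterS op => r [theta [thc th1 th]]; exists theta; split => // t.
  move=> /th[m m0]; rewrite /= !add0r (flat_from0 fl) -/p p0' add0r => e0.
  by exists m.
have sgn2 t : 0 <= t <= 1 -> (0 < f (dilate r (circle t))) = (0 < sin (2 * pi * theta t)) /\
    (f (dilate r (circle t)) < 0) = (sin (2 * pi * theta t) < 0).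
  by move=> /th'[m m0 e0]; rewrite /f e0 /= pmulr_rgt0 // pmulr_rlt0.
have c0 : circle 0 = (1, 0) :> R * R by rewrite /circle mulr0 cos0 sin0.
have [m m0 e0] := th' 0 ltac:(by rewrite lexx ler01).
have d0 : dilate r (circle 0) = (r, 0) by rewrite c0 /dilate /= mulr1 mulr0.
rewrite d0 in e0.
apply: (turn_side thc th1).
- by have := Dr; rewrite e0 /= pmulr_rgt0.
- have [_ _ fz] := hA _ Ar; have : f (r, 0) = 0 by apply/fz.
  by rewrite /f e0 /= => /eqP; rewrite mulf_eq0 gt_eqF //= => /eqP.
- move=> t t01; rewrite -(sgn2 t _).2; last by case/andP: t01 => *; apply/andP; split; lra.
  apply: (H _ (sm t)).1; rewrite /= mulr_gt0 //; apply: sin_turn_gt0.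
  by case/andP: t01 => *; apply/andP; split; lra.
- move=> t t01; rewrite -(sgn2 t _).1; last by case/andP: t01 => *; apply/andP; split; lra.
  apply: (H _ (sm t)).2; rewrite /= pmulr_rlt0 //.
  have -> : 2 * pi * t = 2 * pi * (t - 1) + pi *+ 2 by ring.
  by rewrite sinD2pi; apply: sin_turn_lt0; case/andP: t01 => *; apply/andP; split; lra.
Unshelve. all: by end_near. Qed.

End Sides.
End FlatCharts.

(** * Potentials *)

Lemma translate_snd (R : realType) (B : topologicalType) (c : coord_chart R B) a q :
  a.2 = 0 -> (to_plane (translate c a) q).2 = (to_plane c q).2.
Proof.
by case: a => x y /= ->; transitivity ((to_plane c q).2 - 0); rewrite ?subr0.
Qed.

Section Potentials.
Context (R : realType) (B : topologicalType) (S : oriented_surface R B).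
Context (X : Type) (H : groupType) (phi : X -> H).
Hypothesis hausB : hausdorff_space B.
Hypothesis cptB : compact [set: B].

Definition edge_values (G : graph_data R B X) (F : B -> H) (p : B) (e : edge G)
    (c : coord_chart R B) (h : H) : Prop :=
  \forall q \near p, (0 < (to_plane c q).2 -> F q = h) /\
    ((to_plane c q).2 < 0 -> F q = (h * phi (label e))%g).

(* In a flat chart, h is the value to the left of the edge; a path going
   downwards in the chart has the letter with exponent +1. Vertices satisfy
   neither alternative. *)
Definition pot (G : graph_data R B X) (F : B -> H) (p : B) : Prop :=
  (~ support G p /\ exists h, \forall q \near p, ~ support G q -> F q = h) \/
  (exists e s c h, [/\ @edom _ _ _ G e s, p = epath e s, flat_chart S e s c &
     edge_values F p e c h]).

Section Transfer.
Context (G G' : graph_data R B X) (grG : is_graph S G) (grG' : is_graph S G').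
Context (e : edge G) (s : R) (c : coord_chart R B).
Context (e' : edge G') (s' : R) (c' : coord_chart R B).
Hypotheses (es : edom e s) (es' : edom e' s').
Hypotheses (fl : flat_chart S e s c) (fl' : flat_chart S e' s' c').
Hypothesis epp : epath e s = epath e' s'.
Hypothesis lab : label e = label e'.
Hypothesis dir : \forall u \near s & u' \near s',
  epath e u = epath e' u' -> (u < s) = (u' < s').
Hypothesis sup : \forall q \near epath e s, support G q <-> support G' q.

(** Two graphs are allowed because the lemma serves twice: with equal graphs it makes the values
    independent of the flat chart, and with different ones it carries potentials over to a graph
    that agrees locally. *)
Lemma edge_values_transfer F h :
  edge_values F (epath e s) e c h -> edge_values F (epath e s) e' c' h.
Proof.
move=> vals; have sides := flat_same_side grG grG' es es' fl fl' epp dir sup.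
have S0 := flat_support fl; have S' := flat_support fl'; rewrite -epp in S'.
near=> q.
have [v1 v2] : (0 < (to_plane c q).2 -> F q = h) /\
    ((to_plane c q).2 < 0 -> F q = (h * phi (label e))%g) by near: q.
have [d1 d2] : (0 < (to_plane c q).2 -> 0 < (to_plane c' q).2) /\
  ((to_plane c q).2 < 0 -> (to_plane c' q).2 < 0) by near: q.
have [_ s1] : cdom c q /\ (support G q <-> (to_plane c q).2 = 0) by near: q.
have [_ s2] : cdom c' q /\ (support G' q <-> (to_plane c' q).2 = 0) by near: q.
have s3 : support G q <-> support G' q by near: q.
split => q2; have [n|n|n] := ltgtP (to_plane c q).2 0.
- by exfalso; have := d2 n; lra.
- exact: v1.
- by exfalso; move/s1/s3/s2: n; lra.
- by rewrite -lab; exact: v2.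
- by exfalso; have := d1 n; lra.
- by exfalso; move/s1/s3/s2: n; lra.
Unshelve. all: by end_near. Qed.

End Transfer.

Section OneGraph.
Context (G : graph_data R B X).
Hypothesis grG : is_graph S G.
Implicit Types (e : edge G) (s : R) (v : vertex G) (c : coord_chart R B).
Implicit Types (F : B -> H) (p : B).

Let off q := ~ support G q.

Lemma off_near p : off p -> \forall q \near p, off q.
Proof.
move=> op; apply: (@open_nbhs_nbhs _ p (~` support G)); split => //.
exact: (closed_openC (support_closed hausB grG cptB)).
Qed.

Lemma edge_values_mull F p e c h k :
  edge_values F p e c h -> edge_values (fun q => k * F q)%g p e c (k * h)%g.
Proof. by apply: filterS => q [h1 h2]; split => hq; [rewrite h1 | rewrite h2 // mulgA]. Qed.

Lemma pot_mull F p k : pot G F p -> pot G (fun q => k * F q)%g p.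
Proof.
case=> [[op [h hF]]|[e [s [c [h [es pe fl vals]]]]]].
  by left; split => //; exists (k * h)%g; apply: filterS hF => q hq /hq ->.
by right; exists e, s, c, (k * h)%g; split => //; exact: edge_values_mull.
Qed.

Lemma pot_congr F F' p : (\forall q \near p, off q -> F q = F' q) ->
  pot G F p -> pot G F' p.
Proof.
move=> FF'; case=> [[op [h hF]]|[e [s [c [h [es pe fl vals]]]]]].
  left; split => //; exists h; near=> q => oq.
  by rewrite -(near FF' q) //; apply: (near hF q).
right; exists e, s, c, h; split => //; have sup := flat_support fl.
rewrite -pe in sup; near=> q.
have [v1 v2] : (0 < (to_plane c q).2 -> F q = h) /\
    ((to_plane c q).2 < 0 -> F q = (h * phi (label e))%g) by near: q.
have [_ sq] : cdom c q /\ (support G q <-> (to_plane c q).2 = 0) by near: q.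
by split => hq; rewrite -(near FF' q) //; [exact: v1|move/sq; lra|exact: v2|move/sq; lra].
Unshelve. all: by end_near. Qed.

(** On a hoop [s] and [s'] may differ by an integer, and so may [u] and [u']. For close parameters
    these two integers are at distance less than 1, hence equal, and passing from one parameter to
    the other is a translation. *)
Lemma epath_inj_near e s e' s' : edom e s -> edom e' s' -> epath e s = epath e' s' ->
  e = e' /\ \forall u \near s & u' \near s',
  epath e u = epath e' u' -> (u < s) = (u' < s').
Proof.
move=> es es' ep; have [ee' ss'] := edge_inj grG es es' ep; split => //.
subst e'; have nb (x : R) : \forall u \near x, `|u - x| < 1 / 2 /\ (edom e x -> edom e u).
  have h1 : \forall u \near x, `|u - x| < 1 / 2.
    by apply/nbhs_ballP; exists (1 / 2) => //= u; rewrite /ball /= distrC.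
  have [ex|ex] := pselect (edom e x); last by apply: filterS h1 => u; split.
  by apply: filterS2 h1 (edom_near ex) => u; split.
exists ([set u | `|u - s| < 1 / 2 /\ (edom e s -> edom e u)],
        [set u | `|u - s'| < 1 / 2 /\ (edom e s' -> edom e u)]); first by split; exact: nb.
move=> [u u'] /= [[us /(_ es) eu] [us' /(_ es') eu']] epu.
suff -> : u = s + (u' - s') by rewrite gtrDl subr_lt0.
have [_ h] := edge_inj grG eu eu' epu.
have near1 : `|(u - u') - (s - s')| < 1.
  have -> : (u - u') - (s - s') = (u - s) - (u' - s') by ring.
  by rewrite (le_lt_trans (ler_normB _ _)) //; lra.
suff /eqP : (u - u') - (s - s') = 0 by rewrite subr_eq0 => /eqP e0; lra.
have int0 (x : R) : x \is a Num.int -> `|x| < 1 -> x = 0.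
  move=> /intrP[n ->]; rewrite -intr_norm -[1]/(1%:~R) ltr_int.
  by case: n => [[|n]|n].
apply: int0 => //; apply: rpredB.
  by case: h => [->|[]//]; rewrite subrr rpred0.
by case: ss' => [->|[]//]; rewrite subrr rpred0.
Qed.

(** At an edge the factor [h * h'^-1] found on the left side also serves on the right side, where
    both values are multiplied on the right by the same label. *)
Lemma pot_unique F F' p : pot G F p -> pot G F' p -> same_germ off F F' p.
Proof.
case=> [[op [h hF]]|[e [s [c [h [es pe fl vals]]]]]].
  case=> [[_ [h' hF']]|[e [s [c [h' [es pe fl vals]]]]]]; last first.
    by case: op; rewrite pe; exact: edge_support.
  exists (h * h'^-1)%g; near=> q => oq.
  by rewrite (near hF q) // (near hF' q) // mulgVK.
case=> [[op _]|[e' [s' [c' [h' [es' pe' fl' vals']]]]]].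
  by case: op; rewrite pe; exact: edge_support.
have pp : epath e' s' = epath e s by rewrite -pe -pe'.
have [ee' dir] := epath_inj_near es' es pp.
have sup : \forall q \near epath e' s', support G q <-> support G q by near=> q.
rewrite pe' in vals'.
have lab : label e' = label e by rewrite ee'.
have := edge_values_transfer grG grG es' es fl' fl pp lab dir sup vals'.
rewrite -pe' => {}vals'; have S0 := flat_support fl; rewrite -pe in S0.
exists (h * h'^-1)%g; near=> q => oq.
have [v1 v2] : (0 < (to_plane c q).2 -> F q = h) /\
    ((to_plane c q).2 < 0 -> F q = (h * phi (label e))%g) by near: q.
have [v3 v4] : (0 < (to_plane c q).2 -> F' q = h') /\
    ((to_plane c q).2 < 0 -> F' q = (h' * phi (label e))%g) by near: q.
have [_ sq] : cdom c q /\ (support G q <-> (to_plane c q).2 = 0) by near: q.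
have [n|n|n] := ltgtP (to_plane c q).2 0.
- by rewrite v2 // v4 // !mulgA mulgVK.
- by rewrite v1 // v3 // mulgVK.
- by case: oq; apply/sq.
Unshelve. all: by end_near. Qed.

(** At nearby points of the edge the recentred chart has the same second coordinate, hence the same
    values on the two sides; off the edge the sign of this coordinate is locally constant. *)
Lemma pot_near F p : pot G F p -> \forall q \near p, pot G F q.
Proof.
case=> [[op [h hF]]|[e [s [c [h [es pe fl vals]]]]]].
  have /nbhs_interior hF' := hF; have oo := off_near op.
  by near=> q; left; split; [near: q | exists h; near: q].
have S0 := flat_support fl; rewrite -pe in S0.
have /nbhs_interior vals' := vals.
have tr := flat_translate grG fl es.
have vn : \forall u \near s, edge_values F (epath e u) e (translate c (to_plane c (epath e u))) h.
  rewrite pe in vals'; have := epath_continuous_at grG es vals'.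
  have [d d0 hd] := flat_edge grG fl es.
  move=> vn; near=> u.
  have [_ _ u2 _] : [/\ edom e u, cdom c (epath e u), (to_plane c (epath e u)).2 = 0
    & forall u' : R, `|u' - s| < d -> u < u' ->
      (to_plane c (epath e u)).1 < (to_plane c (epath e u')).1].
    apply: hd; near: u; apply/nbhs_ballP; exists d => // u; by rewrite /ball /= distrC.
  have vu : nbhs (epath e u) (fun q => (0 < (to_plane c q).2 -> F q = h) /\
    ((to_plane c q).2 < 0 -> F q = (h * phi (label e))%g)) by near: u; exact: vn.
  by apply: filterS vu => q; rewrite translate_snd.
have both := nbhsI vn (nbhsI tr (edom_near es)).
have /nbhs_ballP[d /= d0 hd] := both.
have par := flat_param grG fl es d0; rewrite -pe in par.
near=> q.
have [sq|oq] := pselect (support G q).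
  have [u [us eu qu]] : exists u, [/\ `|u - s| < d, edom e u & q = epath e u].
    by move: sq; near: q.
  have [|vu [tu _]] := hd u; first by rewrite /ball /= distrC.
  by right; exists e, u, (translate c (to_plane c (epath e u))), h; split => //; rewrite qu.
left; split => //.
have [dq sq] : cdom c q /\ (support G q <-> (to_plane c q).2 = 0) by near: q.
have vq : nbhs q (fun q => (0 < (to_plane c q).2 -> F q = h) /\
    ((to_plane c q).2 < 0 -> F q = (h * phi (label e))%g)) by near: q.
have tc : (to_plane c x).2 @[x --> q] --> (to_plane c q).2.
  apply: (@continuous_comp _ _ _ (to_plane c) snd); last exact: cvg_snd.
  exact: to_continuous.
have [n|n|n] := ltgtP (to_plane c q).2 0; last by case: oq; apply/sq.
- have lt0 : \forall x \near q, (to_plane c x).2 < 0 by apply: (cvgr_lt _ tc).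
  by exists (h * phi (label e))%g; apply: filterS2 lt0 vq => x x0 [_ h2] _; exact: h2.
- have gt0 : \forall x \near q, 0 < (to_plane c x).2 by apply: (cvgr_gt _ tc).
  by exists h; apply: filterS2 gt0 vq => x x0 [h1 _] _; exact: h1.
Unshelve. all: by end_near. Qed.

Lemma edge_pot_exists e s c (h : H) : edom e s -> flat_chart S e s c ->
  pot G (fun q => if 0 < (to_plane c q).2 then h else (h * phi (label e))%g) (epath e s).
Proof.
move=> es fl; right; exists e, s, c, h; split => //; near=> q.
by split => [->//|h0]; rewrite ltNge ltW.
Unshelve. all: by end_near. Qed.

Lemma pot_exists p : (forall v, p <> position v) -> exists F, pot G F p.
Proof.
move=> pv; have [sp|op] := pselect (support G p); last first.
  by exists (fun=> 1%g); left; split => //; exists 1%g; near=> q.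
case: sp => [[v pe]|[e [s [es pe]]]]; first by case: (pv v).
have [c fl] := edge_flat grG es.
by eexists; rewrite pe; apply: (edge_pot_exists 1%g es fl).
Unshelve. all: by end_near. Qed.

Lemma off_dense p (U : set B) : nbhs p U -> exists2 q, U q & ~ support G q.
Proof.
have edge_case e s U' : edom e s -> nbhs (epath e s) U' -> exists2 q, U' q & off q.
  move=> es; have [c fl] := edge_flat grG es.
  move=> /(nbhsI (flat_support fl))/(proj1 (near_flat fl _)) N.
  have N' := nbhsI (near_cimg (flat_cimg0 fl)) N.
  have /near_prodR[d d0 hd] := N'.
  have [|cz [[_ sz] Uz]] := hd (0, d / 2) ltac:(by rewrite /= subrr normr0).
    by rewrite /= subr0 ger0_norm; lra.
  exists (from_plane c (0, d / 2)) => //; move/sz; rewrite from_planeK //=; lra.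
move=> pU; have [sp|op] := pselect (support G p); last first.
  by exists p => //; exact: nbhs_singleton.
case: sp => [[v pe]|[e [s [es pe]]]]; last by apply: (edge_case e s) => //; rewrite -pe.
have [c Sc dp] := atlas_cover S p.
have /nbhs_interior pU' := pU.
have := nbhsI (vertex_discrete hausB G p) pU' => /(proj1 (near_to _ dp)) N.
have cp := to_plane_img dp.
have N' := nbhsI (near_cimg cp) N.
have /near_prodR[d d0 hd] := N'.
(* No vertex other than [p] is near [p], so a point slightly above [p] is off the graph or interior
   to an edge, and then the case of an edge applies to it. *)
pose z := ((to_plane c p).1, (to_plane c p).2 + d / 2).
have [||cz [vz /= Uz]] := hd z.
- by rewrite /= subrr normr0.
- by rewrite /= addrC addKr ger0_norm; lra.
have zp : from_plane c z <> p.
  move=> e0; have : to_plane c (from_plane c z) = to_plane c p by rewrite e0.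
  by rewrite from_planeK // => /(congr1 snd) /= /eqP; rewrite -subr_eq0 addrAC subrr add0r gt_eqF // divr_gt0.
have [sz|oz] := pselect (support G (from_plane c z)); last first.
  by exists (from_plane c z) => //; exact: nbhs_singleton.
case: sz => [[v' e0]|[e [s [es e0]]]]; last by apply: (edge_case e s) => //; rewrite -e0.
have [vp|vp] := pselect (position v' = p); first by case: zp; rewrite e0.
by case: (vz v').
Qed.

End OneGraph.

Lemma pot_agree (G G' : graph_data R B X) (U K : set B) F p :
  is_graph S G -> is_graph S G' -> open U -> U `<=` K -> agree_on K G G' ->
  U p -> pot G F p -> pot G' F p.
Proof.
move=> grG grG' Uo UK [sK vK eK] Up.
have nU : nbhs p U by apply: open_nbhs_nbhs.
have sup : \forall q \near p, support G q <-> support G' q.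
  apply: filterS nU => q /UK Kq.
  have /(congr1 (fun A => A q)) /= e0 := sK; split => sq.
    by have : (support G q /\ K q) by []; rewrite /setI /= in e0; rewrite e0 => -[].
  by have : (support G' q /\ K q) by []; rewrite /setI /= in e0; rewrite -e0 => -[].
case=> [[op [h hF]]|[e [s [c [h [es pe fl vals]]]]]].
  left; split; first by move/(nbhs_singleton sup).
  by exists h; apply: filterS2 sup hF => q sq hq oq; apply: hq => /sq.
have sp : support G' p by apply/(nbhs_singleton sup); rewrite pe; exact: edge_support.
case: sp => [[v' pv]|[e' [s' [es' pe']]]].
  (* A vertex of [G'] at [p] would give a vertex of [G] there, but [p] is interior to an edge of
     [G]. *)
  have [v vp _] := (vK p (black v') (UK _ Up)).2 (ex_intro2 _ _ v' (esym pv) erefl).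
  by case: (edge_not_vertex grG es (v := v)); rewrite vp.
have epp : epath e s = epath e' s' by rewrite -pe -pe'.
have [lab dirK] := eK e s e' s' es es' epp ltac:(by rewrite -pe; exact: UK).
have [c' fl'] := edge_flat grG' es'.
have dir : \forall u \near s & u' \near s', epath e u = epath e' u' -> (u < s) = (u' < s').
  have Us : \forall u \near s, U (epath e u).
    by apply: (epath_continuous_at grG es); rewrite -pe.
  have Us' : \forall u \near s & u' \near s', U (epath e u).
    by exists ([set u | U (epath e u)], setT) => //=; [split => //; exact: filterT | move=> [u u'] []].
  apply: filterS2 Us' dirK => -[u u'] /= Uu h' ee; apply: h' => //; exact: UK.
rewrite pe in sup vals.
right; exists e', s', c', h; split => //; rewrite pe.
exact: (edge_values_transfer grG grG' es es' fl fl' epp lab dir sup vals).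
Qed.

End Potentials.

(** * Potentials on star-shaped regions *)

Section LocalPotentials.
Context (R : realType) (B : topologicalType) (S : oriented_surface R B).
Context (X : Type) (H : groupType) (phi : X -> H).
Hypothesis hausB : hausdorff_space B.
Hypothesis cptB : compact [set: B].
Context (G : graph_data R B X).
Hypothesis grG : is_graph S G.
Implicit Types (c : coord_chart R B) (F : B -> H).

Let off q := ~ support G q.
Local Notation pot := (pot S phi G).

Lemma same_germ_from c z (off' : set B) F F' : cimg c z ->
  same_germ off' F F' (from_plane c z) <->
  same_germ (off' \o from_plane c) (F \o from_plane c) (F' \o from_plane c) z.
Proof.
move=> cz; split=> -[h hF]; exists h; first exact: (proj1 (near_from _ cz) hF).
by apply/(near_from _ cz); exact: hF.
Qed.

Lemma off_dense_from c z U : cimg c z -> nbhs z U ->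
  exists2 q, U q & off (from_plane c q).
Proof.
move=> cz zU; have N : \forall q \near from_plane c z, cdom c q /\ U (to_plane c q).
  apply/(near_from _ cz); have := near_cimg cz; apply: filterS2 zU => z' Uz cz'.
  by rewrite from_planeK //; split => //; exact: from_plane_dom.
have [q [dq Uq] oq] := off_dense hausB grG N.
by exists (to_plane c q) => //; rewrite to_planeK.
Qed.

Lemma pot_germ F F' p : pot F p -> same_germ off F' F p -> pot F' p.
Proof.
move=> Fp [h hF]; apply: (pot_congr (F := fun q => h * F q)%g); last exact: pot_mull.
by apply: filterS hF => q hq /hq.
Qed.

Lemma model_exists : exists M : B -> B -> H,
  forall p, (forall v : vertex G, p <> position v) -> pot (M p) p.
Proof.
suff /choice[M HM] : forall p, exists F, (forall v : vertex G, p <> position v) -> pot F p.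
  by exists M.
move=> p.
have [pv|pv] := pselect (forall v : vertex G, p <> position v).
  by have [F HF] := pot_exists phi grG pv; exists F.
by exists (fun=> 1%g).
Qed.

(** A potential at a point is one at all nearby points, where it is unique up to a left factor: this
    is the consistency of local models that [glue_star] requires. *)
Lemma star_potential c (O : set (R * R)) (o : R * R) :
  open O -> O `<=` cimg c -> O o ->
  (forall q (t : R), O q -> 0 <= t <= 1 -> O (seg o q t)) ->
  (forall z (v : vertex G), O z -> from_plane c z <> position v) ->
  exists F, forall z, O z -> pot F (from_plane c z).
Proof.
move=> Oo Oc oO Os Ov; have [M HM] := model_exists.
have HMz z : O z -> pot (M (from_plane c z)) (from_plane c z).
  by move=> Oz; apply: HM => v; exact: Ov.
have [||F HF] := @glue_star R H (off \o from_plane c)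
    (fun z => M (from_plane c z) \o from_plane c) O o Oo oO Os.
- by move=> z U Oz; apply: off_dense_from; exact: Oc.
- move=> z Oz; have cz := Oc z Oz.
  have nO : \forall z' \near z, O z' by apply: open_nbhs_nbhs.
  have := proj1 (near_from _ cz) (pot_near hausB cptB grG (HMz z Oz)).
  apply: filterS2 nO => z' Oz' pz'; apply/same_germ_from; first exact: Oc.
  by apply: (pot_unique grG pz'); exact: HMz.
exists (F \o to_plane c) => z Oz; apply: pot_germ (HMz z Oz) _.
apply/same_germ_from; first exact: Oc.
apply: same_germ_congr (HF z Oz); have := near_cimg (Oc z Oz).
by apply: filterS => z' cz' _; rewrite /= from_planeK.
Qed.

Lemma star_potential_unique c (O : set (R * R)) (o : R * R) F F' :
  O `<=` cimg c -> O o ->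
  (forall q (t : R), O q -> 0 <= t <= 1 -> O (seg o q t)) ->
  (forall z, O z -> pot F (from_plane c z)) ->
  (forall z, O z -> pot F' (from_plane c z)) ->
  exists h, forall z, O z ->
    \forall q \near from_plane c z, off q -> F q = (h * F' q)%g.
Proof.
move=> Oc oO Os HF HF'.
have [||h Hh] := @star_const R H (off \o from_plane c) O o
  (fun z => F (from_plane c z) * (F' (from_plane c z))^-1)%g oO Os.
- by move=> z U Oz; apply: off_dense_from; exact: Oc.
- move=> z Oz; apply: (@same_germ_quotient _ _ _ (F \o from_plane c) (F' \o from_plane c)).
  apply/same_germ_from; first exact: Oc.
  by apply: (pot_unique grG); [exact: HF | exact: HF'].
exists h => z Oz; apply/(near_from _ (Oc z Oz)).
by apply: filterS (Hh z Oz) => q hq /hq <-; rewrite mulgVK.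
Qed.

(** The new value at [q] is that of the potential attached to [q]. Potentials attached to close
    points both agree with [F] on the dense complement of [N], so the factor between them is 1. *)
Lemma pot_fill (W : set B) (N : set B) F :
  open W -> (forall p U, W p -> nbhs p U -> exists2 q, U q & off q /\ ~ N q) ->
  (forall p, W p -> exists2 F', pot F' p &
     \forall q \near p, off q -> ~ N q -> F q = F' q) ->
  exists F', forall p, W p -> pot F' p.
Proof.
move=> Wo dns loc.
have [Fs HFs] : exists Fs : B -> B -> H, forall p, W p -> pot (Fs p) p /\
    \forall q \near p, off q -> ~ N q -> F q = Fs p q.
  suff /choice[Fs HFs] : forall p, exists F', W p -> pot F' p /\
      \forall q \near p, off q -> ~ N q -> F q = F' q by exists Fs.
  move=> p.
  have [Wp|Wp] := pselect (W p); last by exists F.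
  by have [F' h1 h2] := loc p Wp; exists F'.
exists (fun q => Fs q q) => p Wp; have [pp Np] := HFs p Wp.
apply: pot_congr pp.
have /nbhs_interior Np' := Np.
have Wn : \forall q \near p, W q by apply: open_nbhs_nbhs.
have pn := pot_near hausB cptB grG (HFs p Wp).1.
near=> q => oq.
have Wq : W q by near: q.
have pq : pot (Fs p) q by near: q.
have [qq Nq] := HFs q Wq.
have Npq : nbhs q (fun q => off q -> ~ N q -> F q = Fs p q) by near: q.
have [h Hh] := pot_unique grG pq qq.
have [x [[x1 x2] x3] [ox nx]] := dns q _ Wq (nbhsI (nbhsI Npq Nq) Hh).
have h1 : h = 1%g.
  apply: (mulIg (Fs q x)); rewrite mul1g -x3 // -x1 //; exact: x2.
by rewrite (nbhs_singleton Hh) // h1 mul1g.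
Unshelve. all: by end_near. Qed.

Definition slit (z0 d : R * R) : set (R * R) :=
  [set z | cross d (z - z0) = 0 /\ 0 <= d.1 * (z - z0).1 + d.2 * (z - z0).2].

(** The centre lies on the ray opposite to the slit. A segment issuing from it that meets the slit
    continues inside it, so it ends in the slit. *)
Lemma slit_star (z0 d : R * R) (e : R) : 0 < e -> d != 0 ->
  exists2 o, (box z0 e `\` slit z0 d) o & forall q (t : R),
    (box z0 e `\` slit z0 d) q -> 0 <= t <= 1 -> (box z0 e `\` slit z0 d) (seg o q t).
Proof.
move=> e0 d0; have n0 : 0 < sqnorm d.
  rewrite /sqnorm; case: d d0 => x y d0 /=.
  have [x0|nx0] := eqVneq x 0; last first.
    by rewrite ltr_wpDr ?sqr_ge0 // exprn_even_gt0.
  rewrite ltr_wpDl ?sqr_ge0 // exprn_even_gt0 //=; apply: contra d0 => /eqP y0.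
  by rewrite x0 y0.
(* Small enough for [z0 - k d] to stay in the box. *)
pose k := e / (1 + `|d.1| + `|d.2|).
have a1 := normr_ge0 d.1; have a2 := normr_ge0 d.2.
have k0 : 0 < k by apply: divr_gt0 => //; lra.
have kd (x : R) : `|x| <= `|d.1| + `|d.2| -> `|k * x| < e.
  move=> xd; rewrite normrM (gtr0_norm k0) /k mulrAC ltr_pdivrMr; last lra.
  by rewrite ltr_pM2l //; lra.
pose o := (z0.1 - k * d.1, z0.2 - k * d.2).
have bo : box z0 e o.
  have e1 (x y : R) : x - k * y - x = - (k * y) by ring.
  by rewrite /box /o /= !e1 !normrN; split; apply: kd; lra.
have so : ~ slit z0 d o.
  rewrite /slit /o /= => -[_].
  have -> : d.1 * (z0.1 - k * d.1 - z0.1) + d.2 * (z0.2 - k * d.2 - z0.2) = - (k * sqnorm d).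
    by rewrite /sqnorm; ring.
  by rewrite oppr_ge0 leNgt mulr_gt0.
exists o => // q t [bq sq] t01; split; first exact: box_seg.
move: t01 => /andP[]; rewrite le_eqVlt => /predU1P[<- _|t0 t1]; first by rewrite seg0.
move=> [c1 c2]; apply: sq; split.
  apply: (mulfI (lt0r_neq0 t0)); rewrite mulr0 -c1.
  by rewrite /cross /seg /o /=; ring.
rewrite -(pmulr_rge0 _ t0).
have : 0 <= (1 - t) * (k * sqnorm d).
  by apply: mulr_ge0; [lra | apply: mulr_ge0; exact: ltW].
move: c2; rewrite /sqnorm /seg /o /=; set a := (X in 0 <= X -> _); set b := (X in _ -> 0 <= X -> _).
suff -> : t * (d.1 * (q - z0).1 + d.2 * (q - z0).2) = a + b by move=> *; exact: addr_ge0.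
by rewrite /a /b /=; ring.
Qed.

Lemma slit_open (z0 d : R * R) (e : R) : open (box z0 e `\` slit z0 d).
Proof.
apply: openI; first exact: box_open.
apply: closed_openC.
have sc : continuous (fun z : R * R => z - z0).
  by move=> z; apply: cvgB; [exact: cvg_id | exact: cvg_cst].
pose f1 z := cross d (z - z0); pose f2 z := d.1 * (z - z0).1 + d.2 * (z - z0).2.
have -> : slit z0 d = f1 @^-1` [set 0] `&` f2 @^-1` [set x | 0 <= x] by [].
have c1 : continuous f1.
  by move=> z; exact: (continuous_comp (sc z) (@cross_continuous _ d (z - z0))).
have c2 : continuous f2.
  move=> z; apply: cvgD; apply: cvgM; try exact: cvg_cst.
    exact: (continuous_comp (sc z) (@cvg_fst _ _ _ _ _)).
  exact: (continuous_comp (sc z) (@cvg_snd _ _ _ _ _)).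
apply: closedI; apply: preimage_closed.
- by move=> z _; exact: c1.
- exact: closed_eq.
- by move=> z _; exact: c2.
- exact: closed_ge.
Qed.

Lemma slit_potential c (v : vertex G) (e : R) (d : R * R) : 0 < e -> d != 0 ->
  cdom c (position v) -> let z0 := to_plane c (position v) in
  box z0 e `<=` cimg c ->
  (forall z (v' : vertex G), box z0 e z -> from_plane c z = position v' -> v' = v) ->
  exists F, forall z, (box z0 e `\` slit z0 d) z -> pot F (from_plane c z).
Proof.
move=> e0 d0 dv z0 bc bv; have [b oO Os] := slit_star z0 e0 d0.
apply: (@star_potential c _ b) => //; first exact: slit_open.
  by move=> z [/bc].
move=> z v' [bz sz] zv; have vv := bv z v' bz zv; apply: sz.
have -> : z = z0 by rewrite /z0 -vv -zv from_planeK //; exact: bc.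
by rewrite /slit /cross /= !subrr !mulr0 subrr addr0.
Qed.

End LocalPotentials.

(** * The neighbourhood of a vertex *)

Section WordValue.
Context (X : Type) (H : groupType) (phi : X -> H).

Definition letter_val (l : X * bool) : H := if l.2 then phi l.1 else (phi l.1)^-1%g.

Definition word_val (w : word X) : H := foldr (fun l a => letter_val l * a)%g 1%g w.

(** The product of the letters read strictly before time [u]: the model of a potential along the
    meridian, starting from 1. At a crossing it still has the value from before the crossing. *)
Fixpoint prefix_val (R : realType) (ts : seq R) (w : word X) (u : R) : H :=
  match ts, w with
  | t :: ts', l :: w' => ((if (t < u)%R then letter_val l else 1) * prefix_val ts' w' u)%g
  | _, _ => 1%g
  end.

Lemma prefix_val_ge (R : realType) (ts : seq R) w u :
  {in ts, forall t, u <= t} -> prefix_val ts w u = 1%g.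
Proof.
elim: ts w => [|t ts IH] [|l w] //= h.
rewrite ifN ?mul1g; first by apply: IH => x xt; apply: h; rewrite inE xt orbT.
by rewrite -leNgt h // inE eqxx.
Qed.

Lemma prefix_val_lt (R : realType) (ts : seq R) w u :
  size ts = size w -> {in ts, forall t, t < u} -> prefix_val ts w u = word_val w.
Proof.
elim: ts w => [|t ts IH] [|l w] //= [sz] h; rewrite h ?inE ?eqxx //.
by rewrite IH // => x xt; apply: h; rewrite inE xt orbT.
Qed.

Lemma prefix_val_near (R : realType) (P : R -> X * bool -> Prop) (ts : seq R) w u0 :
  sorted (fun x y => x < y) ts -> List.Forall2 P ts w ->
  (u0 \notin ts -> \forall u \near u0, prefix_val ts w u = prefix_val ts w u0) /\
  (u0 \in ts -> exists2 l, P u0 l & \forall u \near u0,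
     prefix_val ts w u = (prefix_val ts w u0 * (if u0 < u then letter_val l else 1))%g).
Proof.
move=> + F; elim: F => [|t l ts' w' Pl _ IH] srt.
  by split => // _; near=> u.
have srt' := path_sorted srt.
have lt_t : {in ts', forall x, t < x}.
  by apply/allP; apply: order_path_min srt; exact: lt_trans.
have [IH1 IH2] := IH srt'.
have [u0t|tu0|e0] := ltgtP u0 t.
- have nt : u0 \notin ts'.
    by apply/negP => /lt_t; rewrite ltNge ltW.
  split; last by rewrite inE lt_eqF //= (negbTE nt).
  move=> _; near=> u; have ut : u < t by near: u; exact: lt_nbhsl.
  rewrite /= !ifN -?leNgt ?(ltW ut) ?(ltW u0t) // !mul1g.
  by near: u; exact: IH1.
- have near_t : \forall u \near u0, t < u by exact: lt_nbhsr.
  rewrite inE gt_eqF //=; split => [/IH1 h|/IH2[l' Pl' h]].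
    by apply: filterS2 near_t h => u tu hu; rewrite /= tu tu0 hu.
  exists l' => //; apply: filterS2 near_t h => u tu hu.
  by rewrite /= tu tu0 hu mulgA.
- subst t; have tn : u0 \notin ts' by apply/negP => /lt_t; rewrite ltxx.
  split; first by rewrite inE eqxx.
  move=> _; exists l => //; apply: filterS (IH1 tn) => u hu.
  rewrite /= ltxx mul1g hu prefix_val_ge ?mulg1 ?mul1g // => x xt.
  by apply: ltW; exact: lt_t.
Unshelve. all: by end_near. Qed.

End WordValue.

Lemma seq_gap (R : realType) (ts : seq R) (u0 : R) :
  exists2 e : R, 0 < e & forall u, `|u - u0| < e -> u \in ts -> u = u0.
Proof.
elim: ts => [|t ts [e e0 he]]; first by exists 1.
have [->|tu] := eqVneq t u0.
  exists e => // u ue; rewrite inE => /predU1P[//|]; exact: he.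
exists (Num.min e `|t - u0|); first by rewrite lt_min e0 normr_gt0 subr_eq0.
move=> u; rewrite lt_min => /andP[ue ut]; rewrite inE => /predU1P[uu|]; last exact: he.
by rewrite uu ltxx in ut.
Qed.

Section Cone.
Context (R : realType) (B : topologicalType) (S : oriented_surface R B).
Context (X : Type) (H : groupType) (phi : X -> H).
Hypothesis hausB : hausdorff_space B.
Hypothesis cptB : compact [set: B].
Context (G : graph_data R B X).
Hypothesis grG : is_graph S G.
Context (v : vertex G) (c : coord_chart R B) (rho r t0 : R).
Context (ts : seq R) (w : word X).

(** Polar coordinates at the vertex, with angles in full turns counted from the starting angle [t0],
    so that [E r] is the meridian. The hypotheses below unfold [vertex_word], with a box in place of
    the ball. *)
Let E l u := from_plane c (dilate l (circle (u + t0))).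

Hypothesis dv : cdom c (position v).
Hypothesis to0 : to_plane c (position v) = 0.
Hypothesis rrho : 0 < r < rho.
Hypothesis bc : box 0 rho `<=` cimg c.
Hypothesis bv : forall z (v' : vertex G), box 0 rho z ->
  from_plane c z = position v' -> v' = v.
Hypothesis rad : forall z s, box 0 rho z -> 0 < s <= 1 ->
  (support G (from_plane c z) <-> support G (from_plane c (dilate s z))).
Hypothesis srt : sorted (fun x y => x < y) ts.
Hypothesis ts01 : {in ts, forall t, 0 < t < 1}.
Hypothesis supE : forall t, 0 <= t <= 1 -> (support G (E r t) <-> t \in ts).
Hypothesis crossw : List.Forall2 (crossing S G (E r)) ts w.

Let off q := ~ support G q.
Local Notation pot := (pot S phi G).
Local Notation val := (letter_val phi).
Local Notation pre := (prefix_val phi ts w).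

Lemma box_polar l u : 0 < l < rho -> box 0 rho (dilate l (circle u)).
Proof.
move=> /andP[l0 lr]; rewrite /box /= !subr0 !normrM (gtr0_norm l0).
have b (x : R) : `|x| <= 1 -> l * `|x| < rho.
  by move=> x1; apply: le_lt_trans lr; rewrite ler_piMr // ltW.
by split; apply: b; rewrite ?cos_max // sin_max.
Qed.

Lemma cimgE l u : 0 < l < rho -> cimg c (dilate l (circle u)).
Proof. by move=> /box_polar h; exact: bc. Qed.

Lemma toE l u : 0 < l < rho -> to_plane c (E l u) = dilate l (circle (u + t0)).
Proof. by move=> h; rewrite from_planeK //; exact: cimgE. Qed.

Lemma E1 l : E l 1 = E l 0.
Proof. by rewrite /E add0r addrC circleD1. Qed.

Lemma E_support l l' u : 0 < l < rho -> 0 < l' < rho ->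
  support G (E l u) <-> support G (E l' u).
Proof.
have aux a b : 0 < a -> a <= b -> b < rho -> support G (E a u) <-> support G (E b u).
  move=> a0 ab br; have b0 : 0 < b by exact: lt_le_trans ab.
  have bb : 0 < b < rho by rewrite b0.
  rewrite /E (rad (s := a / b) (box_polar (u + t0) bb)); last first.
    by rewrite divr_gt0 //= ler_pdivrMr // mul1r.
  suff -> : dilate (a / b) (dilate b (circle (u + t0))) = dilate a (circle (u + t0)) by [].
  by rewrite /dilate /= !mulrA divfK // gt_eqF.
move=> /andP[l0 lr] /andP[l0' lr']; have [ll|ll] := leP l l'; first exact: aux.
by split => h; apply/(aux l' l) => //; rewrite ltW.
Qed.

Lemma E_ts l u : 0 < l < rho -> 0 <= u <= 1 -> support G (E l u) <-> u \in ts.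
Proof. by move=> lr u01; rewrite -supE //; exact: E_support. Qed.

Lemma E_not_vertex l u (v' : vertex G) : 0 < l < rho -> E l u <> position v'.
Proof.
move=> lr e0; have vv := bv (box_polar _ lr) e0.
have := toE u lr; rewrite e0 vv to0 => /(congr1 sqnorm).
rewrite sqnorm_dilate sqnorm_circle mulr1 /sqnorm /= !expr0n addr0 => /esym/eqP.
by rewrite expf_eq0 /= gt_eqF //; case/andP: lr.
Qed.

Lemma near_E l0 u0 (e : R) : 0 < l0 < rho -> 0 < e ->
  \forall q \near E l0 u0, exists l u, [/\ 0 < l < rho, `|u - u0| < e & q = E l u].
Proof.
move=> lr e0; have [l00 l0r] := andP lr; apply/(near_from _ (cimgE _ lr)).
have m0 : 0 < Num.min e (rho - l0) by rewrite lt_min e0 subr_gt0.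
have := @polar_near R l0 (u0 + t0) _ l00 m0.
apply: filterS => z [l [u [lp]]]; rewrite !lt_min => /andP[_ ll] /andP[ue _] ->.
exists l, (u - t0); split; last by rewrite /E subrK.
  by rewrite lp /=; move: ll; rewrite ltr_distl => /andP[_]; lra.
by have -> : u - t0 - u0 = u - (u0 + t0) by ring.
Qed.

Lemma E_continuous l : 0 < l < rho -> continuous (E l).
Proof.
move=> lr u; apply: (@continuous_comp _ _ _ (fun u => dilate l (circle (u + t0))) (from_plane c)).
  apply: (@continuous_comp _ _ _ (fun u => circle (u + t0)) (dilate l)); last exact: dilate_continuous.
  apply: (@continuous_comp _ _ _ (fun u => u + t0) circle); last exact: circle_continuous.
  by apply: cvgD; [exact: cvg_id | exact: cvg_cst].
by apply: from_continuous; exact: cimgE.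
Qed.

Lemma E_continuous_l l u : 0 < l < rho -> {for l, continuous (E^~ u)}.
Proof.
move=> lr; apply: (@continuous_comp _ _ _ (fun l => dilate l (circle (u + t0))) (from_plane c)).
  apply: (@cvg_pair _ _ _ _ (nbhs _) (nbhs _)) => /=; apply: cvgM;
    try exact: cvg_cst; exact: cvg_id.
by apply: from_continuous; exact: cimgE.
Qed.

Lemma gap u0 : 0 < u0 < 1 -> exists2 e : R, 0 < e & forall u, `|u - u0| < e ->
  [/\ 0 < u < 1, (u \in ts -> u = u0) & `|u - u0| < 1 / 2].
Proof.
move=> /andP[u00 u01]; have [e e0 he] := seq_gap ts u0.
exists (Num.min e (Num.min (1 / 2) (Num.min u0 (1 - u0)))).
  by rewrite !lt_min e0 u00 subr_gt0 u01 /= andbT.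
move=> u; rewrite !lt_min => /andP[ue /andP[uh /andP[ua ub]]].
split => //; last exact: he.
by move: ua ub; rewrite !ltr_norml => /andP[? ?] /andP[? ?]; apply/andP; split; lra.
Qed.

(** Zero on the line that carries the ray of angle [u0], positive on the counterclockwise side of
    the ray. *)
Let Xc u0 q := cross (circle (u0 + t0)) (to_plane c q).

Lemma XcE u0 l u : 0 < l < rho -> Xc u0 (E l u) = l * sin (2 * pi * (u - u0)).
Proof.
move=> lr; rewrite /Xc toE // cross_circle.
by have -> : u + t0 - (u0 + t0) = u - u0 by ring.
Qed.

Lemma Xc_sign u0 l u : 0 < l < rho -> `|u - u0| < 1 / 2 ->
  [/\ (0 < Xc u0 (E l u)) = (u0 < u), (Xc u0 (E l u) < 0) = (u < u0) &
      Xc u0 (E l u) = 0 -> u = u0].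
Proof.
move=> lr; rewrite ltr_norml => /andP[u1 u2]; rewrite XcE //.
have l0 : 0 < l by case/andP: lr.
rewrite pmulr_rgt0 // pmulr_rlt0 //.
have [uu|uu|->] := ltgtP u u0.
- have s0 : sin (2 * pi * (u - u0)) < 0 by apply: sin_turn_lt0; apply/andP; split; lra.
  split; [by rewrite ltNge ltW | by rewrite s0 | ].
  by move/eqP; rewrite mulf_eq0 gt_eqF //= lt_eqF.
- have s0 : 0 < sin (2 * pi * (u - u0)) by apply: sin_turn_gt0; apply/andP; split; lra.
  split; [by rewrite s0 | by rewrite ltNge ltW | ].
  by move/eqP; rewrite mulf_eq0 gt_eqF //= gt_eqF.
- by rewrite subrr mulr0 sin0 ltxx.
Qed.

Lemma ray_support u0 l : 0 < l < rho -> u0 \in ts ->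
  \forall q \near E l u0, cdom c q /\ (support G q <-> Xc u0 q = 0).
Proof.
move=> lr tu; have [e e0 he] := gap (ts01 tu).
have := near_E u0 lr e0; apply: filterS => q [l' [u [lr' ue ->]]].
have [u01 ut uh] := he u ue.
split; first by apply: from_plane_dom; exact: cimgE.
have [_ _ xs] := Xc_sign lr' uh.
have u01' : 0 <= u <= 1 by case/andP: u01 => ? ?; rewrite !ltW.
rewrite E_ts //; split; first by move=> /ut ->; rewrite XcE // subrr mulr0 sin0 mulr0.
by move=> /xs ->.
Qed.

(** The model of a potential near a ray, multiplied by [y] when the ray is crossed
    counterclockwise. *)
Definition ray_step u0 (y : H) (q : B) : H := if 0 < Xc u0 q then y else 1%g.

(* Near a point of a ray, the ray and the edge in a flat chart are the zero sets
   of two functions, whose signs therefore agree or are opposite. *)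
Lemma ray_sides u0 l e s c1 : 0 < l < rho -> u0 \in ts ->
  @edom _ _ _ G e s -> E l u0 = epath e s -> flat_chart S e s c1 ->
  (\forall q \near E l u0, (0 < Xc u0 q -> 0 < (to_plane c1 q).2) /\
     (Xc u0 q < 0 -> (to_plane c1 q).2 < 0)) \/
  (\forall q \near E l u0, (0 < Xc u0 q -> (to_plane c1 q).2 < 0) /\
     (Xc u0 q < 0 -> 0 < (to_plane c1 q).2)).
Proof.
move=> lr tu es Ee fl.
pose z0 : R * R := dilate l (circle (u0 + t0)); have cz0 : cimg c z0 by exact: cimgE.
have S0 := flat_support fl; rewrite -Ee in S0.
have := nbhsI (ray_support lr tu) S0 => /(proj1 (near_from _ cz0)) N.
have /near_prodR[d d0 hd] := nbhsI (near_cimg cz0) N.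
have hA z : box z0 d z -> cimg c z /\
    (cdom c (from_plane c z) /\ (support G (from_plane c z) <-> Xc u0 (from_plane c z) = 0)) /\
    (cdom c1 (from_plane c z) /\ (support G (from_plane c z) <-> (to_plane c1 (from_plane c z)).2 = 0)).
  by move=> [? ?]; apply: hd.
pose f z := (to_plane c1 (from_plane c z)).2.
have both : (exists2 z, box z0 d z & 0 < f z) /\ (exists2 z, box z0 d z & f z < 0).
  have N2 : \forall q \near E l u0, cdom c q /\ box z0 d (to_plane c q).
    apply/(near_from _ cz0); have := near_cimg cz0; apply: filterS2 (box_nbhs z0 d0) => z bz cz.
    by split; [exact: from_plane_dom | rewrite from_planeK].
  rewrite Ee in N2; have {}N2 := proj1 (near_flat fl _) N2.
  have /near_prodR[k k0 hk] := nbhsI (near_cimg (flat_cimg0 fl)) N2.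
  have two (x : R) : `|x| < k -> exists2 z, box z0 d z & f z = x.
    move=> xk; have [||cx [dx bx]] := hk (0, x); rewrite ?subr0 ?normr0 //=.
    exists (to_plane c (from_plane c1 (0, x))) => //.
    by rewrite /f to_planeK // from_planeK.
  have kh : `|k / 2| < k by rewrite gtr0_norm; lra.
  split; first by have [z bz fz] := two _ kh; exists z => //; lra.
  by rewrite -normrN in kh; have [z bz fz] := two _ kh; exists z => //; lra.
have [||||Hs|Hs] := @convex_sides R (box z0 d) (cross (circle (u0 + t0))) f _ _ _ _ both.1 both.2.
- by move=> *; exact: box_seg.
- by move=> *; exact: cross_seg.
- move=> z /hA[cz [[_ _] [dz _]]].
  apply: (@continuous_comp _ _ _ (fun z => to_plane c1 (from_plane c z)) snd); last exact: cvg_snd.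
  apply: (@continuous_comp _ _ _ (from_plane c) (to_plane c1)); first exact: from_continuous.
  exact: to_continuous.
- move=> z /hA[cz [[_ s1] [_ s2]]]; rewrite /f -s2 s1 /Xc from_planeK //.
- left; apply/(near_from _ cz0); have := near_cimg cz0.
  by apply: filterS2 (box_nbhs z0 d0) => z bz cz; rewrite /Xc from_planeK //; exact: Hs.
- right; apply/(near_from _ cz0); have := near_cimg cz0.
  by apply: filterS2 (box_nbhs z0 d0) => z bz cz; rewrite /Xc from_planeK //; exact: Hs.
Qed.

(** Here the left side of the edge is the counterclockwise side of the ray. A counterclockwise path
    goes over to the left of the edge, whence the exponent -1. *)
Lemma step_pot_sides u0 l e s c1 : 0 < l < rho -> u0 \in ts ->
  @edom _ _ _ G e s -> E l u0 = epath e s -> flat_chart S e s c1 ->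
  (\forall q \near E l u0, (0 < Xc u0 q -> 0 < (to_plane c1 q).2) /\
     (Xc u0 q < 0 -> (to_plane c1 q).2 < 0)) ->
  pot (ray_step u0 (phi (label e))^-1%g) (E l u0).
Proof.
move=> lr tu es Ee fl sd; right; exists e, s, c1, (phi (label e))^-1%g; split => //.
have S0 := flat_support fl; rewrite -Ee in S0.
near=> q.
have [a1 a2] : (0 < Xc u0 q -> 0 < (to_plane c1 q).2) /\
     (Xc u0 q < 0 -> (to_plane c1 q).2 < 0) by near: q.
have [_ s1] : cdom c q /\ (support G q <-> Xc u0 q = 0) by near: q; exact: ray_support.
have [_ s2] : cdom c1 q /\ (support G q <-> (to_plane c1 q).2 = 0) by near: q.
rewrite /ray_step mulVg; have [n|n|n] := ltgtP (Xc u0 q) 0.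
- by split => //; have := a2 n => *; exfalso; lra.
- by split => //; have := a1 n => *; exfalso; lra.
- by have := proj1 s2 (proj2 s1 n) => ->; rewrite ltxx.
Unshelve. all: by end_near. Qed.

Lemma step_pot_flipped u0 l e s c1 : 0 < l < rho -> u0 \in ts ->
  @edom _ _ _ G e s -> E l u0 = epath e s -> flat_chart S e s c1 ->
  (\forall q \near E l u0, (0 < Xc u0 q -> (to_plane c1 q).2 < 0) /\
     (Xc u0 q < 0 -> 0 < (to_plane c1 q).2)) ->
  pot (ray_step u0 (phi (label e))) (E l u0).
Proof.
move=> lr tu es Ee fl sd; right; exists e, s, c1, 1%g; split => //.
have S0 := flat_support fl; rewrite -Ee in S0.
near=> q.
have [a1 a2] : (0 < Xc u0 q -> (to_plane c1 q).2 < 0) /\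
     (Xc u0 q < 0 -> 0 < (to_plane c1 q).2) by near: q.
have [_ s1] : cdom c q /\ (support G q <-> Xc u0 q = 0) by near: q; exact: ray_support.
have [_ s2] : cdom c1 q /\ (support G q <-> (to_plane c1 q).2 = 0) by near: q.
rewrite /ray_step mul1g; have [n|n|n] := ltgtP (Xc u0 q) 0.
- by split => //; have := a2 n => *; exfalso; lra.
- by split => //; have := a1 n => *; exfalso; lra.
- by have := proj1 s2 (proj2 s1 n) => ->; rewrite ltxx.
Unshelve. all: by end_near. Qed.

Lemma step_pot_exists u0 l : 0 < l < rho -> u0 \in ts ->
  exists y, pot (ray_step u0 y) (E l u0).
Proof.
move=> lr tu; have u01 := ts01 tu.
have : support G (E l u0) by apply/E_ts => //; case/andP: u01 => ? ?; rewrite !ltW.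
case=> [[v' /(E_not_vertex lr)//]|[e [s [es Ee]]]].
have [c1 fl] := edge_flat grG es.
have [h|h] := ray_sides lr tu es Ee fl.
  by eexists; exact: (step_pot_sides lr tu es Ee fl h).
by eexists; exact: (step_pot_flipped lr tu es Ee fl h).
Qed.

(** Just after [u0] the meridian is on the counterclockwise side of the ray, and the exponent
    prescribes on which side of the edge it is. So the exponent decides which alternative of
    [ray_sides] holds. *)
Lemma crossing_pot u0 l : u0 \in ts -> crossing S G (E r) u0 l ->
  pot (ray_step u0 (val l)) (E r u0).
Proof.
move=> tu [e [s [c1 [es Ee lab fl [near1 near2]]]]].
have [_ _ z0 _ _] := fl; rewrite -Ee in z0.
have [g g0 hg] := gap (ts01 tu).
have [[A1 A2] /= [hA1 hA2] hA] := near2.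
have key (P : B -> Prop) : (\forall q \near E r u0, P q) -> exists u, [/\ P (E r u),
    0 < Xc u0 (E r u) &
    if l.2 then (to_plane c1 (E r u)).2 < 0 else 0 < (to_plane c1 (E r u)).2].
  move=> nP; have nP' : \forall u \near u0, P (E r u) by exact: (E_continuous rrho nP).
  near u0^'+ => u; have uu0 : u0 < u by near: u; exact: nbhs_right_gt.
  have ug : `|u - u0| < g.
    by rewrite gtr0_norm ?subr_gt0 // ltrBlDr addrC; near: u; apply: nbhs_right_lt; lra.
  have [_ _ uh] := hg u ug; have [xs _ _] := Xc_sign rrho uh.
  exists u; split; [by near: u; exact: cvg_within nP' | by rewrite xs |].
  have := hA (u0, u); rewrite /= z0 /=; apply => //.
  by split; [exact: (nbhs_singleton hA1) | near: u; exact: cvg_within hA2].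
have [sd|sd] := ray_sides rrho tu es Ee fl.
  have [u [[a1 _] x0]] := key _ sd; rewrite /letter_val -lab; case: ifP => _.
    by move=> neg; have := lt_trans (a1 x0) neg; rewrite ltxx.
  by move=> _; exact: (step_pot_sides rrho tu es Ee fl sd).
have [u [[a1 _] x0]] := key _ sd; rewrite /letter_val -lab; case: ifP => _.
  by move=> _; exact: (step_pot_flipped rrho tu es Ee fl sd).
by move=> pos; have := lt_trans (a1 x0) pos; rewrite ltxx.
Unshelve. all: by end_near. Qed.

(** Before the ray both functions are 1, so the factor between the two potentials is 1; beyond the
    ray they are [y] and [y']. *)
Lemma step_unique u0 l y y' : 0 < l < rho -> u0 \in ts ->
  pot (ray_step u0 y) (E l u0) -> pot (ray_step u0 y') (E l u0) -> y = y'.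
Proof.
move=> lr tu p1 p2; have [h Hh] := pot_unique grG p1 p2.
have [g g0 hg] := gap (ts01 tu).
have Hu : \forall u \near u0, off (E l u) -> ray_step u0 y (E l u) = (h * ray_step u0 y' (E l u))%g.
  exact: (E_continuous lr Hh).
have offu u : `|u - u0| < g -> u != u0 -> off (E l u).
  move=> /hg[/andP[? ?] tsu _] uu; rewrite /off E_ts ?ltW // => /tsu e0.
  by rewrite e0 eqxx in uu.
have h1 : h = 1%g.
  near u0^'- => u; have uu0 : u < u0 by near: u; exact: nbhs_left_lt.
  have ug : `|u - u0| < g.
    by rewrite distrC gtr0_norm ?subr_gt0 // ltrBlDr addrC -ltrBlDr; near: u; apply: nbhs_left_gt; lra.
  have : off (E l u) -> ray_step u0 y (E l u) = (h * ray_step u0 y' (E l u))%g.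
    by near: u; exact: cvg_within Hu.
  rewrite /ray_step; have [_ _ uh] := hg u ug.
  have [-> _ _] := Xc_sign lr uh; rewrite ltNge ltW //= mulg1 => -> //.
  by apply: offu => //; rewrite lt_eqF.
near u0^'+ => u; have uu0 : u0 < u by near: u; exact: nbhs_right_gt.
have ug : `|u - u0| < g.
  by rewrite gtr0_norm ?subr_gt0 // ltrBlDr addrC; near: u; apply: nbhs_right_lt; lra.
have : off (E l u) -> ray_step u0 y (E l u) = (h * ray_step u0 y' (E l u))%g.
  by near: u; exact: cvg_within Hu.
rewrite /ray_step; have [_ _ uh] := hg u ug.
have [-> _ _] := Xc_sign lr uh; rewrite uu0 h1 mul1g; apply.
by apply: offu => //; rewrite gt_eqF.
Unshelve. all: by end_near. Qed.

(* By [step_pot_exists], the radii at which the given function is a potential form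
   an open and closed set, which contains the radius of the meridian. *)
Lemma step_pot u0 l lt : u0 \in ts -> 0 < l < rho -> crossing S G (E r) u0 lt ->
  pot (ray_step u0 (val lt)) (E l u0).
Proof.
move=> tu lr /(crossing_pot tu) p0; set y := val lt in p0 *.
have main a b : 0 < a -> a <= b -> b < rho ->
    pot (ray_step u0 y) (E a u0) <-> pot (ray_step u0 y) (E b u0).
  move=> a0 ab br; apply: (@cousin R a b (fun a b => pot (ray_step u0 y) (E a u0) <->
    pot (ray_step u0 y) (E b u0))) => //; first by move=> *; tauto.
  move=> t /andP[at_ tb].
  have trho : 0 < t < rho by rewrite (lt_le_trans a0 at_) (le_lt_trans tb br).
  have [y' py'] := step_pot_exists trho tu.
  have np := pot_near hausB cptB grG py'.
  have : \forall l \near t, pot (ray_step u0 y') (E l u0) by exact: (E_continuous_l trho np).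
  move=> /nbhs_ballP[d /= d0 hd]; exists d => // s u as_ su ub ts_ ut.
  have srho : 0 < s < rho by rewrite (lt_le_trans a0 as_) (le_lt_trans (le_trans su ub) br).
  have urho : 0 < u < rho.
    by rewrite (lt_le_trans a0 (le_trans as_ su)) (le_lt_trans ub br).
  have ps : pot (ray_step u0 y') (E s u0).
    by apply: hd; rewrite /ball /= ltr_distl; apply/andP; split; lra.
  have pu : pot (ray_step u0 y') (E u u0).
    by apply: hd; rewrite /ball /= ltr_distl; apply/andP; split; lra.
  split => p1; first by rewrite (step_unique srho tu p1 ps).
  by rewrite (step_unique urho tu p1 pu).
have [l0 lr'] := andP lr; have [r0 rr] := andP rrho.
by have [ll|ll] := leP l r; [apply/(main l r) | apply/(main r l) => //; exact: ltW].
Qed.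

(** The letters are read at radius [r] only; [step_pot] supplies the same jumps at every radius [l],
    so that [pre] models potentials on all the circles. *)
Lemma cone_step F l u0 : 0 < l < rho -> 0 <= u0 <= 1 -> pot F (E l u0) ->
  exists h, \forall u \near u0, u \notin ts -> F (E l u) = (h * pre u)%g.
Proof.
move=> lr u01 pF.
have [pre1 pre2] := prefix_val_near phi u0 srt crossw.
have [tu|ntu] := boolP (u0 \in ts).
  have [lt cr preu] := pre2 tu.
  have [h Hh] := pot_unique grG pF (step_pot tu lr cr).
  have Hu : \forall u \near u0, off (E l u) -> F (E l u) = (h * ray_step u0 (val lt) (E l u))%g.
    exact: (E_continuous lr Hh).
  have [g g0 hg] := gap (ts01 tu).
  exists (h * (pre u0)^-1)%g; near=> u => tsu.
  have ug : `|u - u0| < g.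
    by near: u; apply/nbhs_ballP; exists g => // u; rewrite /ball /= distrC.
  have [/andP[? ?] _ uh] := hg u ug.
  have ou : off (E l u) by rewrite /off E_ts ?ltW //; exact/negP.
  rewrite (near Hu u) // (near preu u) // !mulgA mulgVK /ray_step.
  by have [-> _ _] := Xc_sign lr uh.
have oE : off (E l u0) by rewrite /off E_ts //; exact/negP.
case: pF => [[_ [h Hh]]|[e [s [c1 [h [es Ee _ _]]]]]]; last first.
  by case: oE; rewrite Ee; exact: edge_support.
have Hu : \forall u \near u0, off (E l u) /\ (off (E l u) -> F (E l u) = h).
  exact: (E_continuous lr (nbhsI (off_near hausB cptB grG oE) Hh)).
exists (h * (pre u0)^-1)%g; near=> u => _.
rewrite (near (pre1 ntu) u) // mulgVK.
have [nsu] : off (E l u) /\ (off (E l u) -> F (E l u) = h) by near: u.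
by apply.
Unshelve. all: by end_near. Qed.

Lemma cone_path F l a b : 0 < l < rho -> 0 <= a -> a <= b -> b <= 1 ->
  (forall u, a <= u <= b -> pot F (E l u)) ->
  a \notin ts -> b \notin ts ->
  (F (E l a) * (pre a)^-1)%g = (F (E l b) * (pre b)^-1)%g.
Proof.
move=> lr a0 ab b1 pF nta ntb.
have dns (t : R) (U : set R) : nbhs t U -> exists2 q : R, U q & [set u | u \notin ts] q.
  move=> Ut; have [g g0 hg] := seq_gap ts t.
  near t^'+ => u; have ut : t < u by near: u; exact: nbhs_right_gt.
  exists u; first by near: u; exact: cvg_within Ut.
  apply/negP => /(hg u) e0; suff : u = t by move=> e1; rewrite e1 ltxx in ut.
  apply: e0; rewrite gtr0_norm ?subr_gt0 // ltrBlDr addrC.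
  by near: u; apply: nbhs_right_lt; lra.
have [||x Hx] := @path_const R _ H [set u | u \notin ts]
   (fun u => F (E l u) * (pre u)^-1)%g id a b ab (fun t _ => @cvg_id _ _).
- by move=> t U _; exact: dns.
- move=> t /andP[at_ tb]; have t01 : 0 <= t <= 1 by rewrite (le_trans a0) // (le_trans tb).
  have [h Hh] := cone_step lr t01 (pF t ltac:(by rewrite at_ tb)).
  by exists h; apply: filterS Hh => u hu /hu ->; rewrite mulgK.
by rewrite (nbhs_singleton (Hx a _)) ?lexx ?ab // (nbhs_singleton (Hx b _)) ?lexx ?ab.
Unshelve. all: by end_near. Qed.

End Cone.

Lemma cross_dense (R : realType) (d z : R * R) (W : set (R * R)) :
  0 < sqnorm d -> nbhs z W -> exists2 z', W z' & cross d z' != 0.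
Proof.
move=> d0 zW; have [cz|cz] := eqVneq (cross d z) 0; last first.
  by exists z => //; exact: nbhs_singleton.
have xc : (fun k : R => (z.1 - k * d.2, z.2 + k * d.1) : R * R) k @[k --> 0] --> z.
  rewrite [X in _ --> X]surjective_pairing -[X in (X, _)]subr0 -[X in (_, X)]addr0.
  rewrite -[X in (_ - X, _)](mul0r d.2) -[X in (_, _ + X)](mul0r d.1).
  apply: (@cvg_pair _ _ _ _ (nbhs _) (nbhs _)) => /=.
    apply: cvgB; first exact: cvg_cst.
    by apply: cvgM; [exact: cvg_id | exact: cvg_cst].
  apply: cvgD; first exact: cvg_cst.
  by apply: cvgM; [exact: cvg_id | exact: cvg_cst].
have Wk : \forall k \near (0 : R), W (z.1 - k * d.2, z.2 + k * d.1) := xc _ zW.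
near (0 : R)^'+ => k.
have k0 : 0 < k by near: k; exact: nbhs_right_gt.
exists (z.1 - k * d.2, z.2 + k * d.1); first by near: k; exact: cvg_within Wk.
have -> : cross d (z.1 - k * d.2, z.2 + k * d.1) = cross d z + k * sqnorm d.
  by rewrite /cross /sqnorm /=; ring.
by rewrite cz add0r gt_eqF // mulr_gt0.
Unshelve. all: by end_near. Qed.

(** Refers to no meridian and no word, only to the graph near [p], and so passes from one graph to
    another where they agree. *)
Definition locally_flat (R : realType) (B : topologicalType) (S : oriented_surface R B)
    (X : Type) (H : groupType) (phi : X -> H) (G : graph_data R B X) (p : B) : Prop :=
  exists F, \forall q \near p, q <> p -> pot S phi G F q.

(* The exceptional set N, of dense complement, is a ray from the vertex across
   which F jumps by y. *)
Definition pot_up_to (R : realType) (B : topologicalType) (S : oriented_surface R B)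
    (X : Type) (H : groupType) (phi : X -> H) (G : graph_data R B X) (y : H) (p : B) : Prop :=
  exists (F : B -> H) (N : set B), \forall q \near p, q <> p ->
    (forall U, nbhs q U -> exists2 x, U x & ~ support G x /\ ~ N x) /\
    exists2 F', pot S phi G F' q &
      \forall x \near q, ~ support G x -> ~ N x -> F x = F' x \/ F x = (y * F' x)%g.

Section ConeVertex.
Context (R : realType) (B : topologicalType) (S : oriented_surface R B).
Context (X : Type) (H : groupType) (phi : X -> H).
Hypothesis hausB : hausdorff_space B.
Hypothesis cptB : compact [set: B].
Context (G : graph_data R B X).
Hypothesis grG : is_graph S G.
Context (v : vertex G) (c : coord_chart R B) (rho r t0 : R).
Context (ts : seq R) (w : word X).

Let E l u := from_plane c (dilate l (circle (u + t0))).

Hypothesis dv : cdom c (position v).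
Hypothesis to0 : to_plane c (position v) = 0.
Hypothesis rrho : 0 < r < rho.
Hypothesis bc : box 0 rho `<=` cimg c.
Hypothesis bv : forall z (v' : vertex G), box 0 rho z ->
  from_plane c z = position v' -> v' = v.
Hypothesis rad : forall z s, box 0 rho z -> 0 < s <= 1 ->
  (support G (from_plane c z) <-> support G (from_plane c (dilate s z))).
Hypothesis srt : sorted (fun x y => x < y) ts.
Hypothesis ts01 : {in ts, forall t, 0 < t < 1}.
Hypothesis supE : forall t, 0 <= t <= 1 -> (support G (E r t) <-> t \in ts).
Hypothesis crossw : List.Forall2 (crossing S G (E r)) ts w.

Let off q := ~ support G q.
Local Notation pot := (pot S phi G).
Local Notation val := (letter_val phi).
Local Notation pre := (prefix_val phi ts w).


Let CP F l a b := @cone_path R B S X H phi hausB cptB G grG v c rho r t0 ts w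
  to0 rrho bc bv rad srt ts01 supE crossw F l a b.

Let ends_notin : (0 \notin ts) * (1 \notin ts).
Proof. by split; apply/negP => /ts01; rewrite ltxx ?andbF. Qed.

Let size_ts : size ts = size w.
Proof. by elim: crossw => //= ? ? ? ? _ _ ->. Qed.

Let pre0 : pre 0 = 1%g.
Proof. by apply: prefix_val_ge => t /ts01/andP[/ltW]. Qed.

Let pre1 : pre 1 = word_val phi w.
Proof. by apply: prefix_val_lt => // t /ts01/andP[]. Qed.

Let near_v (P : B -> Prop) :
  (\forall q \near position v, P q) <-> (\forall z \near (0 : R * R), P (from_plane c z)).
Proof. by rewrite -to0; exact: near_to. Qed.

(** A full turn on a small circle returns to the same point and to the same value of the potential,
    while [pre] goes from 1 to the value of the word. *)
Lemma locally_flat_word : locally_flat S phi G (position v) -> word_val phi w = 1%g.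
Proof.
move=> [F /near_v/near_prodR[d d0 hd]]; have [r0 rr] := andP rrho.
pose l := Num.min d rho / 2.
have m0 : 0 < Num.min d rho by rewrite lt_min d0 (lt_trans r0 rr).
have l0 : 0 < l by exact: divr_gt0.
have m1 : Num.min d rho <= d by rewrite ge_min lexx.
have m2 : Num.min d rho <= rho by rewrite ge_min lexx orbT.
have lr : 0 < l < rho by rewrite l0 /= /l; lra.
have ld : 0 < l < d by rewrite l0 /= /l; lra.
have pE u : pot F (E l u).
  have [b1 b2] := box_polar (u + t0) ld; apply: (hd _ b1 b2).
  exact: (E_not_vertex to0 bc bv lr).
have := @CP F l 0 1 lr (lexx 0) ler01 (lexx 1) (fun u _ => pE u) ends_notin.1 ends_notin.2.
rewrite pre0 pre1 /E (E1 c t0) => /mulgI/(congr1 (fun x => x^-1)%g).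
by rewrite !invgK.
Qed.

(** The slit is the ray through the starting point of the meridian, which avoids the graph. Hence a
    potential on the slit neighbourhood is constant on either side close to the slit, and following
    a circle from one side to the other compares the two constants. *)
Lemma word_pot_up_to : (forall h : H, (word_val phi w * h)%g = (h * word_val phi w)%g) ->
  pot_up_to S phi G (word_val phi w) (position v).
Proof.
move=> cen; have [r0 rr] := andP rrho; have rho0 : 0 < rho by exact: lt_trans rr.
pose d : R * R := circle (0 + t0).
have sd : sqnorm d = 1 by exact: sqnorm_circle.
have d0 : d != 0.
  apply/eqP => e0; move: sd; rewrite e0 /sqnorm /= !expr0n addr0 => /eqP.
  by rewrite eq_sym oner_eq0.
have [||F HF] := @slit_potential _ _ S _ _ phi hausB cptB G grG c v rho d rho0 d0 dv.
- by rewrite to0.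
- by rewrite to0.
rewrite to0 in HF.
(* The whole line is taken as exceptional set; it has dense complement, and near its other half [F]
   is already a potential. *)
exists F, [set q | cross d (to_plane c q) = 0].
have sN : \forall z \near (0 : R * R), sqnorm z < rho ^+ 2.
  apply: (cvgr_lt _ (@sqnorm_continuous R (0 : R * R))).
  by rewrite /sqnorm /= !expr0n addr0 exprn_gt0.
apply/near_v; have := box_nbhs (0 : R * R) rho0; apply: filterS2 sN => z zr bz zv.
have cz := bc bz; set p := from_plane c z in zv *.
split.
  move=> U pU; have [q [Uq dq] oq] := off_dense hausB grG
    (nbhsI (nbhs_interior pU) (near_cdom (from_plane_dom cz))).
  have N := nbhsI Uq (off_near hausB cptB grG oq).
  have cq := to_plane_img dq; rewrite -(to_planeK dq) in N.
  have N2 := nbhsI (near_cimg cq) (proj1 (near_from _ cq) N).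
  have [z' [cz' [Uz' oz']] crz'] := cross_dense (d := d) (ltac:(by rewrite sd)) N2.
  by exists (from_plane c z') => //; split => //=; rewrite from_planeK //; exact/eqP.
have [sz|nsz] := pselect (slit 0 d z); last first.
  by exists F; [exact: HF | near=> x => _ _; left].
have [cr dt] := sz; rewrite subr0 in cr dt.
pose l := d.1 * z.1 + d.2 * z.2.
have zl : z = dilate l d.
  rewrite [z]surjective_pairing /dilate /l; congr pair.
    transitivity (z.1 * sqnorm d + d.2 * cross d z); first by rewrite cr sd; ring.
    by rewrite /cross /sqnorm; ring.
  transitivity (z.2 * sqnorm d - d.1 * cross d z); first by rewrite cr sd; ring.
  by rewrite /cross /sqnorm; ring.
have l0 : 0 < l.
  rewrite lt_neqAle dt andbT; apply/eqP => l0; apply: zv; rewrite /p zl -l0.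
  by rewrite /dilate !mul0r -[RHS](to_planeK dv) to0.
have lr : 0 < l < rho.
  rewrite l0 /= -(ltr_pXn2r (n := 2)) ?nnegrE ?ltW //.
  by move: zr; rewrite {1}zl sqnorm_dilate sd mulr1.
have pE : p = E l 0 by rewrite /p zl.
have op : off p.
  rewrite pE /off (E_ts rrho rad supE lr) ?lexx ?ler01 //; exact/negP/ends_notin.1.
have bzn : \forall q \near z, box 0 rho q.
  by apply: open_nbhs_nbhs; split => //; exact: box_open.
have [e e0 he] := proj1 (near_prodR _ _) (nbhsI (near_cimg cz)
  (nbhsI (proj1 (near_from _ cz) (off_near hausB cptB grG op)) bzn)).
pose W : set (R * R) := box z e.
have hW z' : W z' -> cimg c z' /\ off (from_plane c z') /\ box 0 rho z'.
  by move=> [? ?]; exact: he.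
have WN : nbhs z W by exact: box_nbhs.
have crs z1 z2 (t : R) : cross d (seg z1 z2 t) = cross d z1 + t * (cross d z2 - cross d z1).
  by rewrite cross_seg; ring.
(* [W] is a box around a point of the slit that misses the graph; each of its two open halves is
   convex and misses the slit, so [F] is constant there. *)
have halfp : exists h, forall z', W z' -> 0 < cross d z' -> F (from_plane c z') = h.
  have [|nA] := pselect (exists2 z1, W z1 & 0 < cross d z1); last first.
    by exists 1%g => z' Wz' cz'; case: nA; exists z'.
  move=> [z1 Wz1 cz1].
  have [||||x Hx] := @star_const R H setT [set z' | W z' /\ 0 < cross d z'] z1 (F \o from_plane c).
  - by [].
  - by move=> q t [Wq cq] t01; split; [exact: box_seg | rewrite /= crs conv_gt].
  - by move=> z' U _ Uz; exists z' => //; exact: nbhs_singleton.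
  - move=> z' [Wz' cz']; have [cimz' [oz' bz']] := hW z' Wz'.
    have : pot F (from_plane c z').
      by apply: HF; split => // -[]; rewrite subr0 => e1; rewrite e1 ltxx in cz'.
    case=> [[_ [h Hh]]|[e1 [s [c1 [h [es pe _ _]]]]]]; last first.
      by case: oz'; rewrite pe; exact: edge_support.
    exists h; have := proj1 (near_from _ cimz') (nbhsI (off_near hausB cptB grG oz') Hh).
    by apply: filterS => q [n1 h1] _; exact: h1.
  by exists x => z' Wz' cz'; apply: (nbhs_singleton (Hx z' (conj Wz' cz'))).
have halfn : exists h, forall z', W z' -> cross d z' < 0 -> F (from_plane c z') = h.
  have [|nA] := pselect (exists2 z1, W z1 & cross d z1 < 0); last first.
    by exists 1%g => z' Wz' cz'; case: nA; exists z'.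
  move=> [z1 Wz1 cz1].
  have [||||x Hx] := @star_const R H setT [set z' | W z' /\ cross d z' < 0] z1 (F \o from_plane c).
  - by [].
  - by move=> q t [Wq cq] t01; split; [exact: box_seg | rewrite /= crs conv_lt].
  - by move=> z' U _ Uz; exists z' => //; exact: nbhs_singleton.
  - move=> z' [Wz' cz']; have [cimz' [oz' bz']] := hW z' Wz'.
    have : pot F (from_plane c z').
      by apply: HF; split => // -[]; rewrite subr0 => e1; rewrite e1 ltxx in cz'.
    case=> [[_ [h Hh]]|[e1 [s [c1 [h [es pe _ _]]]]]]; last first.
      by case: oz'; rewrite pe; exact: edge_support.
    exists h; have := proj1 (near_from _ cimz') (nbhsI (off_near hausB cptB grG oz') Hh).
    by apply: filterS => q [n1 h1] _; exact: h1.
  by exists x => z' Wz' cz'; apply: (nbhs_singleton (Hx z' (conj Wz' cz'))).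
have [hp Hp] := halfp; have [hn Hn] := halfn.
have crE u : cross d (dilate l (circle (u + t0))) = l * sin (2 * pi * u).
  by rewrite /d cross_circle; have -> : u + t0 - (0 + t0) = u by ring.
have potE u : 0 < u < 1 -> pot F (E l u).
  move=> /andP[u0 u1]; apply: HF; split; first exact: box_polar.
  case=> s0 c0; rewrite subr0 crE in s0; rewrite subr0 in c0.
  move/eqP: s0; rewrite mulf_eq0 gt_eqF //= => /eqP s0.
  have [uh|uh|uh] := ltgtP u (1 / 2).
  - by have := @sin_turn_gt0 R u; rewrite u0 uh s0 ltxx => /(_ isT).
  - have := @sin_turn_lt0 R (u - 1) ltac:(apply/andP; split; lra).
    rewrite -sinD2pi; have -> : 2 * pi * (u - 1) + pi *+ 2 = 2 * pi * u :> R by ring.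
    by rewrite s0 ltxx.
  - have cE : d.1 * (dilate l (circle (u + t0))).1 + d.2 * (dilate l (circle (u + t0))).2 =
        l * cos (2 * pi * u).
      have -> : 2 * pi * u = 2 * pi * (u + t0) - 2 * pi * (0 + t0) by ring.
      by rewrite cosB /d /circle /dilate /=; ring.
    have piE : 2 * pi * (1 / 2) = pi :> R by field.
    move: c0; rewrite cE uh piE cospi mulrN1 oppr_ge0 => l0'.
    by have := lt_le_trans l0 l0'; rewrite ltxx.
have near0 : \forall u \near (0 : R), W (dilate l (circle (u + t0))).
  have c0 : (fun u : R => dilate l (circle (u + t0))) u @[u --> 0] --> z.
    rewrite zl; apply: (@continuous_comp _ _ _ (fun u => circle (u + t0)) (dilate l)); last exact: dilate_continuous.
    apply: (@continuous_comp _ _ _ (fun u => u + t0) circle); last exact: circle_continuous.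
    by apply: cvgD; [exact: cvg_id | exact: cvg_cst].
  exact: c0 _ WN.
have prn0 := (prefix_val_near phi 0 srt crossw).1 ends_notin.1.
have prn1 := (prefix_val_near phi 1 srt crossw).1 ends_notin.2.
have [k k0 hk] : exists2 k : R, 0 < k & forall u, `|u| < k ->
    [/\ W (dilate l (circle (u + t0))), pre u = pre 0 & pre (1 + u) = pre 1].
  have prn1' : \forall u \near (0 : R), pre (1 + u) = pre 1.
    have c1 : (fun u : R => 1 + u) u @[u --> 0] --> (1 : R).
      by rewrite -[X in _ --> X]addr0; apply: cvgD; [exact: cvg_cst | exact: cvg_id].
    exact: c1 _ prn1.
  have /nbhs_ballP[k /= k0 hk] := nbhsI near0 (nbhsI prn0 prn1').
  exists k => // u uk; have [] := hk u; first by rewrite /ball /= sub0r normrN.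
  by move=> ? [].
(* An angle so small that the points of angles [a] and [1 - a] lie in [W], on the two sides of the
   slit, and that no letter is read before [a] or after [1 - a]. *)
pose a := Num.min k (1 / 2) / 2.
have mm : 0 < Num.min k (1 / 2) by rewrite lt_min k0 /=; lra.
have mk : Num.min k (1 / 2) <= k by rewrite ge_min lexx.
have mh : Num.min k (1 / 2) <= 1 / 2 by rewrite ge_min lexx orbT.
have a0 : 0 < a by rewrite /a; lra.
have ak : a < k by rewrite /a; lra.
have ah : a < 1 / 2 by rewrite /a; lra.
have [|Wa prea _] := hk a; first by rewrite gtr0_norm.
have [|Wb _ preb] := hk (- a); first by rewrite normrN gtr0_norm.
have Eb : E l (1 - a) = E l (- a).
  have e1 : 1 - a + t0 = - a + t0 + 1 by ring.
  by rewrite /E e1 circleD1.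
have offts u : 0 <= u <= 1 -> off (E l u) -> u \notin ts.
  by move=> u01 ou; apply/negP => /(E_ts rrho rad supE lr u01).
have key : (F (E l a) * (pre a)^-1)%g = (F (E l (1 - a)) * (pre (1 - a))^-1)%g.
  apply: CP => //; [exact: ltW | lra | lra | | |].
  - by move=> u uab; apply: potE; case/andP: uab => ? ?; apply/andP; split; lra.
  - by apply: offts (hW _ Wa).2.1; apply/andP; split; lra.
  - by apply: offts; [apply/andP; split; lra | rewrite Eb; exact: (hW _ Wb).2.1].
move: key; rewrite Eb prea preb pre0 pre1 invg1 mulg1 /E Hp //; last first.
  by rewrite crE mulr_gt0 //; apply: sin_turn_gt0; rewrite a0 ah.
rewrite Hn //; last first.
  by rewrite crE pmulr_rlt0 //; apply: sin_turn_lt0; apply/andP; split; lra.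
(* By [hpn], [hp] is [hn] times the inverse of the value of the word; centrality moves this factor
   to the left, where [pot_up_to] wants it. *)
move=> hpn; exists (fun=> hp).
  by left; split => //; exists hp; near=> q.
apply/(near_from _ cz); move: (near_cimg cz); apply: filterS2 WN => q Wq cq _ /= nq.
rewrite from_planeK // in nq.
have [cq0|cq0|//] := ltgtP (cross d q) 0; last by left; exact: Hp.
by right; rewrite Hn // hpn cen mulgVK.
Unshelve. all: by end_near. Qed.

End ConeVertex.

(** * Potentials around a vertex and across its cut *)

Section Vertices.
Context (R : realType) (B : topologicalType) (S : oriented_surface R B).
Context (X : Type) (H : groupType) (phi : X -> H).
Hypothesis hausB : hausdorff_space B.
Hypothesis cptB : compact [set: B].
Context (G : graph_data R B X).
Hypothesis grG : is_graph S G.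

Let off q := ~ support G q.
Local Notation pot := (pot S phi G).

Lemma vertex_word_val (v : vertex G) w : vertex_word S v w ->
  (locally_flat S phi G (position v) -> word_val phi w = 1%g) /\
  ((forall h : H, (word_val phi w * h)%g = (h * word_val phi w)%g) ->
    pot_up_to S phi G (word_val phi w) (position v)).
Proof.
move=> [m [c [rho [r [t0 [[Sc dv to0 rrho bc] [bv rad em]]]]]]].
move=> [_ [ts [srt ts01 supE crossw]]].
have bb : box 0 rho `<=` ball (0 : R * R) rho.
  by move=> z [z1 z2]; split; rewrite /ball /= distrC.
rewrite em in supE crossw.
have bc' : box 0 rho `<=` cimg c by move=> z /bb/bc.
have bv' z (v' : vertex G) : box 0 rho z -> from_plane c z = position v' -> v' = v.
  by move=> /bb; exact: bv.
have rad' z s : box 0 rho z -> 0 < s <= 1 ->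
  (support G (from_plane c z) <-> support G (from_plane c (dilate s z))).
  by move=> /bb; exact: rad.
split; first exact: (locally_flat_word hausB cptB grG dv to0 rrho bc' bv' rad' srt ts01 supE crossw).
exact: (word_pot_up_to hausB cptB grG dv to0 rrho bc' bv' rad' srt ts01 supE crossw).
Qed.

(** With the value 1, the jump across the slit in [word_pot_up_to] is trivial, and [pot_fill]
    removes the slit. *)
Lemma locally_flat_of_word (v : vertex G) w : vertex_word S v w -> word_val phi w = 1%g ->
  locally_flat S phi G (position v).
Proof.
move=> vw w1; have [_ pu] := vertex_word_val vw.
have [|F [N FN]] := pu; first by move=> h; rewrite w1 mulg1 mul1g.
have := nbhs_interior FN; set A := (X in nbhs _ X) => FN'.
have Ai : A `<=` _ := @interior_subset _ _.
have [|||F' HF'] := @pot_fill _ _ S _ _ phi hausB cptB G grG (A `&` ~` [set position v]) N F.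
- apply: openI; first exact: open_interior.
  by apply: closed_openC; apply: accessible_closed_set1; exact: hausdorff_accessible.
- move=> p U [/Ai Ap pv] pU.
  by have [h _] := Ap pv; exact: h.
- move=> p [/Ai Ap pv]; have [_ [F' pF' FF']] := Ap pv; exists F' => //.
  apply: filterS FF' => x hx ox nx; case: (hx ox nx) => // ->.
  by rewrite w1 mul1g.
exists F'; near=> q => qv; apply: HF'; split => //.
by near: q.
Unshelve. all: by end_near. Qed.

Context (z : H).
Hypothesis zC : forall h : H, (z * h)%g = (h * z)%g.
Hypothesis zz : (z * z)%g = 1%g.

(** The coset modulo the subgroup generated by [z]. For a function known only up to [z], the ratio
    to a potential is locally constant as such a coset. *)
Definition coset_z (x : H) : set H := [set y | y = x \/ y = (z * x)%g].

Lemma coset_zM x : coset_z (z * x)%g = coset_z x.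
Proof.
have zzx : (z * (z * x))%g = x by rewrite mulgA zz mul1g.
by apply/seteqP; split => y [->|->]; rewrite /coset_z /= ?zzx; [right|left|right|left].
Qed.

Lemma coset_const c (O : set (R * R)) (o1 : R * R) (F P : B -> H) (N : set B) :
  O `<=` cimg c -> O o1 ->
  (forall q (t : R), O q -> 0 <= t <= 1 -> O (seg o1 q t)) ->
  (forall x, O x -> pot F (from_plane c x)) ->
  (forall x, O x ->
    (forall U, nbhs (from_plane c x) U -> exists2 y, U y & ~ support G y /\ ~ N y) /\
    exists2 F', pot F' (from_plane c x) &
      \forall y \near from_plane c x, ~ support G y -> ~ N y -> P y = F' y \/ P y = (z * F' y)%g) ->
  exists K, forall x, O x -> \forall y \near from_plane c x,
    ~ support G y /\ ~ N y -> coset_z (P y * (F y)^-1)%g = K.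
Proof.
move=> Oc Oo1 Os HF HP.
have [||K HK] := @star_const R (set H) [set x | ~ support G (from_plane c x) /\ ~ N (from_plane c x)]
  O o1 (fun x => coset_z (P (from_plane c x) * (F (from_plane c x))^-1)%g) Oo1 Os.
- move=> x U Ox Ux; have [dns _] := HP x Ox; have cx := Oc x Ox.
  have NU : \forall q \near from_plane c x, cdom c q /\ U (to_plane c q).
    apply/(near_from _ cx); have := near_cimg cx; apply: filterS2 Ux => y Uy cy.
    by rewrite from_planeK //; split => //; exact: from_plane_dom.
  have [y [dy Uy] oy] := dns _ NU.
  by exists (to_plane c y) => //=; rewrite to_planeK.
- move=> x Ox; have [_ [F' pF' FF']] := HP x Ox.
  have [h Hh] := pot_unique grG pF' (HF x Ox).
  exists (coset_z h); apply: (proj1 (near_from (fun y => ~ support G y /\ ~ N y ->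
    coset_z (P y * (F y)^-1)%g = coset_z h) (Oc x Ox))).
  apply: filterS2 FF' Hh => y h1 h2 [oy ny].
  have [->|->] := h1 oy ny; rewrite h2 // ?mulgA mulgK //.
  by rewrite coset_zM.
by exists K => x Ox; apply/(near_from _ (Oc x Ox)); exact: HK.
Qed.

Definition on_cut (a p : R * R) : bool := (p.1 == a.1) && (a.2 < p.2).

(** [p] is the centre of the neighbourhood and [q] the variable. Near a point [p] of the cut,
    multiplying the part to the left of the cut by [z] turns a function with the prescribed jump
    into a potential. *)
Definition cut_sign (a p q : R * R) : H := if on_cut a p && (q.1 < a.1) then z else 1%g.

(* Away from the vertical ray above the vertex, F is a potential; let m be its
   jump across the ray. Comparing with a potential up to z shows m = 1 or m = z,
   and m = 1 would make F a potential around the vertex. *)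
Lemma cut_vertex c (v : vertex G) (e : R) : 0 < e ->
  cdom c (position v) -> let a := to_plane c (position v) in
  box a e `<=` cimg c ->
  (forall x (v' : vertex G), box a e x -> from_plane c x = position v' -> v' = v) ->
  pot_up_to S phi G z (position v) -> ~ locally_flat S phi G (position v) ->
  exists F, \forall p \near a, p <> a ->
    pot (fun q => cut_sign a p (to_plane c q) * F q)%g (from_plane c p).
Proof.
move=> e0 dv a bc bv [P [N PN]] nflat.
have ca : cimg c a by exact: to_plane_img.
have /near_prodR[e1 e10 he1] := proj1 (near_to _ dv) PN.
pose k := Num.min e e1.
have k0 : 0 < k by rewrite lt_min e0.
have bk x : box a k x -> box a e x /\ box a e1 x.
  by rewrite /box /= !lt_min => -[/andP[-> ->] /andP[-> ->]].
have bc' : box a k `<=` cimg c by move=> x /bk[/bc].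
have bv' x (v' : vertex G) : box a k x -> from_plane c x = position v' -> v' = v.
  by move=> /bk[/bv h _]; exact: h.
have fa x : box a k x -> from_plane c x = position v -> x = a.
  by move=> bx e2; rewrite /a -e2 from_planeK //; exact: bc'.
have PNk x : box a k x -> x <> a ->
    (forall U, nbhs (from_plane c x) U -> exists2 y, U y & ~ support G y /\ ~ N y) /\
    exists2 F', pot F' (from_plane c x) &
      \forall y \near from_plane c x, ~ support G y -> ~ N y -> P y = F' y \/ P y = (z * F' y)%g.
  by move=> bx xa; have [_ [b1 b2]] := bk x bx; apply: (he1 x b1 b2) => /(fa x bx).
pose d : R * R := (0, 1).
have d0 : d != 0 by apply/eqP => -[/eqP]; rewrite oner_eq0.
have slitE x : slit a d x <-> x.1 = a.1 /\ a.2 <= x.2.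
  change (0 * (x.2 - a.2) - 1 * (x.1 - a.1) = 0 /\ 0 <= 0 * (x.1 - a.1) + 1 * (x.2 - a.2)
    <-> x.1 = a.1 /\ a.2 <= x.2).
  rewrite !mul0r !mul1r !add0r subr_ge0; split=> -[h1 h2]; split => //.
    by apply/eqP; rewrite -subr_eq0 -oppr_eq0 h1.
  by rewrite h1 subrr oppr0.
pose O1 := box a k `\` slit a d.
have [Fv HFv] := slit_potential phi hausB cptB grG k0 d0 dv bc' bv'.
have [b1 Ob1 Os1] := slit_star a k0 d0.
have reg (Q : set (R * R)) (y : R * R) :
    (forall p q (t : R), Q p -> Q q -> 0 <= t <= 1 -> Q (seg p q t)) ->
    open Q -> box a k y -> Q y ->
    [/\ open (box a k `&` Q), (box a k `&` Q) `<=` cimg c, (box a k `&` Q) y &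
     forall q (t : R), (box a k `&` Q) q -> 0 <= t <= 1 -> (box a k `&` Q) (seg y q t)].
  move=> cQ oQ by_ Qy; split => //.
  - by apply: openI => //; exact: box_open.
  - by move=> x [/bc'].
  - by move=> q t [bq Qq] t01; split; [exact: box_seg | exact: cQ].
have o1l : open [set x : R * R | x.1 < a.1].
  by apply: (@open_comp _ _ fst [set x | x < a.1]); [move=> x _; exact: cvg_fst | exact: open_lt].
have o1r : open [set x : R * R | a.1 < x.1].
  by apply: (@open_comp _ _ fst [set x | a.1 < x]); [move=> x _; exact: cvg_fst | exact: open_gt].
have o2u : open [set x : R * R | a.2 < x.2].
  by apply: (@open_comp _ _ snd [set x | a.2 < x]); [move=> x _; exact: cvg_snd | exact: open_gt].
have kh : `|k / 2| < k by rewrite gtr0_norm; lra.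
have bxy (x y : R) : `|x| < k -> `|y| < k -> box a k (a.1 + x, a.2 + y).
  by move=> hx hy; split; rewrite /= addrC addKr.
have kN : `|- (k / 2)| < k by rewrite normrN.
have k00 : `|0 : R| < k by rewrite normr0.
(* The upper half T of the box contains the cut but not the vertex; L and R are its parts to the
   left and to the right of the cut, where [Fv] is a potential too. The potential [FT] on T is
   normalized to equal [Fv] on L, and [m] is their ratio on R. *)
have [TO Tc T1 Ts] := @reg [set x | a.2 < x.2] (a.1 + 0, a.2 + k / 2)
  (fun p q t h1 h2 h3 => conv_gt h1 h2 h3) o2u (bxy _ _ k00 kh) ltac:(rewrite /=; lra).
have [LO Lc L1 Ls] := @reg ([set x | x.1 < a.1] `&` [set x | a.2 < x.2]) (a.1 - k / 2, a.2 + k / 2)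
  (fun p q t h1 h2 h3 => conj (conv_lt h1.1 h2.1 h3) (conv_gt h1.2 h2.2 h3))
  (openI o1l o2u) (bxy _ _ kN kh) ltac:(split; rewrite /=; lra).
have [RO Rc R1 Rs] := @reg ([set x | a.1 < x.1] `&` [set x | a.2 < x.2]) (a.1 + k / 2, a.2 + k / 2)
  (fun p q t h1 h2 h3 => conj (conv_gt h1.1 h2.1 h3) (conv_gt h1.2 h2.2 h3))
  (openI o1r o2u) (bxy _ _ kh kh) ltac:(split; rewrite /=; lra).
have Tna x : (box a k `&` [set x | a.2 < x.2]) x -> x <> a.
  by move=> [_ /= h] e2; rewrite e2 ltxx in h.
have [|FT0 HFT0] := @star_potential _ _ S _ _ phi hausB cptB G grG c _ _ TO Tc T1 Ts.
  move=> x v' Tx xv; have vv := bv' x v' Tx.1 xv; apply: (Tna x Tx).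
  by apply: fa; [exact: Tx.1 | rewrite -vv].
have LT x : (box a k `&` ([set x | x.1 < a.1] `&` [set x | a.2 < x.2])) x ->
  (box a k `&` [set x | a.2 < x.2]) x /\ O1 x.
  by move=> [bx [/= h1 h2]]; split => //; split => // /slitE[h _]; rewrite h ltxx in h1.
have RT x : (box a k `&` ([set x | a.1 < x.1] `&` [set x | a.2 < x.2])) x ->
  (box a k `&` [set x | a.2 < x.2]) x /\ O1 x.
  by move=> [bx [/= h1 h2]]; split => //; split => // /slitE[h _]; rewrite h ltxx in h1.
have [h1 Hh1] := star_potential_unique hausB grG Lc L1 Ls
  (fun x Lx => HFv x (LT x Lx).2) (fun x Lx => HFT0 x (LT x Lx).1).
pose FT q := (h1 * FT0 q)%g.
have HFT x : (box a k `&` [set x | a.2 < x.2]) x -> pot FT (from_plane c x).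
  by move=> Tx; apply: pot_mull; exact: HFT0.
have [m Hm] := star_potential_unique hausB grG Rc R1 Rs
  (fun x Rx => HFv x (RT x Rx).2) (fun x Rx => HFT x (RT x Rx).1).
have O1c : O1 `<=` cimg c by move=> x [/bc'].
have O1na x : O1 x -> x <> a by move=> [_ sx] e2; apply: sx; apply/slitE; rewrite e2.
have [K1 HK1] := coset_const O1c Ob1 Os1 HFv (fun x (Ox : O1 x) => PNk x Ox.1 (O1na x Ox)).
have [K2 HK2] := coset_const Tc T1 Ts HFT (fun x (Tx : (box a k `&` [set x | a.2 < x.2]) x) => PNk x Tx.1 (Tna x Tx)).
(* The ratios of [P] to [Fv] and to [FT] are constant modulo [z], and these constants agree on L
   where [Fv = FT]. Reading them on R, where [Fv = m * FT], puts [m] in the subgroup generated by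
   [z]. *)
have mz : m = 1%g \/ m = z.
  have eK : K1 = K2.
    have [Lt LO1] := LT _ L1.
    have [dns _] := PNk _ Lt.1 (Tna _ Lt).
    have [y [[y1 y2] y3] oy] := dns _ (nbhsI (nbhsI (HK1 _ LO1) (HK2 _ Lt)) (Hh1 _ L1)).
    by rewrite -y1 // -y2 // y3 //; exact: oy.1.
  have [Rt RO1] := RT _ R1.
  have [dns _] := PNk _ Rt.1 (Tna _ Rt).
  have [y [[y1 y2] y3] oy] := dns _ (nbhsI (nbhsI (HK1 _ RO1) (HK2 _ Rt)) (Hm _ R1)).
  have := y1 oy; rewrite eK -(y2 oy) y3; last exact: oy.1.
  rewrite invgM mulgA => e3.
  have : coset_z (P y * (FT y)^-1 * m^-1)%g (P y * (FT y)^-1 * m^-1)%g by left.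
  rewrite e3 => -[].
    rewrite -[RHS]mulg1 => /mulgI/(congr1 (fun x => x^-1)%g).
    by rewrite invgK invg1 => ->; left.
  rewrite zC => /mulgI/(congr1 (fun x => x^-1)%g); rewrite invgK => ->; right.
  by apply: (mulgI z); rewrite mulgV zz.
(* On the cut itself the value is the one continued from the right, since [cut_sign] corrects only
   the left side. *)
pose F q := if on_cut a (to_plane c q) then (m * FT q)%g else Fv q.
have Fslit x : box a k x -> on_cut a x ->
    pot (fun q => (if (to_plane c q).1 < a.1 then m else 1) * F q)%g (from_plane c x).
  move=> bx /andP[/eqP x1 x2]; have Tx : (box a k `&` [set x | a.2 < x.2]) x by [].
  apply: (pot_congr (F := fun q => m * FT q)%g); last by apply: pot_mull; exact: HFT.
  apply/(near_from _ (bc' _ bx)).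
  have nT : \forall y \near x, (box a k `&` [set x | a.2 < x.2]) y by apply: open_nbhs_nbhs.
  apply: filterS nT => y [by_ y2] oy; have cy := bc' _ by_.
  rewrite /F /on_cut from_planeK // y2 andbT.
  have [yl|yr|ye] := ltgtP y.1 a.1; last by rewrite mul1g.
    by rewrite (nbhs_singleton (Hh1 y (conj by_ (conj yl y2)))).
  by rewrite mul1g (nbhs_singleton (Hm y (conj by_ (conj yr y2)))).
have Fout x : box a k x -> x <> a -> ~~ on_cut a x -> pot F (from_plane c x).
  move=> bx xa nx; have Ox : O1 x.
    split => // /slitE[x1]; rewrite le_eqVlt => /predU1P[x2|x2].
      by apply: xa; rewrite [x]surjective_pairing [a]surjective_pairing x1 x2.
    by move: nx; rewrite /on_cut x1 eqxx x2.
  apply: (pot_congr (F := Fv)); last exact: HFv.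
  apply/(near_from _ (bc' _ bx)).
  have nO : \forall y \near x, O1 y by apply: open_nbhs_nbhs; split => //; exact: slit_open.
  apply: filterS nO => y [by_ sy] oy; rewrite /F from_planeK; last exact: bc'.
  rewrite ifN //; apply/negP => /andP[/eqP y1 y2]; apply: sy; apply/slitE.
  by split => //; exact: ltW.
have em : m = z.
  case: mz => // m1; exfalso; apply: nflat; exists F.
  apply/(near_to _ dv); have := box_nbhs a k0; apply: filterS => x bx xv.
  have xa : x <> a by move=> e2; apply: xv; rewrite e2 to_planeK.
  have [cx|ncx] := boolP (on_cut a x); last exact: Fout.
  apply: (pot_congr _ (Fslit x bx cx)); near=> q => _.
  by rewrite m1; case: ifP; rewrite mul1g.
exists F; have := box_nbhs a k0; apply: filterS => x bx xa.
rewrite /cut_sign; have [cx|ncx] := boolP (on_cut a x).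
  by rewrite -em; exact: Fslit.
apply: (pot_congr _ (Fout x bx xa ncx)); near=> q => _.
by rewrite mul1g.
Unshelve. all: by end_near. Qed.

End Vertices.

(** * Potentials with cuts *)

(** [cut_sign] as an exponent of [z], so that the corrections for several cuts add up, even when
    their cuts overlap. *)
Definition cut_bit {R : realType} (a p x : R * R) : nat := on_cut a p && (x.1 < a.1).

Lemma fst_lt_near (R : realType) (p : R * R) (x : R) : p.1 < x -> \forall q \near p, q.1 < x.
Proof. by move=> h; exact: (@cvgr_lt R _ (nbhs p) _ fst p.1 cvg_fst x h). Qed.

Lemma fst_gt_near (R : realType) (p : R * R) (x : R) : x < p.1 -> \forall q \near p, x < q.1.
Proof. by move=> h; exact: (@cvgr_gt R _ (nbhs p) _ fst p.1 cvg_fst x h). Qed.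

Lemma snd_lt_near (R : realType) (p : R * R) (x : R) : p.2 < x -> \forall q \near p, q.2 < x.
Proof. by move=> h; exact: (@cvgr_lt R _ (nbhs p) _ snd p.2 cvg_snd x h). Qed.

Lemma snd_gt_near (R : realType) (p : R * R) (x : R) : x < p.2 -> \forall q \near p, x < q.2.
Proof. by move=> h; exact: (@cvgr_gt R _ (nbhs p) _ snd p.2 cvg_snd x h). Qed.

Lemma left_of_near (R : realType) (x : R) (q : R * R) : q.1 != x ->
  \forall y \near q, (y.1 < x) = (q.1 < x).
Proof.
rewrite neq_lt => /orP[h|h].
  by apply: filterS (fst_lt_near h) => y ->; rewrite h.
by apply: filterS (fst_gt_near h) => y yx; rewrite !ltNge !ltW.
Qed.

(** If [q] is on the cut along with [p], the two corrections coincide; if [q] is beside it, the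
    correction for [p] is constant near [q]. Away from the end of the cut, a point [p] off it has
    only such points around it. At the end [a] itself this fails, and that vertex is treated
    separately by [own]. *)
Lemma cut_bit_near (R : realType) (a p : R * R) : a <> p ->
  \forall q \near p, exists b : nat, \forall x \near q,
    cut_bit a p x = (b + cut_bit a q x)%N.
Proof.
move=> ap; rewrite /cut_bit; have [cp|ncp] := boolP (on_cut a p).
  have /andP[/eqP p1 p2] := cp.
  apply: filterS (snd_gt_near p2) => q q2; have [q1|q1] := eqVneq q.1 a.1.
    by exists 0%N; near=> x; rewrite /on_cut q1 eqxx q2.
  exists (nat_of_bool (q.1 < a.1)%R); apply: filterS (left_of_near q1) => x ->.
  by rewrite /on_cut (negbTE q1) addn0.
have nc : \forall q \near p, ~~ on_cut a q.
  have [p1|p1] := eqVneq p.1 a.1; last first.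
    move: (p1); rewrite neq_lt => /orP[h|h].
      by apply: filterS (fst_lt_near h) => q q1; rewrite /on_cut lt_eqF.
    by apply: filterS (fst_gt_near h) => q q1; rewrite /on_cut gt_eqF.
  have p2 : p.2 < a.2.
    rewrite lt_neqAle; apply/andP; split.
      apply/eqP => p2; apply: ap; rewrite [a]surjective_pairing [p]surjective_pairing.
      by rewrite p1 p2.
    by move: ncp; rewrite /on_cut p1 eqxx /= -leNgt.
  by apply: filterS (snd_lt_near p2) => q q2; rewrite /on_cut ltNge (ltW q2) andbF.
by apply: filterS nc => q /negbTE nq; exists 0%N; near=> x; rewrite nq.
Unshelve. all: by end_near. Qed.

Lemma near_sum (I : finType) (T : topologicalType) (q : T) (P : pred I)
    (f g : I -> T -> nat) :
  (forall v, P v -> exists b : nat, \forall x \near q, f v x = (b + g v x)%N) ->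
  exists K : nat, \forall x \near q,
    (\sum_(v | P v) f v x = K + \sum_(v | P v) g v x)%N.
Proof.
move=> h; suff /choice[b hb] : forall v, exists b : nat, P v ->
    \forall x \near q, f v x = (b + g v x)%N.
  exists (\sum_(v | P v) b v)%N.
  have hb' : \forall x \near q, forall v, P v -> f v x = (b v + g v x)%N.
    apply: (@filter_forall _ I (fun v x => P v -> f v x = (b v + g v x)%N)) => v.
    have [Pv|nPv] := boolP (P v); last by near=> x.
    by apply: filterS (hb v Pv) => x.
  apply: filterS hb' => x hx.
  by rewrite -big_split; apply: eq_bigr => v; exact: hx.
by move=> v; have [/h[b hb]|nPv] := boolP (P v); [exists b | exists 0%N].
Unshelve. all: by end_near. Qed.

Section CutPotential.
Context (R : realType) (B : topologicalType) (S : oriented_surface R B).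
Context (X : Type) (H : groupType) (phi : X -> H).
Hypothesis hausB : hausdorff_space B.
Hypothesis cptB : compact [set: B].
Context (G : graph_data R B X).
Hypothesis grG : is_graph S G.
Context (z : H).
Hypothesis zC : forall h : H, (z * h)%g = (h * z)%g.
Hypothesis zz : (z * z)%g = 1%g.

Local Notation pot := (pot S phi G).

Lemma zXC n (h : H) : (z ^+ n * h)%g = (h * z ^+ n)%g.
Proof.
elim: n => [|n IH]; first by rewrite expg0 mulg1 mul1g.
by rewrite expgS -mulgA IH !mulgA zC.
Qed.

Lemma zX2 n : (z ^+ n * z ^+ n)%g = 1%g.
Proof.
elim: n => [|n IH]; first by rewrite expg0 mulg1.
by rewrite expgS -mulgA [(z ^+ n * (z * _))%g]mulgA zXC -mulgA IH mulg1.
Qed.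

Context (c : coord_chart R B) (rho : R) (V : pred (vertex G)).
Let O := [set p : R * R | sqnorm p < rho ^+ 2].
Let a (v : vertex G) := to_plane c (position v).
Hypothesis rho0 : 0 < rho.
Hypothesis Oc : O `<=` cimg c.
Hypothesis V_dom : forall v, V v -> cdom c (position v) /\ O (a v).
Hypothesis V_pot : forall v, V v ->
  pot_up_to S phi G z (position v) /\ ~ locally_flat S phi G (position v).
Hypothesis nV_flat : forall v, ~~ V v -> cdom c (position v) -> O (a v) ->
  locally_flat S phi G (position v).

Definition cut_count (p x : R * R) : nat := \sum_(v | V v) cut_bit (a v) p x.

Let O_open : open O.
Proof.
by apply: (@open_comp _ _ sqnorm [set x | x < rho ^+ 2]); [move=> p _; exact: sqnorm_continuous | exact: open_lt].
Qed.

(** The correction near [q] for the cut issuing from [p] itself. The cut excludes its end, so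
    [cut_count p] does not see it, although it passes through points arbitrarily close to [p]. *)
Let own (p q x : R * R) : nat := \sum_(v | V v && (a v == p)) cut_bit (a v) q x.

Let vertex_model (v : vertex G) : cdom c (position v) -> O (a v) -> exists F : B -> H,
  \forall q \near a v, q <> a v ->
    pot (fun y => z ^+ own (a v) q (to_plane c y) * F y)%g (from_plane c q).
Proof.
move=> dv Ov; have ainj v' : V v' -> a v' = a v -> v' = v.
  move=> /V_dom[dv' _] e; apply: (position_inj grG).
  by rewrite -(to_planeK dv') -(to_planeK dv); congr from_plane.
have [Vv|nVv] := boolP (V v); last first.
  have [F FN] := nV_flat nVv dv Ov; exists F.
  have := nbhsI (open_nbhs_nbhs (conj O_open Ov)) (proj1 (near_to _ dv) FN).
  apply: filterS => q [Oq pq] qa.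
  have qv : from_plane c q <> position v.
    by move=> e; apply: qa; rewrite /a -e from_planeK //; exact: Oc.
  apply: (pot_congr _ (pq qv)); near=> y => _.
  rewrite /own big_pred0 ?expg0 ?mul1g // => v'.
  by apply/negP => /andP[Vv' /eqP /(ainj _ Vv') e]; rewrite e (negbTE nVv) in Vv'.
have /near_prodR[e e0 he] := nbhsI (open_nbhs_nbhs (conj O_open Ov))
  (proj1 (near_to _ dv) (vertex_discrete hausB G (position v))).
have [up nfl] := V_pot Vv.
have be p : box (a v) e p -> O p /\ forall v' : vertex G,
    position v' <> position v -> from_plane c p <> position v'.
  by move=> [? ?]; exact: he.
have [||F FN] := cut_vertex hausB cptB grG zC zz e0 dv _ _ up nfl.
- by move=> p /be[/Oc].
- move=> p v' /be[_ h] e1; apply: (position_inj grG); apply: contrapT => nv.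
  exact: (h v' nv e1).
exists F; apply: filterS FN => q pq qa; apply: (pot_congr _ (pq qa)).
near=> y => _; congr (_ * _)%g; rewrite /own (big_pred1 v) => [|v' /=].
  by rewrite /cut_sign /cut_bit; case: ifP; rewrite ?expg1 ?expg0.
apply/andP/eqP => [[Vv' /eqP]|->]; first exact: ainj.
by rewrite eqxx.
Unshelve. all: by end_near. Qed.

Let model_at p : O p -> exists F : B -> H,
  ((forall v : vertex G, from_plane c p <> position v) -> pot F (from_plane c p)) /\
  \forall q \near p, q <> p ->
    pot (fun y => z ^+ own p q (to_plane c y) * F y)%g (from_plane c q).
Proof.
move=> Op; have cp := Oc Op.
have [[v pv]|nv] := pselect (exists v : vertex G, from_plane c p = position v).
  have av : a v = p by rewrite /a -pv from_planeK.
  have dv : cdom c (position v) by rewrite -pv; exact: from_plane_dom.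
  have [|F FN] := @vertex_model v dv; first by rewrite av.
  by exists F; split; [move=> /(_ v) | rewrite av in FN].
have nv' (v : vertex G) : from_plane c p <> position v by move=> e; apply: nv; exists v.
have [F pF] := pot_exists phi grG nv'; exists F; split => //.
have := proj1 (near_from _ cp) (pot_near hausB cptB grG pF).
apply: filterS => q pq _; apply: (pot_congr _ pq); near=> y => _.
rewrite /own big_pred0 ?expg0 ?mul1g // => v.
apply/negP => /andP[/V_dom[dv _] /eqP e]; apply: (nv' v).
by rewrite -e to_planeK.
Unshelve. all: by end_near. Qed.

(** The local models times [z ^+ cut_count] are consistent: near a close point [q] the corrections
    differ by a constant exponent, which a left factor absorbs. So [glue_star] applies on the round
    disk [O]. *)
Lemma cut_potential : exists F : B -> H, forall p, O p ->
  (forall v : vertex G, from_plane c p <> position v) ->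
  pot (fun y => z ^+ cut_count p (to_plane c y) * F y)%g (from_plane c p).
Proof.
have Ex p : exists F : B -> H, O p ->
  ((forall v : vertex G, from_plane c p <> position v) -> pot F (from_plane c p)) /\
  \forall q \near p, q <> p ->
    pot (fun y => z ^+ own p q (to_plane c y) * F y)%g (from_plane c q).
  have [Op|nOp] := pselect (O p); last by exists (fun=> 1%g).
  by have [F HF] := model_at Op; exists F.
have [M HM] := choice Ex.
have O0 : O (0, 0) by rewrite /O /sqnorm /= !expr0n addr0 exprn_gt0.
have Ostar q (t : R) : O q -> 0 <= t <= 1 -> O (seg (0, 0) q t).
  move=> Oq /andP[t0 t1]; rewrite /O /=.
  have -> : sqnorm (seg (0, 0) q t) = t ^+ 2 * sqnorm q by rewrite /sqnorm /seg /=; ring.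
  apply: le_lt_trans Oq; rewrite ler_piMl ?exprn_ile1 //.
  by rewrite /sqnorm addr_ge0 ?sqr_ge0.
pose MC p (x : R * R) := (z ^+ cut_count p x * M p (from_plane c x))%g.
have [||F HF] := @glue_star R H [set x | ~ support G (from_plane c x)] MC O (0, 0) O_open O0 Ostar.
- by move=> p U Op; apply: (off_dense_from hausB grG); exact: Oc.
- move=> p Op.
  (* Summed over [V]: cuts ending elsewhere contribute by [cut_bit_near], while a cut ending at [p]
     contributes nothing to [cut_count p] and the same to [own] and to [cut_count q]. *)
  have step : \forall q \near p, exists K : nat, \forall x \near q,
      (cut_count p x + own p q x = K + cut_count q x)%N.
    have fa : \forall q \near p, forall v, a v <> p ->
        exists b : nat, \forall x \near q, cut_bit (a v) p x = (b + cut_bit (a v) q x)%N.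
      apply: (@filter_forall _ (vertex G) (fun v q => a v <> p -> exists b : nat,
        \forall x \near q, cut_bit (a v) p x = (b + cut_bit (a v) q x)%N) (nbhs p) _) => v.
      have [e|ne] := pselect (a v = p); first by near=> q => /(_ e).
      by apply: filterS (cut_bit_near ne) => q ? _.
    apply: filterS fa => q hq.
    have Exb v : exists b : nat, \forall x \near q,
        (cut_bit (a v) p x + (if a v == p then cut_bit (a v) q x else 0) = b + cut_bit (a v) q x)%N.
      have [e|/eqP ne] := eqVneq (a v) p.
        by exists 0%N; near=> x; rewrite e /cut_bit /on_cut ltxx andbF.
      by have [b hb] := hq v ne; exists b; apply: filterS hb => x ->; rewrite addn0.
    have [K hK] := near_sum (fun v (_ : V v) => Exb v); exists K; apply: filterS hK => x <-.
    by rewrite /cut_count /own [X in (_ + X)%N]big_mkcondr -big_split.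
  have nO : \forall q \near p, O q by apply: open_nbhs_nbhs.
  have [_ near_p] := HM p Op.
  have disc := proj1 (near_from _ (Oc Op)) (vertex_discrete hausB G (from_plane c p)).
  near=> q.
  have [->|/eqP qp] := eqVneq q p; first exact: same_germ_refl.
  have Oq : O q by near: q.
  have cq := Oc Oq.
  have qv (v : vertex G) : from_plane c q <> position v.
    move=> e; have [ep|nep] := pselect (position v = from_plane c p); last first.
      have d : forall v : vertex G, position v <> from_plane c p -> from_plane c q <> position v by near: q.
      exact: (d v nep e).
    apply: qp; rewrite -(from_planeK cq) -(from_planeK (Oc Op)); congr to_plane.
    by rewrite e.
  have pq : pot (fun y => z ^+ own p q (to_plane c y) * M p y)%g (from_plane c q) by move: qp; near: q.
  have [K hK] : exists K : nat, \forall x \near q,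
      (cut_count p x + own p q x = K + cut_count q x)%N by near: q.
  have [h Hh] := pot_unique grG pq ((HM q Oq).1 qv).
  exists (z ^+ K * h)%g.
  have := proj1 (near_from _ cq) Hh; have := near_cimg cq; apply: filterS3 hK => x Kx cx hx ox.
  have := hx ox; rewrite from_planeK // => e; rewrite /MC.
  have -> : M p (from_plane c x) = (z ^+ own p q x * h * M q (from_plane c x))%g.
    by rewrite -mulgA -e mulgA zX2 mul1g.
  rewrite !mulgA -expgnDr Kx expgnDr.
  by rewrite -!mulgA; congr (_ * _)%g; rewrite !mulgA zXC.
exists (F \o to_plane c) => p Op pv; have cp := Oc Op.
apply: (pot_germ ((HM p Op).1 pv)).
have [h Hh] := HF p Op; exists h; apply/(near_from _ cp); have := near_cimg cp.
apply: filterS2 Hh => x hx cx ox; rewrite /= from_planeK // hx // /MC.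
by rewrite !mulgA [(z ^+ _ * h)%g]zXC -(mulgA h) zX2 mulg1.
Unshelve. all: by end_near. Qed.

End CutPotential.

(** * A group in which the relators hold and [r4] has order two *)

Section Words.
Context (X : Type) (H : groupType) (phi : X -> H).

Lemma word_val_cat (w w' : word X) :
  word_val phi (w ++ w') = (word_val phi w * word_val phi w')%g.
Proof. by elim: w => [|l w IH] /=; rewrite ?mul1g // IH mulgA. Qed.

Lemma word_val_pow (w : word X) n : word_val phi (wpow w n) = (word_val phi w ^+ n)%g.
Proof. by elim: n => //= n IH; rewrite /wpow /= word_val_cat -/(wpow w n) IH expgS. Qed.

Lemma word_val_inv (w : word X) : word_val phi (winv w) = (word_val phi w)^-1%g.
Proof.
elim: w => [|l w IH]; first by rewrite /= invg1.
rewrite /winv /= rev_cons -cats1 word_val_cat -/(winv w) IH /= mulg1 invgM.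
by congr (_ * _)%g; case: l => x []; rewrite /letter_val //= invgK.
Qed.

Lemma word_val_rot (w : word X) k :
  (forall h : H, (word_val phi w * h)%g = (h * word_val phi w)%g) ->
  word_val phi (rot k w) = word_val phi w.
Proof.
move=> cen; set a := word_val phi (take k w); set b := word_val phi (drop k w).
have ew : word_val phi w = (a * b)%g by rewrite -word_val_cat cat_take_drop.
rewrite /rot word_val_cat -/a -/b; apply: (mulgI a).
by rewrite mulgA -ew cen.
Qed.

Lemma winvK (w : word X) : winv (winv w) = w.
Proof.
rewrite /winv map_rev revK -map_comp -[RHS]map_id; apply: eq_map => -[x b] /=.
by rewrite negbK.
Qed.

Lemma winv_rot (w : word X) k : exists k', winv (rot k w) = rot k' (winv w).
Proof. by rewrite /winv map_rot rev_rot /rotr; eexists. Qed.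

End Words.

Lemma word_val_morph (X : Type) (H K : groupType) (f : H -> K) (phi : X -> H) (w : word X) :
  f 1%g = 1%g -> (forall x y, f (x * y)%g = (f x * f y)%g) ->
  f (word_val phi w) = word_val (f \o phi) w.
Proof.
move=> f1 fM; have fV x : f (x^-1)%g = ((f x)^-1)%g.
  by apply: (mulgI (f x)); rewrite -fM !mulgV.
elim: w => //= l w IH; rewrite fM IH; congr (_ * _)%g.
by rewrite /letter_val; case: ifP.
Qed.

Section Monomial.
Context (g : nat) (hg : (2 <= g)%N).
Let m := (2 * g).+1.
Let N := (4 * g * m)%N.
Let T := ('Z_N * 'I_m.+1)%type.
Let q : 'Z_N := - (2 * m)%:R.

Let N_gt1 : (1 < N)%N. Proof. by rewrite /N /m; nia. Qed.

Let N0 : N%:R = 0 :> 'Z_N. Proof. exact: pchar_Zp. Qed.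

(* A monomial lift of the transposition (k k+1), with weights written additively.
   The word r3 shifts the strands by 2 m + q or 2 m + m q, and r4 shifts them by
   m (m + 1) + m q. For q = - 2 m and N = 2 m (m - 1), r3 becomes trivial and r4
   the shift by N / 2. *)
Definition swap_step (k : nat) (p : 'Z_N * nat) : 'Z_N * nat :=
  if p.2 == k then (p.1 + 1 + q, k.+1)
  else if p.2 == k.+1 then (p.1 + 1, k) else (p.1 + 1, p.2).

Let toN (p : T) : 'Z_N * nat := (p.1, val p.2).

Let toN_inj : injective toN.
Proof.
move=> [x j] [x' j'] e; congr pair; first exact: (congr1 fst e).
exact: val_inj (congr1 snd e).
Qed.

Lemma swap_step_lt k p : (k < m)%N -> (p.2 < m.+1)%N -> ((swap_step k p).2 < m.+1)%N.
Proof. by move=> km pm; rewrite /swap_step; case: ifP => // _; case: ifP => //= _; lia. Qed.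

Definition sigma_fun (k : 'I_m) (p : T) : T :=
  ((swap_step k (toN p)).1, inord (swap_step k (toN p)).2).

Lemma toN_sigma_fun (k : 'I_m) p : toN (sigma_fun k p) = swap_step k (toN p).
Proof.
rewrite /toN /sigma_fun /= inordK; first by case: swap_step.
by apply: swap_step_lt => //=; exact: ltn_ord.
Qed.

Lemma swap_step_inj k : injective (swap_step k).
Proof.
move=> [x j] [x' j'] e.
have e1 : (swap_step k (x, j)).1 = (swap_step k (x', j')).1 by rewrite e.
have e2 : (swap_step k (x, j)).2 = (swap_step k (x', j')).2 by rewrite e.
have jj : j = j'.
  by move: e2; rewrite /swap_step /=; case: (j =P k); case: (j =P k.+1); case: (j' =P k); case: (j' =P k.+1) => /=; lia.
subst j'; congr pair; move: e1; rewrite /swap_step /=.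
by case: ifP => _; [move=> /addIr/addIr | case: ifP => _ /addIr].
Qed.

Lemma sigma_fun_inj k : injective (sigma_fun k).
Proof. by move=> p p' /(congr1 toN); rewrite !toN_sigma_fun => /swap_step_inj/toN_inj. Qed.

Definition sigma (k : 'I_m) : {perm T} := perm (@sigma_fun_inj k).

Definition half_shift_fun (p : T) : T := (p.1 + (2 * g * m)%:R, p.2).

Lemma half_shift_fun_inj : injective half_shift_fun.
Proof.
move=> [x j] [x' j'] e; have e1 := congr1 fst e; have e2 := congr1 snd e.
by congr pair; [exact: addIr e1 | exact: e2].
Qed.

Definition half_shift : {perm T} := perm half_shift_fun_inj.

Lemma half_shift2 : (half_shift * half_shift = 1)%g.
Proof.
apply/permP => -[x j]; rewrite permM !permE /half_shift_fun /= -addrA -natrD.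
have -> : (2 * g * m + 2 * g * m)%N = N by rewrite /N; lia.
by rewrite N0 addr0.
Qed.

Lemma half_shift_neq1 : half_shift != 1%g.
Proof.
apply/eqP => /permP/(_ (0, ord0))/(congr1 fst); rewrite permE perm1 /= add0r.
move=> /(congr1 (fun x : 'Z_N => nat_of_ord x)); rewrite val_Zp_nat // modn_small /=.
  by rewrite /m; nia.
by rewrite /N /m; nia.
Qed.

Lemma sigma_half_shift k : (sigma k * half_shift = half_shift * sigma k)%g.
Proof.
apply/permP => -[x j]; rewrite !permM !permE; apply: toN_inj.
have e p : toN (half_shift_fun p) = ((toN p).1 + (2 * g * m)%:R, (toN p).2) by [].
rewrite e !toN_sigma_fun e /swap_step /=.
by case: ifP => _; [|case: ifP => _]; congr pair => /=; ring.
Qed.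

Lemma toN_word (s : seq nat) p : all (fun i => 1 <= i <= m)%N s ->
  toN (word_val sigma [seq xi g i | i <- s] p) =
  foldl (fun p k => swap_step k p) (toN p) [seq i.-1 | i <- s].
Proof.
elim: s p => [|i s IH] p /=; first by rewrite perm1.
move=> /andP[/andP[i1 im] sm]; rewrite permM IH // /letter_val /= permE toN_sigma_fun.
by rewrite inordK //; move: im; rewrite /m; lia.
Qed.

Definition run (p : 'Z_N * nat) (s : seq nat) := foldl (fun p k => swap_step k p) p s.

Lemma run_cat p s1 s2 : run p (s1 ++ s2) = run (run p s1) s2.
Proof. exact: foldl_cat. Qed.

(** The strand at position [s] is carried through all the swaps and gains [q] at each of them; every
    strand it passes descends by one, without [q]. *)
Lemma run_up (x : 'Z_N) j s l :
  run (x, j) (iota s l) =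
  if (j < s)%N then (x + l%:R, j)
  else if j == s then (x + l%:R * (1 + q), (s + l)%N)
  else if (j <= s + l)%N then (x + l%:R, j.-1) else (x + l%:R, j).
Proof.
elim: l s x j => [|l IH] s x j.
  rewrite /= mul0r !addr0 addn0; case: ltngtP => //.
  by move=> ->.
rewrite /= -/(run _ _) /swap_step /=; case: (ltngtP j s) => js.
- rewrite ltn_eqF; last lia. rewrite IH ltnW //; congr pair; rewrite -[l.+1%:R]natr1; ring.
- have [e|ne] := eqVneq j s.+1.
    rewrite IH ifT // ifT; last lia. by rewrite e; congr pair; rewrite -[l.+1%:R]natr1; ring.
  rewrite IH ifN; last lia. rewrite ifN // addSnnS.
  by case: ifP => _; congr pair; rewrite -[l.+1%:R]natr1; ring.
- subst j; rewrite IH ifN; last lia. rewrite eqxx addSnnS; congr pair.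
  by rewrite -[l.+1%:R]natr1; ring.
Qed.

(** The strand at position [s + l] is carried down without any [q]; every strand it passes rises by
    one and gains a single [q]. *)
Lemma run_down (x : 'Z_N) j s l :
  run (x, j) (rev (iota s l)) =
  if (j < s)%N then (x + l%:R, j)
  else if j == (s + l)%N then (x + l%:R, s)
  else if (j < s + l)%N then (x + l%:R + q, j.+1) else (x + l%:R, j).
Proof.
elim: l s => [|l IH] s.
  by rewrite /= addr0 addn0; case: ltngtP => // ->.
rewrite /= rev_cons -cats1 run_cat IH /run /= /swap_step.
have [js|js|js] := ltngtP j s.
- have -> : (j < s.+1)%N by lia. have -> /= : (j == s) = false by lia.
  have -> /= : (j == s.+1) = false by lia.
  by congr pair; rewrite -[l.+1%:R]natr1; ring.
- have -> : (j < s.+1)%N = false by lia. rewrite addSnnS.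
  have [e|ne] := eqVneq j (s + l.+1)%N => /=.
    have -> /= : (s.+1 == s) = false by lia. rewrite eqxx.
    by congr pair; rewrite -[l.+1%:R]natr1; ring.
  have [jl|jl] := boolP (j < s + l.+1)%N => /=.
    have -> /= : (j.+1 == s) = false by lia. have -> /= : (j.+1 == s.+1) = false by lia.
    by congr pair; rewrite -[l.+1%:R]natr1; ring.
  have -> /= : (j == s) = false by lia. have -> /= : (j == s.+1) = false by lia.
  by congr pair; rewrite -[l.+1%:R]natr1; ring.
- subst j; rewrite ltnSn /= eqxx.
  have -> : (s == s + l.+1)%N = false by lia. have -> : (s < s + l.+1)%N by lia.
  by congr pair; rewrite -[l.+1%:R]natr1; ring.
Qed.

Let run_up0 (x : 'Z_N) j : run (x, j) (iota 0 m) =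
  if j == 0%N then (x + m%:R * (1 + q), m)
  else if (j <= m)%N then (x + m%:R, j.-1) else (x + m%:R, j).
Proof. by rewrite run_up ltn0 !add0n. Qed.

Let run_down0 (x : 'Z_N) j : run (x, j) (rev (iota 0 m)) =
  if j == m then (x + m%:R, 0%N)
  else if (j < m)%N then (x + m%:R + q, j.+1) else (x + m%:R, j).
Proof. by rewrite run_down ltn0 !add0n. Qed.

Let size_xi n : all (fun i => 1 <= i <= n)%N (iota 1 n).
Proof. by apply/allP => i; rewrite mem_iota; lia. Qed.

Let map_pred n : [seq i.-1 | i <- iota 1 n] = iota 0 n.
Proof. by rewrite (iotaDl 1 0) -map_comp -[RHS]map_id; apply: eq_map. Qed.

Let N_halves : (2 * g)%:R * q = 0.
Proof.
have e : (2 * g * (2 * m) = N)%N by rewrite /N; lia.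
by rewrite /q mulrN -natrM e N0 oppr0.
Qed.

Let mq : m%:R * q = q.
Proof. by rewrite /m -natr1 mulrDl N_halves add0r mul1r. Qed.

Lemma sigma_r3 : word_val sigma (r3 g) = 1%g.
Proof.
apply/permP => -[x j]; apply: toN_inj; rewrite /r3 /xi_seq -map_rev -map_cat toN_word; last first.
  by rewrite all_cat all_rev size_xi.
rewrite map_cat map_rev map_pred -/(run _ _) run_cat perm1.
have jm := ltn_ord j; rewrite -[toN _]/(x, val j) run_up0.
have e0 : m%:R * 2 + q = 0 by rewrite /q natrM; ring.
have [->|j0] := eqVneq (val j) 0%N.
  rewrite run_down0 eqxx; congr pair.
  transitivity (x + (m%:R * 2 + m%:R * q)); first by ring.
  by rewrite mq e0 addr0.
have -> : (val j <= m)%N by rewrite -ltnS.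
rewrite run_down0.
have j1 : (val j).-1.+1 = val j by rewrite prednK // lt0n.
have -> : ((val j).-1 < m)%N by rewrite j1 -ltnS.
have -> : ((val j).-1 == m) = false by rewrite ltn_eqF // j1 -ltnS.
rewrite j1; congr pair.
by transitivity (x + (m%:R * 2 + q)); [ring | rewrite e0 addr0].
Qed.

(** Each factor [d] lowers a strand by one and sends the bottom strand to the top. In [m + 1]
    factors every strand returns to its place, having gone from bottom to top exactly once, so the
    shift is the same for all. *)
Lemma sigma_r4 : word_val sigma (r4 g) = half_shift.
Proof.
set d := word_val sigma (xi_seq g m).
have dE p : toN (d p) = if (toN p).2 == 0%N then ((toN p).1 + m%:R * (1 + q), m)
    else ((toN p).1 + m%:R, (toN p).2.-1).
  rewrite /d /xi_seq toN_word ?size_xi // map_pred -/(run _ _).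
  case: p => x j; have jm := ltn_ord j; rewrite -[toN _]/(x, val j) run_up0 /toN.
  by have -> : (val j <= m)%N by rewrite -ltnS.
have dX t p : (t <= (toN p).2)%N ->
    toN ((d ^+ t)%g p) = ((toN p).1 + t%:R * m%:R, ((toN p).2 - t)%N).
  elim: t => [|t IH] tp; first by rewrite expg0 perm1 mul0r addr0 subn0; case: (toN p).
  rewrite expgSr permM dE IH /=; last exact: ltnW.
  have -> : ((toN p).2 - t == 0)%N = false by lia.
  by congr pair; [rewrite -natr1; ring | lia].
apply/permP => -[x j]; apply: toN_inj; rewrite /r4 word_val_pow -/d.
have jm : (val j <= m)%N by rewrite -ltnS; exact: ltn_ord.
(* After [j] factors the strand is at the bottom, the next one takes it to [m], and the remaining
   [m - j] bring it back to [j]. *)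
have -> : (d ^+ (2 * g).+2 = d ^+ (val j).+1 * d ^+ (m - val j))%g.
  by rewrite -expgnDr addSn subnKC.
rewrite permM.
have e1 : toN ((d ^+ (val j).+1)%g (x, j)) = (x + (val j)%:R * m%:R + m%:R * (1 + q), m).
  by rewrite expgSr permM dE dX //= subnn.
rewrite dX e1 /=; last by lia.
rewrite permE /half_shift_fun /toN /=; congr pair; last by rewrite /= subKn.
have jj : (val j)%:R + (m - val j)%:R = m%:R :> 'Z_N by rewrite -natrD subnKC.
transitivity (x + (((val j)%:R + (m - val j)%:R) * m%:R + m%:R + m%:R * q)); first by ring.
rewrite jj mq; congr (_ + _); rewrite /q.
have -> : m%:R * m%:R + m%:R = (2 * g * m)%:R + (2 * m)%:R :> 'Z_N.
  by rewrite -natrM -!natrD; congr (_%:R); rewrite /m; lia.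
by rewrite addrK.
Qed.

Lemma sigma_comm (k k' : 'I_m) : (k.+1 < k')%N -> (sigma k * sigma k' = sigma k' * sigma k)%g.
Proof.
move=> kk; apply/permP => p; rewrite !permM !permE; apply: toN_inj.
rewrite !toN_sigma_fun; case: (toN p) => x j; rewrite /swap_step /=.
have [->|n1] := eqVneq j k => /=.
  have -> : (k.+1 == k') = false by lia. have -> /= : (k.+1 == k'.+1) = false by lia.
  have -> : (nat_of_ord k == k') = false by lia. have -> /= : (nat_of_ord k == k'.+1) = false by lia.
  by rewrite eqxx; congr pair; ring.
have [->|n2] := eqVneq j k.+1 => /=.
  have -> : (nat_of_ord k == k') = false by lia. have -> /= : (nat_of_ord k == k'.+1) = false by lia.
  have -> : (k.+1 == k') = false by lia. have -> /= : (k.+1 == k'.+1) = false by lia.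
  have -> /= : (k.+1 == k) = false by lia. by rewrite eqxx.
have [e3|n3] := eqVneq j k' => /=.
  have -> : (k'.+1 == k) = false by lia. have -> /= : (k'.+1 == k.+1) = false by lia.
  by congr pair; ring.
have [e4|n4] := eqVneq j k'.+1 => /=.
  have -> : (nat_of_ord k' == k) = false by lia. by have -> /= : (nat_of_ord k' == k.+1) = false by lia.
by rewrite (negbTE n1) (negbTE n2).
Qed.

Lemma sigma_braid (k k' : 'I_m) : k' = k.+1 :> nat ->
  (sigma k * sigma k' * sigma k = sigma k' * sigma k * sigma k')%g.
Proof.
move=> kk; apply/permP => p; rewrite !permM !permE; apply: toN_inj.
rewrite !toN_sigma_fun kk; move: (nat_of_ord k) => i; case: (toN p) => x j.
have n1 l : (l == l.+1) = false by lia. have n2 l : (l.+1 == l) = false by lia.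
have n3 l : (l == l.+2) = false by lia. have n4 l : (l.+2 == l) = false by lia.
rewrite /swap_step /=.
have [->|m1] := eqVneq j i => /=.
  by rewrite ?(eqxx, n1, n2, n3, n4) /= ?(eqxx, n1, n2, n3, n4) /= ?(eqxx, n1, n2, n3, n4) /=; congr pair; ring.
have [m2|m2] := eqVneq j i.+1 => /=.
  by rewrite ?(eqxx, n1, n2, n3, n4) /= ?(eqxx, n1, n2, n3, n4) /= ?(eqxx, n1, n2, n3, n4) /=; congr pair; ring.
have [m3|m3] := eqVneq j i.+2 => /=.
  by rewrite ?(negbTE m1, negbTE m2, eqxx, n1, n2, n3, n4) /= ?(eqxx, n1, n2, n3, n4) /= ?(eqxx, n1, n2, n3, n4) /=; congr pair; ring.
by rewrite ?(negbTE m1, negbTE m2, negbTE m3) /= ?(negbTE m1, negbTE m2, negbTE m3).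
Qed.

Lemma sigma_relator (r : word (X0 g)) : R0 r ->
  word_val sigma r = 1%g \/ r = r4 g /\ word_val sigma r = half_shift.
Proof.
case=> [i j i1 ij jg|i /andP[i1 ig]||]; last 2 first.
- by left; exact: sigma_r3.
- by right; split; [|exact: sigma_r4].
- left; rewrite /= /letter_val /= mulg1.
  have c : (sigma (inord i.-1) * sigma (inord j.-1) = sigma (inord j.-1) * sigma (inord i.-1))%g.
    by apply: sigma_comm; rewrite !inordK; rewrite ?/m; lia.
  by rewrite !mulgA c mulgK mulgV.
- left; rewrite /= /letter_val /= mulg1.
  have c : (sigma (inord i.-1) * sigma (inord i) * sigma (inord i.-1) =
      sigma (inord i) * sigma (inord i.-1) * sigma (inord i))%g.
    by apply: sigma_braid; rewrite !inordK; rewrite ?/m; lia.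
  by rewrite !mulgA c !mulgK mulgV.
Qed.

Let C := [group of 'C[half_shift]]%G.

(** [H] is the centralizer of the half shift in the group of permutations: this makes [z] central,
    and it contains all the [sigma k]. *)
Lemma braid_extension : exists (H : groupType) (phi : X0 g -> H) (z : H),
  [/\ forall h : H, (z * h)%g = (h * z)%g, (z * z)%g = 1%g, z <> 1%g, word_val phi (r4 g) = z &
   forall r, R0 r -> word_val phi r = 1%g \/ r = r4 g /\ word_val phi r = z].
Proof.
have zC : half_shift \in C by exact: cent1id.
have sC k : sigma k \in C by apply/cent1P; exact: sigma_half_shift.
exists (subg_of C), (fun k => subg C (sigma k)), (subg C half_shift).
have vE (w : word (X0 g)) : sgval (word_val (fun k => subg C (sigma k)) w) = word_val sigma w.
  have e : (@sgval _ C \o (fun k => subg C (sigma k))) = sigma.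
    by apply/funext => k /=; rewrite subgK ?sC.
  by rewrite (@word_val_morph _ _ _ (@sgval _ C)) // e.
have vz : sgval (subg C half_shift) = half_shift by exact: subgK.
split.
- move=> h; apply: subg_inj; rewrite !sgvalM // vz.
  by have /cent1P := subgP h.
- by apply: subg_inj; rewrite sgvalM // vz half_shift2.
- by move=> /(congr1 (@sgval _ C)); rewrite vz => e; have := half_shift_neq1; rewrite e eqxx.
- by apply: subg_inj; rewrite vE sigma_r4 vz.
- move=> r /sigma_relator[e|[-> e]]; [left|right; split => //];
  by apply: subg_inj; rewrite vE e ?vz.
Qed.

End Monomial.

(** * Comparison of the two graphs *)

Lemma agree_on_sym (R : realType) (B : topologicalType) (X : Type) (K : set B)
    (G G' : graph_data R B X) : agree_on K G G' -> agree_on K G' G.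
Proof.
move=> [sK vK eK]; split => [//|p b Kp|e s e' s' es es' ep Kp]; first by rewrite vK.
have [lab dir] := eK e' s' e s es' es (esym ep) ltac:(by rewrite -ep).
split => //; have [[A1 A2] /= [h1 h2] hA] := dir; exists (A2, A1) => //= -[u u'] /= [a2 a1] Ku ee.
have := hA (u', u) (conj a1 a2); rewrite /= => h; rewrite -(h _ (esym ee)) //.
by rewrite -ee.
Qed.

Lemma locally_flat_agree (R : realType) (B : topologicalType) (S : oriented_surface R B)
    (X : Type) (H : groupType) (phi : X -> H) (G G' : graph_data R B X) (U K : set B) p :
  is_graph S G -> is_graph S G' -> open U -> U `<=` K -> agree_on K G G' -> U p ->
  locally_flat S phi G p -> locally_flat S phi G' p.
Proof.
move=> grG grG' Uo UK aK Up [F HF]; exists F.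
have nU : \forall q \near p, U q by apply: open_nbhs_nbhs.
apply: filterS2 nU HF => q Uq pq qp.
exact: (pot_agree grG grG' Uo UK aK Uq (pq qp)).
Qed.

Lemma closed_disk_compact (R : realType) : compact (@closed_disk R).
Proof.
apply: (@subclosed_compact _ _ (`[(-1 : R), 1] `*` `[(-1 : R), 1])).
- have -> : @closed_disk R = sqnorm @^-1` [set x | x <= 1] by [].
  apply: preimage_closed; last exact: closed_le.
  by move=> z _; exact: sqnorm_continuous.
- by apply: compact_setX; exact: segment_compact.
- move=> [x y]; rewrite /closed_disk /= => h; rewrite !in_itv /=.
  have := sqr_ge0 x; have := sqr_ge0 y => y0 x0.
  have sq (t : R) : t ^+ 2 <= 1 -> -1 <= t <= 1.
    by move=> t1; rewrite -ler_norml -(ler_pXn2r (n := 2)) ?nnegrE // expr1n real_normK ?num_real.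
  by split; apply: sq; lra.
Qed.

(** By compactness of the disk, every dilation of ratio close to 1 keeps it inside [U]. *)
Lemma disk_collar (R : realType) (U : set (R * R)) : open U -> closed_disk `<=` U ->
  \forall rho \near (1 : R)^'+, forall p, sqnorm p < rho ^+ 2 -> U p.
Proof.
move=> Uo DU; have /compact_near_coveringP cov := @closed_disk_compact R.
have H1 : \forall rho \near (1 : R), closed_disk `<=` (fun p => U (dilate rho p)).
  apply: (cov _ (nbhs (1 : R)) (fun rho p => U (dilate rho p))) => p Dp.
  have c : {for (p, 1 : R), continuous (fun x : (R * R) * R => dilate x.2 x.1)}.
    apply: (@cvg_pair _ _ _ _ (nbhs _) (nbhs _)) => /=; apply: cvgM.
    - exact: cvg_snd.
    - exact: (@cvg_comp _ _ _ fst fst _ _ _ cvg_fst cvg_fst).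
    - exact: cvg_snd.
    - exact: (@cvg_comp _ _ _ fst snd _ _ _ cvg_fst cvg_snd).
  apply: c; apply: open_nbhs_nbhs; split => //=.
  by rewrite /dilate !mul1r; case: p Dp => x y; exact: DU.
near=> rho => p pr.
have r1 : 1 < rho by near: rho; exact: nbhs_right_gt.
have Hr : closed_disk `<=` (fun p => U (dilate rho p)) by near: rho; exact: cvg_within H1.
have r0 : 0 < rho by lra.
have -> : p = dilate rho (dilate rho^-1 p).
  by rewrite /dilate /= !mulrA divff ?gt_eqF // !mul1r; case: p {pr}.
apply: Hr; rewrite /closed_disk /=.
have -> : (rho^-1 * p.1) ^+ 2 + (rho^-1 * p.2) ^+ 2 = rho ^- 2 * sqnorm p.
  by rewrite /sqnorm -exprVn; ring.
by rewrite mulrC ler_pdivrMr ?exprn_gt0 // mul1r ltW.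
Unshelve. all: by end_near. Qed.

Section Compare.
Context (R : realType) (B : topologicalType) (S : oriented_surface R B).
Context (X : Type) (H : groupType) (phi : X -> H).
Hypothesis hausB : hausdorff_space B.
Hypothesis cptB : compact [set: B].
Context (G G' : graph_data R B X).
Hypotheses (grG : is_graph S G) (grG' : is_graph S G').
Context (z : H).
Hypothesis zC : forall h : H, (z * h)%g = (h * z)%g.
Hypothesis zz : (z * z)%g = 1%g.
Hypothesis z1 : z <> 1%g.
Context (c : coord_chart R B) (rho : R).
Let O := [set p : R * R | sqnorm p < rho ^+ 2].
Hypothesis rho1 : 1 < rho.
Hypothesis Oc : O `<=` cimg c.
Let D := from_plane c @` closed_disk.
Context (K : set B).
Hypothesis DK : ~` D `<=` K.
Hypothesis aK : agree_on K G G'.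
Context (V : pred (vertex G)) (V' : pred (vertex G')).
Hypothesis V_dom : forall v, V v -> cdom c (position v) /\ sqnorm (to_plane c (position v)) <= 1.
Hypothesis V'_dom : forall v, V' v -> cdom c (position v) /\ sqnorm (to_plane c (position v)) <= 1.
Hypothesis collar : forall p, O p -> 1 < sqnorm p ->
  (forall v : vertex G, from_plane c p <> position v) /\
  (forall v : vertex G', from_plane c p <> position v).
Context (F F' : B -> H).
Hypothesis HF : forall p, O p -> (forall v : vertex G, from_plane c p <> position v) ->
  pot S phi G (fun y => z ^+ cut_count c V p (to_plane c y) * F y)%g (from_plane c p).
Hypothesis HF' : forall p, O p -> (forall v : vertex G', from_plane c p <> position v) ->
  pot S phi G' (fun y => z ^+ cut_count c V' p (to_plane c y) * F' y)%g (from_plane c p).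

Let rho2 : 1 < rho ^+ 2.
Proof. by have := rho1; nra. Qed.

Let D_closed : closed D.
Proof.
apply: compact_closed => //; apply: continuous_compact; last exact: closed_disk_compact.
apply: continuous_in_subspaceT => p; rewrite inE => Dp.
apply: from_continuous; apply: Oc; rewrite /O /=; apply: le_lt_trans Dp _.
exact: rho2.
Qed.

(** The number of cuts whose abscissa exceeds that of [x]. Along the upper half circle, [z] to this
    power cancels all the jumps of the ratio of [F] and [F']. *)
Let left_count (x : R * R) : nat :=
  (\sum_(v | V v) (x.1 < (to_plane c (position v)).1)%R +
   \sum_(v | V' v) (x.1 < (to_plane c (position v)).1)%R)%N.

Let ring_point (t : R) : R * R := dilate ((1 + rho) / 2) (circle t).

Let ring_sqnorm t : 1 < sqnorm (ring_point t) < rho ^+ 2.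
Proof.
rewrite sqnorm_dilate sqnorm_circle mulr1; apply/andP; split.
  by have := rho1; nra.
by have := rho1; nra.
Qed.

(** The circle lies in the complement of [D], an open set on which the graphs agree. There both
    corrected functions are potentials for [G'], hence proportional. *)
Let ring_ratio t : exists h, \forall q \near from_plane c (ring_point t), ~ support G' q ->
  (F q * (F' q)^-1)%g = (h * z ^+ (cut_count c V (ring_point t) (to_plane c q) +
     cut_count c V' (ring_point t) (to_plane c q)))%g.
Proof.
have /andP[p1 pr] := ring_sqnorm t; set p := ring_point t in p1 pr *.
have Op : O p by [].
have [nv nv'] := collar Op p1.
have cp := Oc Op.
have nD : (~` D) (from_plane c p).
  move=> [q Dq qp]; have cq : cimg c q.
    by apply: Oc; rewrite /O /=; exact: le_lt_trans Dq rho2.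
  have e : q = p by rewrite -(from_planeK cq) -(from_planeK cp) qp.
  by rewrite e in Dq; have := lt_le_trans p1 Dq; rewrite ltxx.
have p1' := pot_agree grG grG' (closed_openC D_closed) DK aK nD (HF Op nv).
have [h Hh] := pot_unique grG' p1' (HF' Op nv').
exists h; apply: filterS Hh => q hq oq.
set n := cut_count c V _ _; set n' := cut_count c V' _ _.
have e : F q = (z ^+ n * (h * (z ^+ n' * F' q)))%g by rewrite -hq // mulgA zX2 ?mul1g.
by rewrite e !mulgA mulgK (zXC zC) -mulgA -expgnDr.
Qed.

Let ring_continuous : continuous (fun t => from_plane c (ring_point t)).
Proof.
move=> t; apply: (@continuous_comp _ _ _ ring_point (from_plane c)).
  apply: (@continuous_comp _ _ _ circle (dilate ((1 + rho) / 2))).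
    exact: circle_continuous.
  exact: dilate_continuous.
by apply: from_continuous; apply: Oc; case/andP: (ring_sqnorm t).
Qed.

(** If [p] has the abscissa of [a], then it is farther from the horizontal axis than [a]; being in
    the upper half plane it is above [a], hence on the cut. So the upper half circle meets the cut
    of [a] wherever it has the same abscissa. *)
Let upper_bit (a p : R * R) : sqnorm a <= 1 -> 1 < sqnorm p -> 0 <= p.2 ->
  exists b : nat, \forall x \near p, nat_of_bool (x.1 < a.1)%R = (b + cut_bit a p x)%N.
Proof.
move=> a1 p1 p2; have [e|ne] := eqVneq p.1 a.1; last first.
  exists (nat_of_bool (p.1 < a.1)%R); apply: filterS (left_of_near ne) => x ->.
  by rewrite /cut_bit /on_cut (negbTE ne) addn0.
exists 0%N; near=> x; rewrite /cut_bit /on_cut e eqxx.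
suff -> : a.2 < p.2 by [].
by move: a1 p1; rewrite /sqnorm e => a1 p1; nra.
Unshelve. all: by end_near. Qed.

Let lower_bit (a p x : R * R) : sqnorm a <= 1 -> 1 < sqnorm p -> p.2 <= 0 ->
  cut_bit a p x = 0%N.
Proof.
move=> a1 p1 p2; rewrite /cut_bit /on_cut; case: eqP => //= e.
suff -> : (a.2 < p.2) = false by [].
apply/negbTE; rewrite -leNgt; move: a1 p1; rewrite /sqnorm e => a1 p1; nra.
Qed.

Let zX_odd n : (z ^+ n)%g = if odd n then z else 1%g.
Proof.
elim: n => [|n IH]; first by rewrite expg0.
by rewrite expgS IH /=; case: (odd n); rewrite ?zz ?mulg1.
Qed.

Let near_ring t (P : R * R -> Prop) : (\forall x \near ring_point t, P x) ->
  \forall q \near from_plane c (ring_point t), P (to_plane c q).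
Proof.
have /andP[_ pr] := ring_sqnorm t; have cp : cimg c (ring_point t) by exact: Oc.
move=> h; apply/(near_from _ cp); have := near_cimg cp.
by apply: filterS2 h => x Px cx; rewrite from_planeK.
Qed.

Let upper_const t : 0 <= t <= 1 / 2 -> exists x, \forall q \near from_plane c (ring_point t),
  ~ support G' q -> (z ^+ left_count (to_plane c q) * (F q * (F' q)^-1))%g = x.
Proof.
move=> /andP[t0 t2]; have /andP[p1 _] := ring_sqnorm t.
have p2 : 0 <= (ring_point t).2.
  rewrite mulr_ge0 //; first by have := rho1; lra.
  have pi0 := pi_gt0 R; apply: sin_ge0_pi.
  have -> : 2 * pi * t = pi * (2 * t) by ring.
  apply/andP; split; first by apply: mulr_ge0; [exact: ltW | lra].
  by rewrite ger_pMr //; lra.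
have [k hk] := near_sum (fun v (Vv : V v) => upper_bit (V_dom Vv).2 p1 p2).
have [k' hk'] := near_sum (fun v (Vv : V' v) => upper_bit (V'_dom Vv).2 p1 p2).
have [h Hh] := ring_ratio t; exists (z ^+ (k + k') * h)%g.
apply: filterS3 (near_ring hk) (near_ring hk') Hh => q k1 k2 hq oq.
rewrite (hq oq) /left_count k1 k2 -/(cut_count c V _ _) -/(cut_count c V' _ _) addnACA.
set n := (cut_count _ _ _ _ + _)%N.
have e : (z ^+ n * (h * z ^+ n))%g = h by rewrite mulgA (zXC zC) -mulgA zX2 ?mulg1.
by rewrite expgnDr -mulgA e.
Qed.

Let lower_const t : 1 / 2 <= t <= 1 -> exists x, \forall q \near from_plane c (ring_point t),
  ~ support G' q -> (F q * (F' q)^-1)%g = x.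
Proof.
move=> /andP[t0 t2]; have /andP[p1 _] := ring_sqnorm t.
have p2 : (ring_point t).2 <= 0.
  rewrite mulr_ge0_le0 //; first by have := rho1; lra.
  have pi0 := pi_gt0 R.
  change (sin (2 * pi * t) <= 0).
  have -> : 2 * pi * t = 2 * pi * (t - 1 / 2) + pi by field.
  rewrite sinDpi oppr_le0; apply: sin_ge0_pi.
  have -> : 2 * pi * (t - 1 / 2) = pi * (2 * t - 1) by field.
  apply/andP; split; first by apply: mulr_ge0; [exact: ltW | lra].
  by rewrite ger_pMr //; lra.
have [h Hh] := ring_ratio t; exists h.
apply: filterS Hh => q hq oq; rewrite (hq oq) /cut_count !big1 ?expg0 ?mulg1 //.
  by move=> v Vv; apply: lower_bit => //; exact: (V'_dom Vv).2.
by move=> v Vv; apply: lower_bit => //; exact: (V_dom Vv).2.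
Qed.

(** The ratio of [F] and [F'] is constant on the lower half circle, and on the upper one after
    multiplication by [z ^+ left_count]. At the rightmost point no cut is counted, so the two
    constants are equal; at the leftmost point all are counted, so [z] to their number is 1. *)
Lemma cut_parity : ~~ odd (#|V| + #|V'|).
Proof.
have h0 : (0 : R) <= 1 / 2 by lra.
have h1 : (1 / 2 : R) <= 1 by lra.
have dns t (U : set B) : nbhs (from_plane c (ring_point t)) U -> exists2 q, U q & ~ support G' q.
  exact: (off_dense hausB grG').
have [x1 Hx1] := @path_const R B H [set q | ~ support G' q]
  (fun q => z ^+ left_count (to_plane c q) * (F q * (F' q)^-1))%g (fun t => from_plane c (ring_point t)) 0 (1 / 2) h0
  (fun t _ => @ring_continuous t) (fun t (U : set B) _ => @dns t U) upper_const.
have [x2 Hx2] := @path_const R B H [set q | ~ support G' q]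
  (fun q => F q * (F' q)^-1)%g (fun t => from_plane c (ring_point t)) (1 / 2) 1 h1
  (fun t _ => @ring_continuous t) (fun t (U : set B) _ => @dns t U) lower_const.
have a1 (a : R * R) : sqnorm a <= 1 -> -1 <= a.1 <= 1.
  by rewrite /sqnorm => ?; apply/andP; split; nra.
have r0 : ring_point 0 = ((1 + rho) / 2, 0).
  by rewrite /ring_point /circle mulr0 cos0 sin0 /dilate /= mulr1 mulr0.
have rh : ring_point (1 / 2) = (- ((1 + rho) / 2), 0).
  have e : 2 * pi * (1 / 2) = pi :> R by field.
  by rewrite /ring_point /circle e cospi sinpi /dilate /= mulrN1 mulr0.
have r1 : ring_point 1 = ring_point 0 by rewrite /ring_point -[1]add0r circleD1.
have e12 : x1 = x2.
  have u0 := Hx1 0 ltac:(by rewrite lexx h0).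
  have l0 := Hx2 1 ltac:(by rewrite lexx h1). rewrite r1 in l0.
  have L0 : \forall x \near ring_point 0, left_count x = 0%N.
    have : 1 < (ring_point 0).1 by rewrite r0 /=; have := rho1; lra.
    move=> /fst_gt_near; apply: filterS => x x1'; rewrite /left_count !big1 // => v Vv.
      have /andP[_ av] := a1 _ (V'_dom Vv).2.
      by rewrite ltNge (le_trans av) // ltW.
    have /andP[_ av] := a1 _ (V_dom Vv).2.
    by rewrite ltNge (le_trans av) // ltW.
  have [q [[q1 q2] q3] oq] := dns 0 _ (nbhsI (nbhsI u0 l0) (near_ring L0)).
  by rewrite -(q1 oq) -(q2 oq) q3 expg0 mul1g.
have uh := Hx1 (1 / 2) ltac:(by rewrite lexx h0).
have lh := Hx2 (1 / 2) ltac:(by rewrite lexx h1).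
have Lh : \forall x \near ring_point (1 / 2), left_count x = (#|V| + #|V'|)%N.
  have : (ring_point (1 / 2)).1 < -1 by rewrite rh /=; have := rho1; lra.
  move=> /fst_lt_near; apply: filterS => x x1'; rewrite /left_count -!sum1_card.
  congr addn; apply: eq_bigr => v Vv.
    have /andP[av _] := a1 _ (V_dom Vv).2.
    by rewrite (lt_le_trans x1' av).
  have /andP[av _] := a1 _ (V'_dom Vv).2.
  by rewrite (lt_le_trans x1' av).
have [q [[q1 q2] q3] oq] := dns (1 / 2) _ (nbhsI (nbhsI uh lh) (near_ring Lh)).
have := q1 oq; rewrite (q2 oq) q3 e12 -[RHS]mul1g => /mulIg; rewrite zX_odd.
by case: odd.
Qed.

End Compare.

Lemma card_le_position (R : realType) (B : topologicalType) (X : Type)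
    (G G' : graph_data R B X) (A : pred (vertex G)) (A' : pred (vertex G')) :
  injective (@position R B X G) ->
  (forall v, A v -> exists2 v', A' v' & position v' = position v) ->
  (#|A| <= #|A'|)%N.
Proof.
move=> inj h; rewrite !cardE.
rewrite -(size_map (@position R B X G)) -(size_map (@position R B X G')).
apply: uniq_leq_size; first by rewrite map_inj_uniq ?enum_uniq.
move=> p /mapP[v]; rewrite mem_enum => Av ->.
have [v' Av' <-] := h v Av; apply: map_f.
by rewrite mem_enum.
Qed.

Section Charts.
Context (R : realType) (g : nat) (B : topologicalType) (S : oriented_surface R B) (b0 : B).
Hypothesis hausB : hausdorff_space B.
Hypothesis cptB : compact [set: B].
Context (H : groupType) (phi : X0 g -> H) (z : H).
Hypothesis zC : forall h : H, (z * h)%g = (h * z)%g.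
Hypothesis zz : (z * z)%g = 1%g.
Hypothesis z1 : z <> 1%g.
Hypothesis relz : forall r, R0 r -> word_val phi r = 1%g \/ r = r4 g /\ word_val phi r = z.
Hypothesis r4z : word_val phi (r4 g) = z.

Let zV : (z^-1)%g = z.
Proof. by apply: (mulgI z); rewrite mulgV zz. Qed.

(** Relators have value 1 or [z], both central and equal to their inverses, so rotation and
    inversion do not affect the value of the vertex word. Value 1 makes the vertex locally flat, and
    [z] prevents this; the word found for the type may come from another meridian than the one given
    by the chart, and local flatness mediates between them. *)
Lemma white_vertex_flat (G : graph_data R B (X0 g)) (v : vertex G) :
  is_chart S b0 (C0 g) G -> ~~ black v ->
  ((vertex_type S v (r4 g) \/ vertex_type S v (winv (r4 g))) <->
    ~ locally_flat S phi G (position v)) /\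
  (~ locally_flat S phi G (position v) -> pot_up_to S phi G z (position v)).
Proof.
move=> [grG _ white _] bv.
have [w [vw [r Rr rw]]] := white v bv.
have cyc (r' w' : word (X0 g)) : cyclic_perm r' w' -> word_val phi r' = 1%g \/ word_val phi r' = z ->
    word_val phi w' = word_val phi r'.
  move=> [k ->] h; apply: word_val_rot.
  by case: h => -> // h; rewrite mul1g mulg1.
have val_r4 : word_val phi (winv (r4 g)) = z by rewrite word_val_inv r4z zV.
have type_z (r' : word (X0 g)) : vertex_type S v r' -> word_val phi r' = z ->
    ~ locally_flat S phi G (position v).
  move=> [w' vw' cw'] rz /(vertex_word_val phi hausB cptB grG vw').1 w1; apply: z1.
  by rewrite -rz -(cyc _ _ cw') ?rz; [rewrite word_val_inv w1 invg1 | right].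
have wval : word_val phi w = word_val phi r.
  have rr := relz Rr; case: rw => /cyc; first by apply; case: rr => [->|[_ ->]]; [left|right].
  rewrite word_val_inv; case: rr => [->|[_ ->]]; first by rewrite invg1; apply; left.
  by rewrite zV; apply; right.
have [r1|[er rz]] := relz Rr.
  have fl := locally_flat_of_word hausB cptB grG vw (etrans wval r1).
  split=> [|/(_ fl)//]; split=> [|/(_ fl)//].
  by case=> /type_z h; [exact: (h r4z) | exact: (h val_r4)].
split; last first.
  move=> _; have := (vertex_word_val phi hausB cptB grG vw).2.
  by rewrite wval rz; apply.
split; first by case=> /type_z; apply.
(* Types are defined through the inverse of the vertex word, so a rotation of r4 gives the type of
   its inverse, and conversely. *)
move=> _; subst r; case: rw => -[k wk]; [right|left]; exists w => //.
  by have [k' e] := winv_rot (r4 g) k; exists k'; rewrite wk e.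
by have [k' e] := winv_rot (winv (r4 g)) k; exists k'; rewrite wk e winvK.
Qed.

Definition twisted (G : graph_data R B (X0 g)) : pred (vertex G) :=
  fun v => ~~ black v && `[< ~ locally_flat S phi G (position v) >].

Lemma w_invariant_twisted (G : graph_data R B (X0 g)) : is_chart S b0 (C0 g) G ->
  w_invariant S G = #|@twisted G|%:R.
Proof.
move=> hG; rewrite /w_invariant; congr (_%:R); apply: eq_card => v.
rewrite unfold_in /= [RHS]unfold_in /twisted; case bv: (black v) => //=.
have e := (white_vertex_flat hG (negbT bv)).1.
by apply/asboolP/asboolP => /e.
Qed.

(** Being twisted depends only on the colour and on the graph nearby, so the vertex of [G'] at the
    same position is twisted too. *)
Lemma twisted_outside_le (G G' : graph_data R B (X0 g)) (D K : set B) :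
  is_chart S b0 (C0 g) G -> is_chart S b0 (C0 g) G' -> closed D -> ~` D `<=` K ->
  agree_on K G G' ->
  (#|[predD @twisted G & [pred v | `[< D (position v) >]]]| <=
   #|[predD @twisted G' & [pred v | `[< D (position v) >]]]|)%N.
Proof.
move=> hG hG' Dc DK aK; have [grG _ _ _] := hG; have [grG' _ _ _] := hG'.
apply: (card_le_position (position_inj grG)) => v /= /andP[/asboolP nD /andP[bv /asboolP nfl]].
have [_ vK _] := aK.
have [v' pv' bv'] := (vK (position v) (black v) (DK _ nD)).1 (ex_intro2 _ _ v erefl erefl).
exists v' => //; apply/andP; split; first by apply/negP => /asboolP; rewrite pv'.
apply/andP; split; first by rewrite bv'.
apply/asboolP => fl; apply: nfl; rewrite pv' in fl.
exact: (locally_flat_agree grG' grG (closed_openC Dc) DK (agree_on_sym aK) nD fl).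
Qed.

Lemma twisted_outside (G G' : graph_data R B (X0 g)) (D K : set B) :
  is_chart S b0 (C0 g) G -> is_chart S b0 (C0 g) G' -> closed D -> ~` D `<=` K ->
  agree_on K G G' ->
  #|[predD @twisted G & [pred v | `[< D (position v) >]]]| =
  #|[predD @twisted G' & [pred v | `[< D (position v) >]]]|.
Proof.
move=> hG hG' Dc DK aK; apply/eqP; rewrite eqn_leq.
rewrite (twisted_outside_le hG hG' Dc DK aK) /=.
exact: (twisted_outside_le hG' hG Dc DK (agree_on_sym aK)).
Qed.

Section Disk.
Context (c : coord_chart R B) (rho : R).
Let O := [set p : R * R | sqnorm p < rho ^+ 2].
Hypothesis rho1 : 1 < rho.
Hypothesis Oc : O `<=` cimg c.
Let D := from_plane c @` closed_disk.
Let inside (G : graph_data R B (X0 g)) : pred (vertex G) :=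
  [predI @twisted G & [pred v | `[< D (position v) >]]].
(** Every vertex in the open disk of radius [rho] then lies in [D], hence is white when [D] has no
    black vertices, and is either locally flat or the origin of a cut. *)
Definition free_collar (G : graph_data R B (X0 g)) : Prop :=
  forall (v : vertex G), cdom c (position v) -> 1 < sqnorm (to_plane c (position v)) ->
    rho ^+ 2 <= sqnorm (to_plane c (position v)).

Let rho2 : 1 < rho ^+ 2.
Proof. by have := rho1; nra. Qed.

Let D_dom p : D p -> cdom c p /\ sqnorm (to_plane c p) <= 1.
Proof.
move=> [x Dx <-]; have cx : cimg c x by apply: Oc; exact: le_lt_trans Dx rho2.
by split; [exact: from_plane_dom | rewrite from_planeK].
Qed.

Let inside_potential (G : graph_data R B (X0 g)) : is_chart S b0 (C0 g) G ->
  (forall v : vertex G, D (position v) -> ~~ black v) -> free_collar G ->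
  exists F : B -> H, forall p, O p -> (forall v : vertex G, from_plane c p <> position v) ->
  pot S phi G (fun y => z ^+ cut_count c (@inside G) p (to_plane c y) * F y)%g (from_plane c p).
Proof.
move=> hG bG cG; have [grG _ _ _] := hG.
apply: (cut_potential hausB cptB grG zC zz) => //; first by have := rho1; lra.
- move=> v /andP[_ /asboolP /D_dom[dv nv]]; split => //.
  exact: le_lt_trans nv rho2.
- move=> v /andP[/andP[bv /asboolP nfl] _]; split => //.
  exact: (white_vertex_flat hG bv).2.
- move=> v nv dv Ov.
  have Dv : D (position v).
    exists (to_plane c (position v)); last exact: to_planeK.
    rewrite /closed_disk /= leNgt; apply/negP => /(cG v dv).
    by rewrite leNgt => /negP; apply.
  apply: contrapT => nfl; move/negP: nv; apply; apply/andP; split; last exact/asboolP.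
  by apply/andP; split; [exact: bG | exact/asboolP].
Qed.

Lemma inside_parity (G G' : graph_data R B (X0 g)) (K : set B) :
  is_chart S b0 (C0 g) G -> is_chart S b0 (C0 g) G' ->
  (forall v : vertex G, D (position v) -> ~~ black v) ->
  (forall v : vertex G', D (position v) -> ~~ black v) ->
  free_collar G -> free_collar G' -> ~` D `<=` K -> agree_on K G G' ->
  odd #|@inside G| = odd #|@inside G'|.
Proof.
move=> hG hG' bG bG' cG cG' DK aK.
have [grG _ _ _] := hG; have [grG' _ _ _] := hG'.
have [F HF] := inside_potential hG bG cG.
have [F' HF'] := inside_potential hG' bG' cG'.
have dom (G1 : graph_data R B (X0 g)) (v : vertex G1) : inside v ->
    cdom c (position v) /\ sqnorm (to_plane c (position v)) <= 1.
  by move=> /andP[_ /asboolP/D_dom].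
have col (G1 : graph_data R B (X0 g)) p : free_collar G1 -> O p -> 1 < sqnorm p ->
    forall v : vertex G1, from_plane c p <> position v.
  move=> c1 Op p1 v e; have cp := Oc Op.
  have := c1 v; rewrite -e from_planeK // => /(_ (from_plane_dom cp) p1).
  by rewrite leNgt => /negP; apply.
have := @cut_parity R B S _ H phi hausB G G' grG grG' z zC zz z1 c rho rho1 Oc K DK aK
  (@inside G) (@inside G') (dom G) (dom G')
  (fun p Op p1 => conj (col G p cG Op p1) (col G' p cG' Op p1)) F F' HF HF'.
by rewrite oddD; case: odd; case: odd.
Qed.

End Disk.
End Charts.

Lemma free_collar_near (R : realType) (g : nat) (B : topologicalType)
    (c : coord_chart R B) (G : graph_data R B (X0 g)) :
  \forall rho \near (1 : R)^'+, free_collar c rho G.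
Proof.
apply: (@filter_forall _ (vertex G) (fun v (rho : R) => cdom c (position v) ->
  1 < sqnorm (to_plane c (position v)) -> rho ^+ 2 <= sqnorm (to_plane c (position v)))) => v.
set s := sqnorm _; have [s1|s1] := leP s 1; first by near=> rho => _; lra.
have sq : {for (1 : R), continuous (fun rho : R => rho * rho)}.
  by apply: cvgM; exact: cvg_id.
have lt_s : \forall rho \near (1 : R), rho ^+ 2 < s.
  by apply: (cvgr_lt _ sq); rewrite mul1r.
near=> rho => _ _; apply: ltW; near: rho; exact: cvg_within lt_s.
Unshelve. all: by end_near. Qed.

Theorem proposition4p2 (R : realType) (g : nat) (hg : (2 <= g)%N)
  (B : topologicalType) (S : oriented_surface R B) (b0 : B)
  (B_hausdorff : hausdorff_space B)
  (B_compact : compact [set: B]%classic)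
  (B_connected : connected [set: B]%classic)
  (G G' : graph_data R B (X0 g))
  (hG : is_chart S b0 (C0 g) G) (hG' : is_chart S b0 (C0 g) G')
  (hW : move_W S b0 G G') :
  w_invariant S G = w_invariant S G'.
Proof.
have [H [phi [z [zC zz z1 r4z relz]]]] := braid_extension hg.
rewrite (w_invariant_twisted B_hausdorff B_compact zC zz z1 relz r4z hG).
rewrite (w_invariant_twisted B_hausdorff B_compact zC zz z1 relz r4z hG').
have [c [[Sc Dc nb0] [_ _ aK bG bG']]] := hW.
pose D := from_plane c @` closed_disk.
(* The graphs agree outside the open disk; the complement of [D] is the open part of this region
   used for comparing germs. *)
have DK : ~` D `<=` ~` (from_plane c @` open_disk).
  by move=> p nD [x ox xp]; apply: nD; exists x => //; exact: ltW.
have D_closed : closed D.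
  apply: compact_closed => //; apply: continuous_compact; last exact: closed_disk_compact.
  apply: continuous_in_subspaceT => p; rewrite inE => Dp.
  by apply: from_continuous; exact: Dc.
near (1 : R)^'+ => rho.
have rho1 : 1 < rho by near: rho; exact: nbhs_right_gt.
have Oc : forall p, sqnorm p < rho ^+ 2 -> cimg c p.
  by near: rho; apply: disk_collar; [exact: cimg_open | exact: Dc].
have cG : free_collar c rho G by near: rho; exact: free_collar_near.
have cG' : free_collar c rho G' by near: rho; exact: free_collar_near.
have out := twisted_outside phi hG hG' D_closed DK aK.
have par := inside_parity B_hausdorff B_compact zC zz z1 relz r4z rho1 Oc hG hG' bG bG' cG cG' DK aK.
(* Twisted vertices are counted separately in [D] and outside: outside, the numbers are equal,
   whereas in [D] only their parities are. *)
rewrite -(cardID [pred v | `[< D (position v) >]] (@twisted _ _ _ _ _ phi G)).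
rewrite -(cardID [pred v | `[< D (position v) >]] (@twisted _ _ _ _ _ phi G')).
rewrite !natrD out; congr (_ + _).
apply: val_inj; rewrite /= !val_Zp_nat // !modn2.
by congr nat_of_bool; exact: par.
Unshelve. all: by end_near. Qed.
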